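(* Let $d\ge 3$ and let $k,l\in\mathbb{N}=\{0,1,2,\dots\}$. If $\phi\in V_{k,l}$, then $$N\phi=\lambda_{k,l}\,\phi,$$ where $\lambda_{k,l}>0$ is given by the integral $$\lambda_{k,l}=\sqrt{\pi}\int_{\mathbb{S}^{d-1}}(1-v_1^2)^k(1-v_1^2+iv_1v_2)^l\,d\mathbb{S}^{d-1}(v),$$ with $v=(v_1,v_2,\dots,v_d)$ the standard coordinates on $\mathbb{S}^{d-1}\subset\mathbb{R}^d$.
   Context: Write $z\in\mathbb{R}^d$ in spherical coordinates $(\rho,\omega)\in[0,\infty)\times\mathbb{S}^{d-1}$, $\rho=|z|$, and let $d\mathbb{S}^{d-1}$ (also written $dv$) be the standard surface measure on the unit sphere. Let $\mathcal{G}=\{(v,p)\in\mathbb{S}^{d-1}\times\mathbb{R}^d : v\cdot p=0\}$. For $f$ on $\mathbb{R}^d$ and $g$ on $\mathcal{G}$ set $$I_0f(v,p)=\int_{\mathbb{R}}f(p+tv)\,dt,\qquad I_0^\sharp g(z)=\int_{\mathbb{S}^{d-1}}g(v,z-(z\cdot v)v)\,dv.$$ The operator $N$ is $N=e^{-\rho^2/2}I_0^\sharp e^{|p|^2}I_0e^{-\rho^2/2}$, where exponentials denote multiplication operators ($e^{-\rho^2/2}$ on functions on $\mathbb{R}^d$, $e^{|p|^2}$ on functions of $(v,p)\in\mathcal{G}$). $L_k^{(\alpha)}$ denotes the generalized Laguerre polynomial of degree $k$ (orthogonal with respect to the weight $x^\alpha e^{-x}$ on $(0,\infty)$), and $\Delta_{\mathbb{S}^{d-1}}$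 the Laplace–Beltrami operator on $\mathbb{S}^{d-1}$. Define $$V_{k,l}=\{e^{-\rho^2/2}L_k^{(l+\frac d2-1)}(\rho^2)\,\rho^l\,Y_l(\omega) : -\Delta_{\mathbb{S}^{d-1}}Y_l=l(l+d-2)Y_l\}.$$ *)

(* Defs.v *)
From HB Require Import structures.
From mathcomp Require Import all_boot all_order all_algebra.
From mathcomp Require Import complex.
From mathcomp Require Import all_classical all_reals all_analysis.
From mathcomp Require Import measurable_realfun.

Set Implicit Arguments.
Unset Strict Implicit.
Unset Printing Implicit Defensive.

Import Order.TTheory GRing.Theory Num.Theory.
Import numFieldNormedType.Exports.

Local Open Scope classical_set_scope.
Local Open Scope complex_scope.
Local Open Scope ring_scope.

(* The sigma-algebra on R^n is the one generated by the coordinates, that is,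
   the Borel sigma-algebra. *)
Section rV_measurable.
Context (R : realType) (n : nat).

Let coor : 'I_n -> 'rV[R]_n -> R := fun i x => x ord0 i.

Let rV_set0 : g_sigma_preimage coor set0.
Proof. exact: sigma_algebra0. Qed.

Let rV_setC A : g_sigma_preimage coor A -> g_sigma_preimage coor (~` A).
Proof. exact: sigma_algebraC. Qed.

Let rV_bigcup (F : (set 'rV[R]_n)^nat) :
  (forall i, g_sigma_preimage coor (F i)) ->
  g_sigma_preimage coor (\bigcup_i (F i)).
Proof. exact: sigma_algebra_bigcup. Qed.

HB.instance Definition _ := @isMeasurable.Build default_measure_display
  'rV[R]_n (g_sigma_preimage coor) rV_set0 rV_setC rV_bigcup.

Lemma measurable_coor (i : 'I_n) :
  measurable_fun [set: 'rV[R]_n] (fun x : 'rV[R]_n => x ord0 i).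
Proof.
move=> _ Y mY; rewrite setTI; apply: sub_sigma_algebra => /=.
rewrite -bigcup_seq/=; exists i => /=; first by rewrite mem_index_enum.
by exists Y => //; rewrite setTI.
Qed.

Lemma measurable_fun_rV d (T : measurableType d) (f : T -> 'rV[R]_n) :
  (forall i, measurable_fun [set: T] (fun x => f x ord0 i)) ->
  measurable_fun [set: T] f.
Proof.
move=> mf.
suff : g_sigma_preimage (fun i => coor i \o f) `<=` measurable.
  by rewrite g_sigma_preimage_comp => prefS _ A mA; apply: prefS; exists A.
apply: smallest_sub; first exact: sigma_algebra_measurable.
case: n f mf @coor => [|m] f mf coor'; first by rewrite big_ord0.
rewrite -bigcup_mkord_ord; apply: bigcup_sub => i Ii.
by move=> A [B mB <-]; exact: mf.
Qed.

End rV_measurable.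

Section lebesgue_rV.
Context (R : realType).

Definition rV_cons n (p : measurableTypeR R * 'rV[R]_n) : 'rV[R]_n.+1 :=
  \row_i (if unlift ord0 i is Some j then p.2 ord0 j else p.1).

Lemma measurable_rV_cons n : measurable_fun setT (@rV_cons n).
Proof.
apply: measurable_fun_rV => i; case: (unliftP ord0 i) => [j|] ->.
- rewrite (_ : (fun _ => _) = (fun x : 'rV[R]_n => x ord0 j) \o snd).
    exact: measurableT_comp (measurable_coor j) measurable_snd.
  by apply/funext => p; rewrite mxE liftK.
- rewrite (_ : (fun _ => _) = fst); first exact: measurable_fst.
  by apply/funext => p; rewrite mxE unlift_none.
Qed.

HB.instance Definition _ n :=
  isMeasurableFun.Build _ _ _ _ (@rV_cons n) (@measurable_rV_cons n).

Section lebesgue_rVS.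
Context (n : nat) (mu : {sigma_finite_measure set 'rV[R]_n -> \bar R}).

Definition lebesgue_rVS : set 'rV[R]_n.+1 -> \bar R :=
  pushforward (lebesgue_measure \x mu)%E (@rV_cons n).

Let lebesgue_rVS0 : lebesgue_rVS set0 = 0%E.
Proof. exact: measure0. Qed.

Let lebesgue_rVS_ge0 A : (0 <= lebesgue_rVS A)%E.
Proof. exact: measure_ge0. Qed.

Let lebesgue_rVS_sigma_additive : semi_sigma_additive lebesgue_rVS.
Proof. exact: measure_semi_sigma_additive. Qed.

HB.instance Definition _ := isMeasure.Build _ _ _ lebesgue_rVS
  lebesgue_rVS0 lebesgue_rVS_ge0 lebesgue_rVS_sigma_additive.

Let lebesgue_rVS_sigma_finite : sigma_finite setT lebesgue_rVS.
Proof.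
have [F UF mF] : sigma_finite setT (lebesgue_measure \x mu)%E.
  have /sigma_finiteP[F [TF ndF Foo]] := sigma_finiteT (@lebesgue_measure R).
  have /sigma_finiteP[G [TG ndG Goo]] := sigma_finiteT mu.
  exists (fun k => F k `*` G k).
    rewrite -setXTT TF TG predeqE => -[x y]; split.
      move=> [/= [k _ Fkx] [m _ Gmy]]; exists (maxn k m) => //; split.
      - by move: x Fkx; exact/subsetPset/ndF/leq_maxl.
      - by move: y Gmy; exact/subsetPset/ndG/leq_maxr.
    by move=> [k _ []/= ? ?]; split; exists k.
  move=> k; have [? ?] := Foo k; have [? ?] := Goo k.
  split; first exact: measurableX.
  by rewrite product_measure1E// lte_mul_pinfty// ge0_fin_numE.
pose u (x : 'rV[R]_n.+1) := (x ord0 ord0, \row_j x ord0 (lift ord0 j)).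
have mu_ : measurable_fun setT u.
  apply/measurable_fun_pair; first exact: measurable_coor.
  apply: measurable_fun_rV => j; under eq_fun do rewrite mxE.
  exact: measurable_coor.
have uK : cancel (@rV_cons n) u.
  move=> [t x]; rewrite /u mxE unlift_none; congr (_, _).
  by apply/rowP => j; rewrite mxE mxE liftK.
exists (fun k => u @^-1` F k); first by rewrite -preimage_bigcup -UF preimage_setT.
move=> k; have [mFk Fkoo] := mF k; split.
  by rewrite -[X in measurable X]setTI; exact: mu_.
rewrite /lebesgue_rVS /pushforward -comp_preimage.
by rewrite (_ : u \o _ = id) // funeqE => p /=; exact: uK.
Qed.

HB.instance Definition _ := Measure_isSigmaFinite.Build _ _ _ lebesgue_rVS
  lebesgue_rVS_sigma_finite.

End lebesgue_rVS.

Fixpoint lebesgue_rV n : {sigma_finite_measure set 'rV[R]_n -> \bar R} :=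
  match n with
  | 0%N => \d_(0 : 'rV[R]_0)
  | m.+1 => lebesgue_rVS (lebesgue_rV m)
  end.

Lemma lebesgue_rV_box n (A : 'I_n -> set R) : (forall i, measurable (A i)) ->
  lebesgue_rV n [set x | forall i, A i (x ord0 i)] =
  (\prod_(i < n) lebesgue_measure (A i))%E.
Proof.
elim: n A => [A mA|n IHn A mA].
  by rewrite big_ord0 /= diracE mem_set // => -[].
pose B := [set x : 'rV[R]_n | forall i, A (lift ord0 i) (x ord0 i)].
have mB : measurable B.
  rewrite (_ : B = \bigcap_(i in [set: 'I_n])
    ((fun x : 'rV[R]_n => x ord0 i) @^-1` A (lift ord0 i))); last first.
    by apply/seteqP; split => [x Ax i _|x Ax i]; exact: Ax.
  apply: fin_bigcap_measurable => // i _.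
  by rewrite -[X in measurable X]setTI; exact: measurable_coor.
rewrite big_ord_recl -(IHn (fun i => A (lift ord0 i)))//.
have := @product_measure1E _ _ _ _ _ (@lebesgue_measure R) (lebesgue_rV n)
  (A ord0) B (mA ord0) mB.
rewrite -/B => <-; rewrite /= /lebesgue_rVS /pushforward.
congr product_measure1; apply/seteqP; split => -[t x] /=.
  move=> Ax; split; first by have := Ax ord0; rewrite mxE unlift_none.
  by move=> i; have := Ax (lift ord0 i); rewrite mxE liftK.
by move=> [At Ax] i; rewrite mxE; case: unliftP => [j|] ->.
Qed.

End lebesgue_rV.

Section sphere.
Context (R : realType) (d : nat).
Implicit Types x y z v : 'rV[R]_d.

Definition dot x y : R := \sum_(i < d) x ord0 i * y ord0 i.

(* The library norm on 'rV is the sup norm, hence this Euclidean norm. *)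
Definition enorm x : R := Num.sqrt (dot x x).

Definition sphere : set 'rV[R]_d := [set v | enorm v = 1].

Definition dir x : 'rV[R]_d := (enorm x)^-1 *: x.

(* The part of the open cone over A that lies in the closed unit ball. *)
Definition cone (A : set 'rV[R]_d) : set 'rV[R]_d :=
  [set x | 0 < enorm x <= 1 /\ A (dir x)].

(* By integration in polar coordinates, the volume of cone A is the surface
   area of A times \int_0^1 r^(d-1) dr = 1/d. *)
Definition surface_measure (A : set 'rV[R]_d) : \bar R :=
  (d%:R%:E * lebesgue_rV R d (cone A))%E.

Lemma measurable_enorm : measurable_fun setT enorm.
Proof.
rewrite (_ : enorm = (fun a => a `^ 2^-1) \o (fun x => dot x x)); last first.
  apply/funext => x; rewrite /= powR12_sqrt//.
  by apply: sumr_ge0 => i _; exact: sqr_ge0.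
apply: measurableT_comp => //; apply: measurable_sum => i.
by apply: measurable_funM; exact: measurable_coor.
Qed.

Lemma measurable_dir : measurable_fun setT dir.
Proof.
apply: measurable_fun_rV => i.
rewrite (_ : (fun _ => _) = (fun x => enorm x `^ (-1) * x ord0 i)); last first.
  by apply/funext => x; rewrite mxE powR_inv1// sqrtr_ge0.
apply: measurable_funM; last exact: measurable_coor.
apply: (measurableT_comp (measurable_powR _)) => //; exact: measurable_enorm.
Qed.

HB.instance Definition _ := isMeasurableFun.Build _ _ _ _ dir measurable_dir.

Let measurable_ball0 : measurable [set x | 0 < enorm x <= 1].
Proof.
rewrite (_ : mkset _ = enorm @^-1` `]0, 1]%classic); last first.
  by apply/seteqP; split => x /=; rewrite in_itv.
by rewrite -[X in measurable X]setTI; exact: measurable_enorm.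
Qed.

Let cone_measure :=
  pushforward (mrestr (lebesgue_rV R d) measurable_ball0) dir.

Let cone_measure0 : cone_measure set0 = 0%E.
Proof. exact: measure0. Qed.

Let cone_measure_ge0 A : (0 <= cone_measure A)%E.
Proof. exact: measure_ge0. Qed.

Let cone_measure_sigma_additive : semi_sigma_additive cone_measure.
Proof. exact: measure_semi_sigma_additive. Qed.

HB.instance Definition _ := isMeasure.Build _ _ _ cone_measure
  cone_measure0 cone_measure_ge0 cone_measure_sigma_additive.

Let surface_measureE : surface_measure = mscale (d%:R)%:nng cone_measure.
Proof.
apply/funext => A; rewrite /surface_measure /mscale /=.
congr (_ * _)%E; rewrite /cone_measure /pushforward /mrestr.
by congr (lebesgue_rV R d _); apply/seteqP; split => x [].
Qed.

Let surface_measure0 : surface_measure set0 = 0%E.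
Proof. by rewrite surface_measureE; exact: measure0. Qed.

Let surface_measure_ge0 A : (0 <= surface_measure A)%E.
Proof. by rewrite surface_measureE; exact: measure_ge0. Qed.

Let surface_measure_sigma_additive : semi_sigma_additive surface_measure.
Proof. by rewrite surface_measureE; exact: measure_semi_sigma_additive. Qed.

HB.instance Definition _ := isMeasure.Build _ _ _ surface_measure
  surface_measure0 surface_measure_ge0 surface_measure_sigma_additive.

End sphere.

Definition Cintegral dT (T : measurableType dT) (R : realType)
    (mu : {measure set T -> \bar R}) (D : set T) (f : T -> R[i]) : R[i] :=
  (\int[mu]_(x in D) complex.Re (f x)) +i* (\int[mu]_(x in D) complex.Im (f x)).

Section xray.
Context (R : realType) (d : nat).
Local Notation V := 'rV[R]_d.

Definition I0 (f : V -> R[i]) (v p : V) : R[i] :=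
  Cintegral lebesgue_measure setT (fun t : R => f (p + t *: v)).

(* g is only evaluated at pairs (v, p) with |v| = 1 and v . p = 0. *)
Definition I0sharp (g : V -> V -> R[i]) (z : V) : R[i] :=
  Cintegral (@surface_measure R d) (@sphere R d)
    (fun v => g v (z - dot z v *: v)).

Definition gauss (f : V -> R[i]) (z : V) : R[i] :=
  (expR (- (enorm z ^+ 2 / 2)))%:C * f z.

Definition exp_sqr_mul (g : V -> V -> R[i]) (v p : V) : R[i] :=
  (expR (enorm p ^+ 2))%:C * g v p.

Definition Nop (f : V -> R[i]) : V -> R[i] :=
  gauss (I0sharp (exp_sqr_mul (I0 (gauss f)))).

End xray.

Section laplace_beltrami.
Context (R : realType) (d : nat).
Local Notation V := 'rV[R]_d.
Local Notation e_ := (fun j : 'I_d => delta_mx ord0 j : V).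

(* Functions and vector fields on the sphere are extended to R^d \ {0} as
   positively homogeneous functions of degree 0.  At a point w of the sphere
   the Euclidean gradient of the extension of f is the Riemannian gradient
   of f; the Euclidean divergence of the extension of a tangent vector field
   is its Riemannian divergence, because the radial derivative vanishes. *)
Definition hom0 (T : Type) (f : V -> T) : V -> T := f \o @dir R d.

Definition sphere_grad (f : V -> R) (w : V) : V :=
  \row_j 'D_(e_ j) (hom0 f) w.

Definition sphere_div (X : V -> V) (w : V) : R :=
  \sum_(j < d) 'D_(e_ j) (fun x => hom0 X x ord0 j) w.

Definition laplace_beltrami (f : V -> R) : V -> R :=
  sphere_div (sphere_grad f).

Definition laplace_beltramiC (Y : V -> R[i]) (w : V) : R[i] :=
  laplace_beltrami (fun x => complex.Re (Y x)) w +i*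
  laplace_beltrami (fun x => complex.Im (Y x)) w.

Definition sphere_C2 (f : V -> R) : Prop :=
  forall (i j : 'I_d) (x : V), x != 0 ->
  [/\ derivable (hom0 f) x (e_ i),
      {for x, continuous ('D_(e_ i) (hom0 f))},
      derivable ('D_(e_ i) (hom0 f)) x (e_ j) &
      {for x, continuous ('D_(e_ j) ('D_(e_ i) (hom0 f)))}].

Definition spherical_harmonic (l : nat) (Y : V -> R[i]) : Prop :=
  [/\ sphere_C2 (fun x => complex.Re (Y x)), sphere_C2 (fun x => complex.Im (Y x)) &
      forall w : V, sphere w ->
        - laplace_beltramiC Y w = (l%:R * (l%:R + d%:R - 2)) * Y w].

End laplace_beltrami.

Section laguerre.
Context (R : realType).

Definition gbinomial (a : R) (m : nat) : R :=
  (\prod_(j < m) (a - j%:R)) / m`!%:R.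

(* L_k^(alpha)(x) = sum_(i <= k) (-1)^i binom(k + alpha, k - i) x^i / i! *)
Definition laguerre (k : nat) (alpha : R) : {poly R} :=
  \poly_(i < k.+1) ((-1) ^+ i * gbinomial (k%:R + alpha) (k - i) / i`!%:R).

End laguerre.

Section eigen.
Context (R : realType) (d : nat).
Local Notation V := 'rV[R]_d.

(* Membership is stated in spherical coordinates (rho, w), rho >= 0, so that
   no direction has to be assigned to the origin. *)
Definition Vkl (k l : nat) : set (V -> R[i]) :=
  [set phi | exists2 Y, spherical_harmonic l Y &
    forall (rho : R) (w : V), 0 <= rho -> sphere w ->
      phi (rho *: w) =
      (expR (- (rho ^+ 2 / 2)) *
       (laguerre k (l%:R + d%:R / 2 - 1)).[rho ^+ 2] * rho ^+ l)%:C * Y w].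

Definition lambda (hd : (3 <= d)%N) (k l : nat) : R[i] :=
  let i1 : 'I_d := Ordinal (ltnW (ltnW hd)) in
  let i2 : 'I_d := Ordinal (ltnW hd) in
  (Num.sqrt pi)%:C * Cintegral (@surface_measure R d) (@sphere R d)
    (fun v => ((1 - v ord0 i1 ^+ 2) ^+ k)%:C *
      ((1 - v ord0 i1 ^+ 2) +i* (v ord0 i1 * v ord0 i2)) ^+ l).

End eigen.

(* Main.v *)
Require Import Defs.
From HB Require Import structures.
From mathcomp Require Import all_boot all_order all_algebra.
From mathcomp Require Import complex.
From mathcomp Require Import all_classical all_reals all_analysis.
From mathcomp Require Import measurable_realfun ring lra zify.

(** Let F be an eigenfunction of the Laplacian on the sphere for the eigenvalue
    -l(l+d-2), and for v on the sphere let q be the component of x orthogonal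
    to v.  Integrating by parts along rotations shows that the moments
    T_m(z) = \int F(x) (z . x)^m dx and
    G_(m,p)(z) = \iint F(x) (z . q)^m |q|^(2p) dx dv
    satisfy the same two-term recurrence in m.  Hence T_m = 0 for m < l, F is a
    multiple of T_l on the sphere (the kernels (z . x)^m concentrate at z), and
    if G_(l,k) = r T_l then G_(m,p) = r T_m whenever m + 2p = l + 2k.  Fubini
    and rotation invariance identify r with lambda / sqrt pi, and expanding
    the integrand of lambda in powers of (v_1 + i v_2)^2 shows r > 0.

    With N0 = l + 2k and h_N the coefficients of the Hermite polynomial of
    degree N0, the function e^(rho^2/2) phi is a multiple of
    \sum_N h_N T_(N0-2N).  Along a line of direction v the Gaussian integral
    turns H(x) into the homogenized polynomial H(z . q, |q|^2), so that N
    replaces T_(N0-2N) by sqrt pi G_(N0-2N,N), that is, by sqrt pi r T_(N0-2N). *)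

Set Implicit Arguments.
Unset Strict Implicit.
Unset Printing Implicit Defensive.

Import Order.TTheory GRing.Theory Num.Theory.
Import numFieldNormedType.Exports.

Local Open Scope classical_set_scope.
Local Open Scope ring_scope.

(** The functions Y in [Vkl] are known only as C^2 eigenfunctions of a Laplacian written with
    partial derivatives; that they come from homogeneous polynomials has to be earned. T_l does
    this: it is visibly a homogeneous polynomial of degree l, and once F is a multiple of it, all
    that remains is identities between integrals. Rotations replace Stokes' theorem: moving a
    rotation from F to z uses only the invariance of the measure. The surface measure is defined by
    cones, so its invariance comes from Lebesgue measure, an iterated product, where a rotation is
    handled as a product of shears.

    Hermite polynomials enter because the exponentials cancel on each line. For p orthogonal to v,
    the factor e^(-|p + t v|^2/2) occurs twice, once in N and once in phi, and gives e^(-|p|^2)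
    e^(-t^2), whose first factor e^(|p|^2) removes. Averaging a Hermite polynomial of w . (p + t v)
    against e^(-t^2) lowers its variance from 1 to 1 - (v . w)^2, which is |q|^2 for the component q
    of w orthogonal to v. So only the G_(m,p) with m + 2p = l + 2k occur, exactly those that share
    the ratio r. *)

(** * Measure-preserving maps and rotation invariance of Lebesgue measure *)

Definition preserves d (T : measurableType d) (R : realType)
    (mu : set T -> \bar R) (f : T -> T) :=
  measurable_fun setT f /\ forall A, measurable A -> mu (f @^-1` A) = mu A.

Section preserves.
Context d (T : measurableType d) (R : realType) (mu : set T -> \bar R).

Lemma preserves_id : preserves mu id.
Proof. by split => //; exact: measurable_id. Qed.

Lemma preserves_comp f g :
  preserves mu f -> preserves mu g -> preserves mu (f \o g).
Proof.
move=> [mf fE] [mg gE]; split; first exact: measurableT_comp.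
move=> A mA; rewrite comp_preimage gE ?fE//.
by rewrite -[X in measurable X]setTI; exact: mf.
Qed.

End preserves.

Section skew.
Context d1 d2 (T1 : measurableType d1) (T2 : measurableType d2) (R : realType).
Variables (m1 : {sigma_finite_measure set T1 -> \bar R})
  (m2 : {sigma_finite_measure set T2 -> \bar R}).

(** The section over t of the preimage of A is the preimage under h t of the section of A, so the
    integrands defining the two measures agree pointwise. *)
Lemma preserves_skewr (h : T1 -> T2 -> T2) :
  measurable_fun setT (fun p : T1 * T2 => h p.1 p.2) ->
  (forall t, preserves m2 (h t)) ->
  preserves (m1 \x m2)%E (fun p => (p.1, h p.1 p.2)).
Proof.
move=> mh hE; split; first exact: measurable_fun_pair.
move=> A mA; rewrite /product_measure1; apply: eq_integral => t _ /=.
rewrite -[RHS](hE t).2; last exact: measurable_xsection.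
congr (m2 _); apply/seteqP; split => x /=; rewrite /xsection /= !inE//.
Qed.

Lemma preserves_skewl (h : T2 -> T1 -> T1) :
  measurable_fun setT (fun p : T1 * T2 => h p.2 p.1) ->
  (forall t, preserves m1 (h t)) ->
  preserves (m1 \x m2)%E (fun p => (h p.2 p.1, p.2)).
Proof.
move=> mh hE.
have mg : measurable_fun setT (fun p : T1 * T2 => (h p.2 p.1, p.2)).
  exact: measurable_fun_pair.
split => // A mA.
(* The product measure is defined by slicing at fixed first coordinate, but here the fibres lie over
   the second one; uniqueness of the product measure exchanges the two slicings. *)
have E B : measurable B -> (m1 \x m2)%E B = (m1 \x^ m2)%E B.
  move=> mB; apply: product_measure_unique => // C D mC mD /=.
  by rewrite product_measure2E.
rewrite [LHS]E; last by rewrite -[X in measurable X]setTI; exact: mg.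
rewrite [RHS]E// /product_measure2; apply: eq_integral => x _ /=.
rewrite -[RHS](hE x).2; last exact: measurable_ysection.
congr (m1 _); apply/seteqP; split => t /=; rewrite /ysection /= !inE//.
Qed.

End skew.

Section lebesgue_rV_invariance.
Context (R : realType).
Local Notation lebR := (@lebesgue_measure R).

Lemma lebesgue_measure_translation (a : R) :
  preserves lebR (fun t : measurableTypeR R => t + a : measurableTypeR R).
Proof.
have mf : measurable_fun setT (fun t : measurableTypeR R => t + a : measurableTypeR R).
  by apply: measurable_funD => //; exact: measurable_cst.
split => // A mA.
pose f : measurableTypeR R -> measurableTypeR R := fun t => t + a.
have := @lebesgue_measure_unique R
  (measure_function_pushforward__canonical__measure_function_Measure lebR mf).
rewrite /= /pushforward => H; symmetry; apply: H mA => X [[x y]] _ <-; rewrite -/f.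
have -> : f @^-1` `]x, y]%classic = `]x - a, y - a]%classic.
  by apply/seteqP; split => t; rewrite /f /= !in_itv/= ltrBlDr lerBrDr.
rewrite !lebesgue_measure_itv/= !lte_fin ltrD2r.
by case: ifP => // _; rewrite -!EFinB; congr _%:E; lra.
Qed.

Lemma preserves_rV_cons n (g : measurableTypeR R * 'rV[R]_n -> measurableTypeR R * 'rV[R]_n)
    (f : 'rV[R]_n.+1 -> 'rV[R]_n.+1) :
  measurable_fun setT f ->
  preserves (lebR \x lebesgue_rV R n)%E g ->
  (forall p, f (rV_cons p) = rV_cons (g p)) ->
  preserves (lebesgue_rV R n.+1) f.
Proof.
move=> mf [mg gE] fg; split => // A mA.
rewrite /= /lebesgue_rVS /pushforward/=.
rewrite -[RHS]gE; last first.
  by rewrite -[X in measurable X]setTI; exact: measurable_rV_cons.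
by congr product_measure1; apply/seteqP; split => p /=; rewrite fg.
Qed.

Lemma measurable_rV_add n (a : 'rV[R]_n) : measurable_fun setT (fun x : 'rV[R]_n => x + a).
Proof.
apply: measurable_fun_rV => i; under eq_fun do rewrite mxE.
by apply: measurable_funD => //; exact: measurable_coor.
Qed.

Lemma lebesgue_rV_translation n (a : 'rV[R]_n) :
  preserves (lebesgue_rV R n) (fun x => x + a).
Proof.
elim: n a => [a|n IHn a].
  rewrite (_ : (fun _ => _) = id); first exact: preserves_id.
  by apply/funext => x; apply/rowP => -[].
pose a' : 'rV[R]_n := \row_j a ord0 (lift ord0 j).
apply: (@preserves_rV_cons _ ((fun p => (p.1, p.2 + a')) \o (fun p => (p.1 + a ord0 ord0 : measurableTypeR R, p.2)))).
- exact: measurable_rV_add.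
- apply: preserves_comp.
    apply: (@preserves_skewr _ _ _ _ _ lebR (lebesgue_rV R n) (fun _ x => x + a')).
      apply: (measurableT_comp (measurable_rV_add _)); exact: measurable_snd.
    by move=> t; exact: IHn.
  apply: (@preserves_skewl _ _ _ _ _ lebR (lebesgue_rV R n) (fun _ t => t + a ord0 ord0)).
    apply: measurable_funD => //; exact: measurable_fst.
  by move=> _; exact: lebesgue_measure_translation.
- move=> p; apply/rowP => i; rewrite !mxE.
  by case: (unliftP ord0 i) => [j|] ->; rewrite ?mxE.
Qed.

Definition shear n (i j : 'I_n) (c : R) (x : 'rV[R]_n) : 'rV[R]_n :=
  x + (c * x ord0 j) *: delta_mx ord0 i.

Lemma measurable_shear n (i j : 'I_n) c : measurable_fun setT (shear i j c).
Proof.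
apply: measurable_fun_rV => k; under eq_fun do rewrite !mxE.
apply: measurable_funD => //; first exact: measurable_coor.
apply: measurable_funM => //; apply: measurable_funM => //.
exact: measurable_coor.
Qed.

(** Split off the first coordinate. If it is neither i nor j, the shear acts on the tail
    (induction); if it is j, the tail is translated by an amount depending on the head; if it is i,
    the head is translated by an amount depending on the tail. *)
Lemma lebesgue_rV_shear n (i j : 'I_n) c : i != j ->
  preserves (lebesgue_rV R n) (shear i j c).
Proof.
elim: n i j => [[]//|n IHn i j].
have [i'|] := unliftP ord0 i; have [j'|] := unliftP ord0 j => -> ->.
- rewrite (inj_eq lift_inj) => ij.
  apply: (@preserves_rV_cons _ (fun p => (p.1, shear i' j' c p.2))).
  + exact: measurable_shear.
  + apply: (@preserves_skewr _ _ _ _ _ lebR (lebesgue_rV R n) (fun _ x => shear i' j' c x)).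
      apply: (measurableT_comp (measurable_shear _ _ _)); exact: measurable_snd.
    by move=> t; exact: IHn.
  + move=> p; apply/rowP => k; rewrite !mxE liftK.
    case: (unliftP ord0 k) => [k'|] -> ; rewrite ?mxE ?(inj_eq lift_inj)//.
    by rewrite eqE/= mulr0 addr0.
- move=> _.
  apply: (@preserves_rV_cons _ (fun p => (p.1, p.2 + (c * p.1) *: delta_mx ord0 i'))).
  + exact: measurable_shear.
  + apply: (@preserves_skewr _ _ _ _ _ lebR (lebesgue_rV R n)
      (fun t x => x + (c * t) *: delta_mx ord0 i')).
      apply: (@measurable_fun_rV R n _ (measurableTypeR R * 'rV[R]_n)%type) => k; under eq_fun do rewrite !mxE.
      apply: measurable_funD.
        by apply: (measurableT_comp (measurable_coor _)); exact: measurable_snd.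
      apply: measurable_funM => //; apply: measurable_funM => //.
    by move=> t; exact: lebesgue_rV_translation.
  + move=> p; apply/rowP => k; rewrite !mxE unlift_none.
    case: (unliftP ord0 k) => [k'|] -> ; rewrite ?mxE ?(inj_eq lift_inj)//.
    by rewrite eqE/= mulr0 addr0.
- move=> _.
  apply: (@preserves_rV_cons _ (fun p => (p.1 + c * p.2 ord0 j' : measurableTypeR R, p.2))).
  + exact: measurable_shear.
  + apply: (@preserves_skewl _ _ _ _ _ lebR (lebesgue_rV R n)
      (fun x t => t + c * x ord0 j')).
      apply: measurable_funD; first exact: measurable_fst.
      apply: measurable_funM => //.
      by apply: (measurableT_comp (measurable_coor _)); exact: measurable_snd.
    by move=> t; exact: lebesgue_measure_translation.
  + move=> p; apply/rowP => k; rewrite !mxE liftK.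
    case: (unliftP ord0 k) => [k'|] -> ; rewrite ?mxE//.
      by rewrite eqE/= mulr0 addr0.
    by rewrite eqxx mulr1.
- by rewrite eqxx.
Qed.

(* Rotation by an angle with cosine c and sine s in the oriented (i, j)-plane. *)
Definition givens n (i j : 'I_n) (c s : R) (x : 'rV[R]_n) : 'rV[R]_n :=
  x + ((c - 1) * x ord0 i - s * x ord0 j) *: delta_mx ord0 i +
      (s * x ord0 i + (c - 1) * x ord0 j) *: delta_mx ord0 j.

(** The three-shear factorization of a plane rotation; s / (1 + c) is the tangent of half the
    angle. *)
Lemma givens_shear n (i j : 'I_n) c s : i != j -> c ^+ 2 + s ^+ 2 = 1 ->
  1 + c != 0 ->
  givens i j c s =
  shear i j (- (s / (1 + c))) \o shear j i s \o shear i j (- (s / (1 + c))).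
Proof.
move=> ij cs c1; set t := s / (1 + c).
have tc : t * (1 + c) = s by rewrite /t divfK.
have st : s * t = 1 - c.
  apply: (mulIf c1); rewrite -mulrA tc; lra.
apply/funext => x; apply/rowP => k; rewrite /givens /shear /= !mxE !eqxx/= [j == i]eq_sym (negbTE ij).
have [->|ki] := eqVneq k i.
  rewrite (negbTE ij)/=.
  transitivity (x ord0 i - (s * t) * x ord0 i - t * (1 + c) * x ord0 j).
    by rewrite st tc; ring.
  transitivity (x ord0 i - t * x ord0 j - s * t * x ord0 i -
    t * (x ord0 j - s * t * x ord0 j)); last ring.
  by rewrite st; ring.
have [->|kj] := eqVneq k j; last by rewrite ?(negbTE ki)/=; ring.
transitivity (x ord0 j + s * x ord0 i - s * t * x ord0 j); last by rewrite ?eqxx ?(negbTE ki)/=; ring.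
by rewrite st ?eqxx ?(negbTE ki)/=; ring.
Qed.

Lemma givens_comp n (i j : 'I_n) c s c' s' : i != j ->
  givens i j c s \o givens i j c' s' =
  givens i j (c * c' - s * s') (s * c' + c * s').
Proof.
move=> ij; apply/funext => x; apply/rowP => k; rewrite /givens /= !mxE.
rewrite !eqxx/= [j == i]eq_sym (negbTE ij).
have [->|ki] := eqVneq k i; first by rewrite (negbTE ij)/=; ring.
by have [->|kj] := eqVneq k j; rewrite /=; ring.
Qed.

Lemma lebesgue_rV_givens n (i j : 'I_n) c s : i != j -> c ^+ 2 + s ^+ 2 = 1 ->
  preserves (lebesgue_rV R n) (givens i j c s).
Proof.
move=> ij cs.
have main a b : a ^+ 2 + b ^+ 2 = 1 -> 1 + a != 0 ->
    preserves (lebesgue_rV R n) (givens i j a b).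
  move=> ab a1; rewrite givens_shear//.
  have ji : j != i by rewrite eq_sym.
  by do 2 (apply: preserves_comp; last exact: lebesgue_rV_shear);
    exact: lebesgue_rV_shear.
(* The half turn has no half-angle tangent; it is the square of a quarter turn. *)
have [c1|] := eqVneq (1 + c) 0; last exact: main.
have c_1 : c = -1 by apply/eqP; rewrite -addr_eq0 addrC c1.
have s0 : s = 0 by apply/eqP; rewrite -sqrf_eq0; apply/eqP; move: cs; rewrite c_1; lra.
rewrite (_ : givens i j c s = givens i j 0 1 \o givens i j 0 1).
  by apply: preserves_comp; apply: main; rewrite ?expr0n/= ?expr1n ?add0r ?addr0 ?oner_neq0.
by rewrite givens_comp// c_1 s0; congr givens; ring.
Qed.

End lebesgue_rV_invariance.

(** * Bounded measurable functions on a set of finite measure *)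

Section bounded_measurable.
Context d (T : measurableType d) (R : realType).
Variable D : set T.
Implicit Types f g : T -> R.

(** Unlike integrability, this is stable under products, and it implies integrability on a set of
    finite measure. It serves as the side condition for all integrals over spheres. *)
Definition bmf f := measurable_fun D f /\ exists M, forall x, D x -> `|f x| <= M.

Lemma bmf_cst c : bmf (fun=> c).
Proof. by split; [exact: measurable_cst|exists `|c|]. Qed.

Lemma bmfD f g : bmf f -> bmf g -> bmf (fun x => f x + g x).
Proof.
move=> [mf [M fM]] [mg [N gN]]; split; first exact: measurable_funD.
by exists (M + N) => x Dx; rewrite (le_trans (ler_normD _ _))// lerD ?fM ?gN.
Qed.

Lemma bmfM f g : bmf f -> bmf g -> bmf (fun x => f x * g x).
Proof.
move=> [mf [M fM]] [mg [N gN]]; split; first exact: measurable_funM.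
by exists (M * N) => x Dx; rewrite normrM ler_pM ?fM ?gN.
Qed.

Lemma bmfZ c f : bmf f -> bmf (fun x => c * f x).
Proof. by move=> bf; apply: bmfM => //; exact: bmf_cst. Qed.

Lemma bmfN f : bmf f -> bmf (fun x => - f x).
Proof.
by move=> /(bmfZ (-1)); under eq_fun do rewrite mulN1r.
Qed.

Lemma bmfB f g : bmf f -> bmf g -> bmf (fun x => f x - g x).
Proof. by move=> bf bg; apply: bmfD => //; exact: bmfN. Qed.

Lemma bmfX f n : bmf f -> bmf (fun x => f x ^+ n).
Proof.
move=> bf; elim: n => [|n IHn]; first exact: bmf_cst.
by under eq_fun do rewrite exprS; exact: bmfM.
Qed.

Lemma bmf_sum I (s : seq I) (P : pred I) (f : I -> T -> R) :
  (forall i, P i -> bmf (f i)) -> bmf (fun x => \sum_(i <- s | P i) f i x).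
Proof.
move=> bf; elim: s => [|i s IHs]; first by under eq_fun do rewrite big_nil; exact: bmf_cst.
under eq_fun do rewrite big_cons.
by have [Pi|//] := boolP (P i); apply: bmfD => //; exact: bf.
Qed.

Lemma eq_bmf f g : (forall x, D x -> f x = g x) -> bmf f -> bmf g.
Proof.
move=> fg [mf [M fM]]; split; last by exists M => x Dx; rewrite -fg// fM.
by apply: eq_measurable_fun mf => x /set_mem; exact: fg.
Qed.

Variable mu : {measure set T -> \bar R}.
Hypotheses (mD : measurable D) (Doo : (mu D < +oo)%E).

Lemma bmf_integrable f : bmf f -> mu.-integrable D (EFin \o f).
Proof.
move=> [mf [M fM]]; apply: measurable_bounded_integrable => //.
exists M; split; first exact: num_real.
by move=> N MN x Dx; apply: (le_trans (fM x Dx)); exact: ltW.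
Qed.

Lemma bmf_RintegralD f g : bmf f -> bmf g ->
  \int[mu]_(x in D) (f x + g x) = \int[mu]_(x in D) f x + \int[mu]_(x in D) g x.
Proof. by move=> bf bg; apply: RintegralD => //; exact: bmf_integrable. Qed.

Lemma bmf_RintegralB f g : bmf f -> bmf g ->
  \int[mu]_(x in D) (f x - g x) = \int[mu]_(x in D) f x - \int[mu]_(x in D) g x.
Proof. by move=> bf bg; apply: RintegralB => //; exact: bmf_integrable. Qed.

Lemma bmf_RintegralZ c f : bmf f ->
  \int[mu]_(x in D) (c * f x) = c * \int[mu]_(x in D) f x.
Proof. by move=> bf; apply: RintegralZl => //; exact: bmf_integrable. Qed.

Lemma Rintegral0 : \int[mu]_(x in D) 0 = 0 :> R.
Proof. by rewrite Rintegral_cst// mul0r. Qed.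

Lemma bmf_Rintegral_sum I (s : seq I) (P : pred I) (f : I -> T -> R) :
  (forall i, P i -> bmf (f i)) ->
  \int[mu]_(x in D) (\sum_(i <- s | P i) f i x) =
  \sum_(i <- s | P i) \int[mu]_(x in D) f i x.
Proof.
move=> bf; elim: s => [|i s IHs].
  by under eq_Rintegral do rewrite big_nil; rewrite Rintegral0 big_nil.
rewrite big_cons -IHs; under eq_Rintegral do rewrite big_cons.
by have [Pi|//] := boolP (P i); rewrite bmf_RintegralD//; [exact: bf|exact: bmf_sum].
Qed.

Lemma bmf_le_Rintegral f g : bmf f -> bmf g -> (forall x, D x -> f x <= g x) ->
  \int[mu]_(x in D) f x <= \int[mu]_(x in D) g x.
Proof. by move=> bf bg; apply: le_Rintegral => //; exact: bmf_integrable. Qed.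

Lemma bmf_le_norm_Rintegral f : bmf f ->
  `|\int[mu]_(x in D) f x| <= \int[mu]_(x in D) `|f x|.
Proof. by move=> bf; apply: le_normr_Rintegral => //; exact: bmf_integrable. Qed.

Lemma eqD_Rintegral f g : (forall x, D x -> f x = g x) ->
  \int[mu]_(x in D) f x = \int[mu]_(x in D) g x.
Proof. by move=> fg; apply: eq_Rintegral => x /set_mem; exact: fg. Qed.

Lemma Rintegral_preserves (phi : T -> T) f : preserves mu phi ->
  (forall x, D (phi x) <-> D x) -> bmf f ->
  \int[mu]_(x in D) f (phi x) = \int[mu]_(x in D) f x.
Proof.
move=> [mphi phiE] phiD bf.
(* Since D is invariant, extending f by zero commutes with phi, which reduces the claim to the
   pushforward formula on the whole space. *)
have fphi : (f \_ D) \o phi = (f \o phi) \_ D.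
  apply/funext => x /=; rewrite !patchE.
  have [Dx|nDx] := pselect (D x); first by rewrite !mem_set//; exact/phiD.
  by rewrite !memNset// => /phiD.
have mfD : measurable_fun setT (f \_ D) by apply: (measurable_restrictT f mD).1; exact: bf.1.
have bfphi : bmf (f \o phi).
  case: (bf) => mf [M fM]; split; last by exists M => x /phiD/fM.
  by apply: (measurable_restrictT _ mD).2; rewrite -fphi; exact: measurableT_comp.
rewrite (_ : \int[mu]_(x in D) f (phi x) = \int[mu]_(x in D) (f \o phi) x)//.
rewrite Rintegral_mkcond -fphi [RHS]Rintegral_mkcond /Rintegral; congr fine.
have mfE : measurable_fun [set: T] (EFin \o (f \_ D)) by exact/measurable_EFinP.
have iE : mu.-integrable (phi @^-1` setT) ((EFin \o (f \_ D)) \o phi).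
  rewrite preimage_setT -compA fphi -(restrict_EFin (f \o phi) D).
  by apply/integrable_restrict => //; rewrite setTI; exact: bmf_integrable.
have := integral_pushforward mphi mfE iE measurableT.
rewrite preimage_setT => /esym E.
rewrite (_ : (\int[mu]_x ((f \_ D \o phi) x)%:E)%E =
  (\int[mu]_x ((EFin \o (f \_ D)) \o phi) x)%E)// E.
apply: (eq_measure_integral mu
  (m1 := measure_function_pushforward__canonical__measure_function_Measure mu mphi)).
by move=> A mA _; rewrite /= /pushforward phiE.
Qed.

(** A bound on f' uniform in t provides a constant dominating function, integrable because D has
    finite measure. *)
Lemma is_derive_Rintegral (f f' : R -> T -> R) :
  (forall t, bmf (f t)) ->
  (exists M, forall t x, D x -> `|f' t x| <= M) ->
  (forall (t : R) x, D x -> is_derive t 1 (f^~ x) (f' t x)) ->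
  forall t : R, is_derive t 1 (fun t => \int[mu]_(x in D) f t x)
    (\int[mu]_(x in D) f' t x).
Proof.
move=> bf [M f'M] df t.
have It : `]t - 1, t + 1[%classic t by rewrite /= in_itv/= gtrBl ltrDl ltr01.
have If x : `]t - 1, t + 1[%classic x -> mu.-integrable D (EFin \o f x).
  by move=> _; exact: bmf_integrable.
have d1E s x : D x -> partial1of2 f s x = f' s x.
  by move=> Dx; rewrite partial1of2E; have /@derive_val := df s x Dx.
have dM s x : `]t - 1, t + 1[%classic s -> D x ->
    `|partial1of2 f s x| <= (fun=> `|M|) x.
  by move=> _ Dx; rewrite d1E// (le_trans (f'M _ _ Dx))// ler_norm.
have dd s x : `]t - 1, t + 1[%classic s -> D x -> derivable (f^~ x) s 1.
  by move=> _ Dx; have /@ex_derive := df s x Dx.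
have iM : mu.-integrable D (EFin \o (fun=> `|M|)).
  by apply: bmf_integrable; exact: bmf_cst.
have M0 (y : T) : 0 <= (fun=> `|M|) y by [].
apply: DeriveDef.
  exact: (@derivable_under_integral R _ T mu f D mD _ _ _ It If dd _ M0 iM dM).
rewrite -derive1E (@differentiation_under_integral R _ T mu f D mD _ _ _ It If dd _ M0 iM dM).
by apply: eqD_Rintegral => x Dx; exact: d1E.
Qed.

End bounded_measurable.

(** * Euclidean geometry, rotations and the surface measure *)

Section euclidean.
Context (R : realType) (d : nat).
Local Notation V := 'rV[R]_d.
Implicit Types (x y z : V) (i j : 'I_d).
Local Notation S := (@sphere R d).

Lemma dotC x y : dot x y = dot y x.
Proof. by apply: eq_bigr => i _; rewrite mulrC. Qed.

Lemma dotDl x y z : dot (x + y) z = dot x z + dot y z.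
Proof. by rewrite /dot -big_split; apply: eq_bigr => i _; rewrite mxE mulrDl. Qed.

Lemma dotDr x y z : dot z (x + y) = dot z x + dot z y.
Proof. by rewrite dotC dotDl ![dot z _]dotC. Qed.

Lemma dotZl c x y : dot (c *: x) y = c * dot x y.
Proof. by rewrite /dot mulr_sumr; apply: eq_bigr => i _; rewrite mxE mulrA. Qed.

Lemma dotZr c x y : dot y (c *: x) = c * dot y x.
Proof. by rewrite dotC dotZl dotC. Qed.

Lemma dotNl x y : dot (- x) y = - dot x y.
Proof. by rewrite -scaleN1r dotZl mulN1r. Qed.

Lemma dotBl x y z : dot (x - y) z = dot x z - dot y z.
Proof. by rewrite dotDl dotNl. Qed.

Lemma dotBr x y z : dot z (x - y) = dot z x - dot z y.
Proof. by rewrite dotC dotBl ![dot z _]dotC. Qed.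

Lemma dot0l x : dot 0 x = 0.
Proof. by rewrite -(scale0r x) dotZl mul0r. Qed.

Lemma dot_delta x i : dot x (delta_mx ord0 i) = x ord0 i.
Proof.
rewrite /dot (bigD1 i)//= big1 => [|j ji]; rewrite mxE eqxx/= ?eqxx ?mulr1 ?addr0//.
by rewrite (negbTE ji) mulr0.
Qed.

Lemma dot_ge0 x : 0 <= dot x x.
Proof. by apply: sumr_ge0 => i _; exact: sqr_ge0. Qed.

Lemma enorm_ge0 x : 0 <= enorm x. Proof. exact: sqrtr_ge0. Qed.

Lemma sqr_enorm x : enorm x ^+ 2 = dot x x.
Proof. by rewrite sqr_sqrtr// dot_ge0. Qed.

Lemma sqr_coor_le x i : x ord0 i ^+ 2 <= dot x x.
Proof.
rewrite /dot (bigD1 i)//= expr2 lerDl.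
by apply: sumr_ge0 => j _; exact: sqr_ge0.
Qed.

Lemma coor_le_enorm x i : `|x ord0 i| <= enorm x.
Proof.
by rewrite -(@ler_pXn2r _ 2) ?nnegrE ?enorm_ge0// sqr_enorm real_normK ?num_real// sqr_coor_le.
Qed.

Lemma enorm_eq0 x : (enorm x == 0) = (x == 0).
Proof.
apply/eqP/eqP => [x0|->]; last first.
  by apply/eqP; rewrite -sqrf_eq0 sqr_enorm dot0l.
apply/rowP => i; apply/eqP; rewrite mxE -normr_eq0 eq_le normr_ge0 andbT.
by rewrite -x0 coor_le_enorm.
Qed.

Lemma enorm_gt0 x : (0 < enorm x) = (x != 0).
Proof. by rewrite lt_def enorm_eq0 enorm_ge0 andbT. Qed.

Lemma enormZ c x : 0 <= c -> enorm (c *: x) = c * enorm x.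
Proof.
move=> c0; rewrite /enorm dotZl dotZr mulrA -expr2 sqrtrM ?sqr_ge0//.
by rewrite sqrtr_sqr ger0_norm.
Qed.

Lemma sphere_dot x : S x <-> dot x x = 1.
Proof.
split => [/= x1|x1]; first by rewrite -sqr_enorm x1 expr1n.
by rewrite /sphere/= /enorm x1 sqrtr1.
Qed.

Lemma dir_sphere x : x != 0 -> S (dir x).
Proof.
move=> x0; rewrite /sphere/= /dir enormZ ?invr_ge0 ?enorm_ge0//.
by rewrite mulVf// enorm_eq0.
Qed.

Lemma dir_id x : S x -> dir x = x.
Proof. by rewrite /sphere /dir /= => ->; rewrite invr1 scale1r. Qed.

Lemma sphere_neq0 x : S x -> x != 0.
Proof. by rewrite /sphere/= -enorm_gt0 => ->. Qed.

Lemma dirZ c x : 0 < c -> dir (c *: x) = dir x.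
Proof.
move=> c0; have c0' : c != 0 by rewrite gt_eqF.
rewrite /dir enormZ ?ltW// scalerA; congr (_ *: _).
by rewrite invfM mulrAC mulVf// mul1r.
Qed.

Lemma cauchy_schwarz x y : dot x y ^+ 2 <= dot x x * dot y y.
Proof.
have [->|y0] := eqVneq y 0; first by rewrite !(dotC _ 0) !dot0l expr0n mulr0.
have y1 : 0 < dot y y by rewrite -sqr_enorm exprn_gt0// enorm_gt0.
have := dot_ge0 (dot y y *: x - dot x y *: y).
rewrite !(dotBl, dotBr, dotZl, dotZr) (dotC y x).
set a := dot x x; set b := dot x y; set c := dot y y in y1 *.
rewrite [X in 0 <= X](_ : _ = c * (a * c - b ^+ 2)); last ring.
by rewrite pmulr_rge0// subr_ge0.
Qed.

Lemma dot_sphere_le1 x y : S x -> S y -> `|dot x y| <= 1.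
Proof.
move=> /sphere_dot x1 /sphere_dot y1.
have := cauchy_schwarz x y; rewrite x1 y1 mulr1 => h.
by rewrite -(@ler_pXn2r _ 2) ?nnegrE// expr1n real_normK ?num_real.
Qed.

Definition rot i j (t : R) : V -> V := givens i j (cos t) (sin t).

Lemma rot_dot i j t x y : i != j -> dot (rot i j t x) y = dot x (rot i j (- t) y).
Proof.
move=> ij; rewrite /rot /givens cosN sinN.
rewrite !(dotDl, dotDr, dotZl, dotZr, dot_delta).
by rewrite ![dot (delta_mx _ _) _]dotC !dot_delta; ring.
Qed.

Lemma rot0 i j x : rot i j 0 x = x.
Proof. by rewrite /rot /givens cos0 sin0 subrr !mul0r subrr !addr0 !scale0r !addr0. Qed.

Lemma rotD i j s t x : i != j -> rot i j s (rot i j t x) = rot i j (s + t) x.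
Proof.
move=> ij; have := congr1 (fun f => f x) (givens_comp (cos s) (sin s) (cos t) (sin t) ij).
by rewrite /rot /= => ->; rewrite cosD sinD addrC; congr givens; rewrite addrC.
Qed.

Lemma dot_rot i j t x y : i != j -> dot (rot i j t x) (rot i j t y) = dot x y.
Proof. by move=> ij; rewrite rot_dot// rotD// addNr rot0. Qed.

Lemma enorm_rot i j t x : i != j -> enorm (rot i j t x) = enorm x.
Proof. by move=> ij; rewrite /enorm dot_rot. Qed.

Lemma sphere_rot i j t x : i != j -> S (rot i j t x) <-> S x.
Proof. by move=> ij; rewrite /sphere/= enorm_rot. Qed.

Lemma rotZ i j t c x : rot i j t (c *: x) = c *: rot i j t x.
Proof. by rewrite /rot /givens; apply/rowP => k; rewrite !mxE; ring. Qed.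

Lemma rotB i j t x y : rot i j t (x - y) = rot i j t x - rot i j t y.
Proof. by rewrite /rot /givens; apply/rowP => k; rewrite !mxE; ring. Qed.

Lemma dir_rot i j t x : i != j -> dir (rot i j t x) = rot i j t (dir x).
Proof. by move=> ij; rewrite /dir rotZ enorm_rot. Qed.

Lemma measurable_sphere : measurable S.
Proof.
rewrite (_ : S = @enorm R d @^-1` [set 1])//.
by rewrite -[X in measurable X]setTI; exact: measurable_enorm.
Qed.

Lemma measurable_cone (A : set V) : measurable A -> measurable (@cone R d A).
Proof.
move=> mA; rewrite (_ : cone A = [set x | 0 < enorm x <= 1] `&` @dir R d @^-1` A).
  apply: measurableI.
    rewrite (_ : mkset _ = @enorm R d @^-1` `]0, 1]%classic); last first.
      by apply/seteqP; split => x /=; rewrite in_itv.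
    by rewrite -[X in measurable X]setTI; exact: measurable_enorm.
  by rewrite -[X in measurable X]setTI; exact: measurable_dir.
by apply/seteqP; split => x [].
Qed.

Lemma measurable_box (A : 'I_d -> set R) : (forall i, measurable (A i)) ->
  measurable [set x : V | forall i, A i (x ord0 i)].
Proof.
move=> mA; rewrite (_ : mkset _ = \bigcap_(i in [set: 'I_d])
  ((fun x : V => x ord0 i) @^-1` A i)); last first.
  by apply/seteqP; split => [x Ax i _|x Ax i]; exact: Ax.
apply: fin_bigcap_measurable => // i _.
by rewrite -[X in measurable X]setTI; exact: measurable_coor.
Qed.

(** A rotation commutes with [dir] and keeps the norm, so it carries cones to cones and the
    invariance of Lebesgue measure applies. *)
Lemma surface_measure_rot i j t : i != j ->
  preserves (@surface_measure R d) (rot i j t).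
Proof.
move=> ij.
have [mr rE] : preserves (lebesgue_rV R d) (rot i j t).
  by apply: lebesgue_rV_givens => //; exact: cos2Dsin2.
split => // A mA; rewrite /surface_measure -(rE (cone A)); last exact: measurable_cone.
congr (_ * lebesgue_rV R d _)%E; apply/seteqP; split => x /=.
  by rewrite /cone/= enorm_rot// dir_rot.
by rewrite /cone/= enorm_rot// dir_rot.
Qed.

Lemma surface_measure_lty (A : set V) : measurable A -> (surface_measure A < +oo)%E.
Proof.
move=> mA; rewrite /surface_measure.
apply: lte_mul_pinfty => //.
apply: (@le_lt_trans _ _ (lebesgue_rV R d [set x | forall i, `[-1, 1]%classic (x ord0 i)])).
  apply: le_measure.
  - by rewrite inE; exact: measurable_cone.
  - by rewrite inE; exact: (@measurable_box (fun=> `[-1, 1]%classic)).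
  - move=> x [/andP[_ x1] _] i /=; rewrite in_itv/= -ler_norml.
    by rewrite (le_trans (coor_le_enorm _ _)).
rewrite (@lebesgue_rV_box R d (fun=> `[-1, 1]%classic))//.
under eq_bigr do rewrite lebesgue_measure_itv/= lte_fin gtrN// -EFinB.
by rewrite prodEFin ltry.
Qed.

Lemma surface_sphere_gt0 : (0 < d)%N -> (0 < surface_measure S)%E.
Proof.
move=> d0; rewrite /surface_measure mule_gt0//; first by rewrite lte_fin ltr0n.
(* This small cube avoids the origin and lies in the unit ball, since each squared coordinate is at
   most 1/d; hence it lies in the cone over the sphere. *)
apply: (@lt_le_trans _ _ (lebesgue_rV R d [set x | forall i, `]0, d%:R^-1]%classic (x ord0 i)])).
  rewrite (@lebesgue_rV_box R d (fun=> `]0, d%:R^-1]%classic))//.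
  under eq_bigr do rewrite lebesgue_measure_itv/= lte_fin invr_gt0 ltr0n d0 sube0.
  by rewrite prodEFin lte_fin prodr_gt0// => i _; rewrite invr_gt0 ltr0n.
apply: le_measure.
- by rewrite inE; exact: (@measurable_box (fun=> `]0, d%:R^-1]%classic)).
- by rewrite inE; apply: measurable_cone; exact: measurable_sphere.
- move=> x /= xi.
  have x0 : x != 0.
    apply/eqP => x0; have := xi (Ordinal d0); rewrite x0 mxE in_itv/= ltxx//.
  split; last exact: dir_sphere.
  rewrite enorm_gt0 x0/= -(@ler_pXn2r _ 2) ?nnegrE ?enorm_ge0// expr1n sqr_enorm.
  have dR : 0 < d%:R :> R by rewrite ltr0n.
  apply: (@le_trans _ _ (\sum_(i < d) d%:R^-1)).
    apply: ler_sum => i _; have := xi i; rewrite in_itv/= => /andP[a b].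
    have b1 : d%:R^-1 <= 1 :> R by rewrite invf_le1// ler1n.
    by rewrite -[leRHS]mulr1; apply: ler_pM => //; try exact: ltW; exact: le_trans b b1.
  by rewrite sumr_const card_ord -[_ *+ _]mulr_natr mulVf ?gt_eqF.
Qed.

End euclidean.

(** * Open sets and continuously differentiable functions on R^n *)

Section rV_topology.
Context (R : realType) (n : nat).
Local Notation V := 'rV[R]_n.
Implicit Types (x y : V) (i : 'I_n).

Lemma mx_norm_coor x i : `|x ord0 i| <= `|x|.
Proof.
rewrite [leRHS]/Num.norm/= mx_normrE.
by apply/bigmax_geP; right => /=; exists (ord0, i).
Qed.

Lemma mx_norm_lt x (e : R) : 0 < e -> (forall i, `|x ord0 i| < e) -> `|x| < e.
Proof.
move=> e0 xe; rewrite [ltLHS]/Num.norm/= mx_normrE.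
by apply/bigmax_ltP; split => // -[j i] _ /=; rewrite (ord1 j).
Qed.

(** The sigma-algebra is generated by coordinates, so U is written as a countable union of boxes
    with rational centre and radius. A box of radius below e/2 that contains x lies in the sup-norm
    ball of radius e about x. *)
Lemma open_measurable_rV (U : set V) : open U -> measurable U.
Proof.
move=> oU.
pose box (p : 'rV[rat]_n * rat) : set V :=
  [set x | forall i, `](ratr (p.1 ord0 i) - ratr p.2), (ratr (p.1 ord0 i) + ratr p.2)[%classic (x ord0 i)].
have -> : U = \bigcup_(p : 'rV[rat]_n * rat) (if `[< box p `<=` U >] then box p else set0).
  apply/seteqP; split => [x Ux|x [p _]]; last by case: asboolP => // + ?; exact.
  have /nbhs_ballP[e /= e0 eU] := oU x Ux.
  have [r /andP[r0 re]] : exists r : rat, 0 < (ratr r : R) < e / 2.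
    have [|r] := @rat_in_itvoo R 0 (e / 2); first by rewrite divr_gt0.
    by rewrite in_itv/=; exists r.
  have /choice[a xa] : forall i, exists q : rat, x ord0 i - ratr r < (ratr q : R) < x ord0 i + ratr r.
    move=> i; have [|q] := @rat_in_itvoo R (x ord0 i - ratr r) (x ord0 i + ratr r).
      by lra.
    by rewrite in_itv/=; exists q.
  exists (\row_i a i, r) => //.
  have bU : box (\row_i a i, r) `<=` U.
    move=> y yb; apply: eU; rewrite -ball_normE/=; apply: mx_norm_lt => // i.
    have := yb i; rewrite /= in_itv/= !mxE => /andP[y1 y2].
    have /andP[x1 x2] := xa i.
    by rewrite ltr_norml; apply/andP; split; lra.
  rewrite asboolT// => i; rewrite /= in_itv/= mxE; have /andP[x1 x2] := xa i.
  by apply/andP; split; lra.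
apply: countable_bigcupT_measurable => [|p]; first exact: (@countableP ('rV[rat]_n * rat)%type).
case: ifPn => // _.
exact: (@measurable_box R n (fun i => `](ratr (p.1 ord0 i) - ratr p.2), (ratr (p.1 ord0 i) + ratr p.2)[%classic)).
Qed.

Lemma open_continuous_measurable_rV (U : set V) (f : V -> R) : open U ->
  (forall x, U x -> {for x, continuous f}) -> measurable_fun U f.
Proof.
move=> oU cf; apply: (measurability _ (RGenOpens.measurableE R)).
move=> _ [_ [a [b ->] <-]]; apply: open_measurable_rV.
rewrite openE => x [Ux fx]; apply: filterI; first exact: open_nbhs_nbhs.
by apply: (cf x Ux); exact: open_nbhs_nbhs.
Qed.

Lemma open_neq0 : open [set x : V | x != 0].
Proof.
rewrite (_ : mkset _ = ~` [set 0]); last first.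
  by apply/seteqP; split => x /= /eqP.
by rewrite openC; apply: accessible_closed_set1; exact/hausdorff_accessible/norm_hausdorff.
Qed.

(** The hypotheses are placed on the ball of radius |b - a| about a, so that b may lie on either
    side of a. *)
Lemma MVT_norm (f f' : R -> R) (a b B : R) :
  (forall s : R, `|s - a| <= `|b - a| -> is_derive s 1 f (f' s)) ->
  (forall s, `|s - a| <= `|b - a| -> `|f' s| <= B) ->
  `|f b - f a| <= B * `|b - a|.
Proof.
have main (c d : R) : c <= d -> (forall s : R, c <= s <= d -> is_derive s 1 f (f' s)) ->
    (forall s, c <= s <= d -> `|f' s| <= B) -> `|f d - f c| <= B * `|d - c|.
  move=> cd df fB.
  have [||u ucd ->] := @MVT_segment R f f' c d cd.
  - by move=> x; rewrite in_itv/= => /andP[/ltW cx /ltW xd]; apply: df; rewrite cx.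
  - apply: derivable_within_continuous => x; rewrite in_itv/= => xcd.
    by have /@ex_derive := df x xcd.
  - by rewrite normrM ler_wpM2r// fB//; move: ucd; rewrite in_itv.
move=> df fB; have [ab|/ltW ba] := leP a b.
  apply: main => // s /andP[as_ sb]; [apply: df|apply: fB];
  by rewrite !ger0_norm ?subr_ge0// lerB.
rewrite distrC [`|b - a|]distrC; apply: main => // s /andP[as_ sb]; [apply: df|apply: fB];
by rewrite !ler0_norm ?subr_le0// lerN2 lerB.
Qed.

Lemma is_derive_line (F : V -> R) (p v : V) (s : R) :
  derivable F (p + s *: v) v ->
  is_derive s 1 (fun s => F (p + s *: v)) ('D_v F (p + s *: v)).
Proof.
move=> dF.
have E : (fun h : R => h^-1 *: (F (p + (h *: 1 + s) *: v) - F (p + s *: v))) =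
    (fun h => h^-1 *: (F (h *: v + (p + s *: v)) - F (p + s *: v))).
  apply/funext => h; congr (_ *: (F _ - _)).
  by rewrite scalerDl addrCA [h *: 1]mulr1.
by apply: DeriveDef; rewrite /derivable /derive /= E.
Qed.

(** Pass from x to y by changing one coordinate at a time and apply the mean value theorem to each
    change; in the sup norm the whole path stays in the ball where the partial derivatives are
    bounded. *)
Lemma partial_lipschitz (F : V -> R) (x : V) (e B : R) : 0 <= B -> 0 < e ->
  (forall y i, `|y - x| < e -> derivable F y (delta_mx ord0 i) /\
     `|'D_(delta_mx ord0 i) F y| <= B) ->
  forall y, `|y - x| < e -> `|F y - F x| <= n%:R * B * `|y - x|.
Proof.
move=> B0 e0 FB y yxe.
pose p k : V := \row_i (if (i < k)%N then y ord0 i else x ord0 i).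
have p0 : p 0%N = x by apply/rowP => i; rewrite mxE.
have pn : p n = y by apply/rowP => i; rewrite mxE ltn_ord.
have step (k : nat) : (k < n)%N -> `|F (p k.+1) - F (p k)| <= B * `|y - x|.
  move=> kn; pose i := Ordinal kn.
  pose q := p k; pose v : V := delta_mx ord0 i.
  have pk s : q + s *: v = \row_j (if j == i then x ord0 i + s else q ord0 j).
    apply/rowP => j; rewrite !mxE eqxx/=.
    by have [->|ji] := eqVneq j i; rewrite ?ltnn ?mulr1 ?mulr0 ?addr0.
  have qe s : `|s| <= `|y ord0 i - x ord0 i| -> `|q + s *: v - x| < e.
    move=> sxy; apply: mx_norm_lt => // j; rewrite pk !mxE.
    have yxj (j' : 'I_n) : `|y ord0 j' - x ord0 j'| < e.
      by apply: le_lt_trans yxe; have := mx_norm_coor (y - x) j'; rewrite !mxE.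
    have [->|ji] := eqVneq j i.
      by rewrite addrAC subrr add0r (le_lt_trans sxy).
    by case: ifPn => _; rewrite ?subrr ?normr0.
  have -> : p k.+1 = q + (y ord0 i - x ord0 i) *: v.
    rewrite pk; apply/rowP => j; rewrite !mxE ltnS leq_eqVlt.
    have [->|ji] := eqVneq j i; first by rewrite eqxx/= addrC subrK.
    by rewrite -[(j == k :> nat)]/(j == i) (negbTE ji).
  have -> : p k = q + 0 *: v by rewrite scale0r addr0.
  apply: (@le_trans _ _ (B * `|y ord0 i - x ord0 i - 0|)).
    apply: (@MVT_norm (fun s => F (q + s *: v)) (fun s => 'D_v F (q + s *: v))).
      move=> s; rewrite !subr0 => sxy; apply: is_derive_line.
      by have [] := FB _ i (qe s sxy).
    by move=> s; rewrite !subr0 => sxy; have [] := FB _ i (qe s sxy).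
  by rewrite subr0 ler_wpM2l//; have := mx_norm_coor (y - x) i; rewrite !mxE.
rewrite -{1}p0 -{1}pn -(telescope_sumr (fun k => F (p k)) (leq0n n)).
rewrite (le_trans (ler_norm_sum _ _ _))// big_mkord.
apply: (@le_trans _ _ (\sum_(i < n) (B * `|y - x|))).
  by apply: ler_sum => i _; exact: step.
by rewrite sumr_const card_ord -mulrA mulr_natl.
Qed.

End rV_topology.

Section c1_functions.
Context (R : realType) (n : nat).
Local Notation V := 'rV[R]_n.
Local Notation e_ := (fun j : 'I_n => delta_mx ord0 j : V).
Implicit Types (x y : V) (i j : 'I_n) (F : V -> R).

Lemma diff0_differentiable F x :
  (forall e : R, 0 < e -> \forall y \near x, `|F y - F x| <= e * `|y - x|) ->
  differentiable F x.
Proof.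
move=> Fo; apply/diffP => /=.
(* The differential is obtained by a choice operator; the zero map shows that there is something to
   choose. *)
apply: (@getPex _ (fun (df : {linear V -> R}) => continuous df /\
  forall y, F y = F (lim (nbhs x)) + df (y - lim (nbhs x))
                  +o_(y \near x) (y - lim (nbhs x)))).
pose z : {linear V -> R} := \0.
exists z; split; first exact: cst_continuous.
have lx : lim (nbhs x) = x by exact: lim_id.
rewrite lx.
suff : F = (fun y => F x + z (y - x)) +o_x (fun y : V => y - x) by rewrite funeqE.
apply/eqaddoP => _/posnumP[e] /=.
near=> y.
rewrite (_ : (F - _) y = F y - F x); last by rewrite !fctE/= addr0.
by near: y; exact: Fo.
Unshelve. all: by end_near. Qed.

(** The origin is left out because the degree-0 extension of a function on the sphere is in general
    discontinuous there. *)
Definition c1 F := forall x i, x != 0 ->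
  derivable F x (e_ i) /\ {for x, continuous ('D_(e_ i) F)}.

(** Subtract the linear map L with the same partial derivatives at x. Those of F - L are small near
    x, so F - L has a small Lipschitz estimate at x and differential zero. *)
Lemma c1_differentiable F x : c1 F -> x != 0 -> differentiable F x.
Proof.
move=> cF x0.
pose c i := 'D_(e_ i) F x.
pose L (y : V) : R := \sum_(i < n) c i * y ord0 i.
have dL y : differentiable L y.
  rewrite (_ : L = \sum_(i < n) (c i *: (fun y : V => y ord0 i))); last first.
    by apply/funext => z; rewrite fct_sumE.
  by apply: differentiable_sum => i; apply: differentiableZ; exact: differentiable_coord.
have Le y i : 'D_(e_ i) L y = c i.
  have Lh h : L (h *: e_ i + y) = h * c i + L y.
    rewrite /L (eq_bigr (fun j => h * (c j * (j == i)%:R) + c j * y ord0 j)); last first.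
      by move=> j _; rewrite !mxE eqxx/=; ring.
    rewrite big_split/= -mulr_sumr; congr (h * _ + _).
    by rewrite (bigD1 i)//= eqxx mulr1 big1 ?addr0// => j ji; rewrite (negbTE ji) mulr0.
  rewrite /derive; apply: cvg_lim => //.
  apply: (@cvg_trans _ (cst (c i) @ 0^')); last exact: cvg_cst.
  apply: near_eq_cvg; near=> h.
  have h0 : h != 0 by near: h; exact: nbhs_dnbhs_neq.
  by rewrite /= Lh addrK -[_ *: _]/(_ * _) mulKf.
rewrite (_ : F = (F - L) + L); last by rewrite subrK.
apply: differentiableD => //; apply: diff0_differentiable => e e0.
(* Makes n B at most e; the successor keeps the denominator nonzero when n = 0. *)
pose B := e / n.+1%:R.
have B0 : 0 < B by rewrite divr_gt0// ltr0n.
have [r r0 rB] : exists2 r, 0 < r & forall y i, `|y - x| < r ->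
    derivable (F - L) y (e_ i) /\ `|'D_(e_ i) (F - L) y| <= B.
  have : \forall y \near x, forall i, derivable (F - L) y (e_ i) /\
      `|'D_(e_ i) (F - L) y| <= B.
    near=> y => i; move: i; near: y; apply: filter_forall => i.
    have [_ /cvgrPdist_le /(_ _ B0) cD] := cF x i x0.
    have nz : \forall y \near x, y != 0.
      by apply: open_nbhs_nbhs; split => //; exact: open_neq0.
    near=> y.
    have [dF _] : derivable F y (e_ i) /\ {for y, continuous ('D_(e_ i) F)}.
      by apply: cF; near: y.
    have dL' : derivable L y (e_ i) by apply: diff_derivable; exact: dL.
    split; first exact: derivableB.
    by rewrite deriveB// Le distrC; near: y; exact: cD.
  move=> /nbhs_ballP[r /= r0 rB]; exists r => // y i yx.
  by apply: rB; rewrite -ball_normE/= distrC.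
have lip := @partial_lipschitz R n (F - L) x r B (ltW B0) r0 rB.
near=> y.
have yr : `|y - x| < r.
  by rewrite distrC; near: y; have := nbhsx_ballx x r r0; rewrite -ball_normE.
rewrite (le_trans (lip _ yr))// ler_wpM2r//.
rewrite /B mulrCA; apply: ler_piMr; first exact: ltW.
by rewrite ler_pdivrMr ?ltr0n// mul1r ler_nat.
Unshelve. all: by end_near. Qed.

Lemma diff_partials F x h : differentiable F x ->
  'd F x h = \sum_(i < n) h ord0 i * 'D_(e_ i) F x.
Proof.
move=> dF; rewrite {1}(row_sum_delta h) linear_sum; apply: eq_bigr => i _.
by rewrite linearZ/= deriveE.
Qed.

Lemma is_derive_curve F (g : R -> V) (g' : V) (t : R) :
  differentiable F (g t) -> is_derive t 1 g g' ->
  is_derive t 1 (F \o g) (\sum_(i < n) g' ord0 i * 'D_(e_ i) F (g t)).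
Proof.
move=> dF dg.
have dg' : differentiable g t by apply/derivable1_diffP.
have dFg : differentiable (F \o g) t by exact: differentiable_comp.
apply: DeriveDef; first exact: diff_derivable.
have gE : 'd g t 1 = g' by rewrite -deriveE//; exact: (@derive_val _ _ _ _ _ _ _ dg).
by rewrite deriveE// diff_comp// /= gE diff_partials.
Qed.

Lemma is_derive_scalev (a : R -> R) (a' : R) (v : V) (t : R) :
  is_derive t 1 a a' -> is_derive t 1 (fun s => a s *: v) (a' *: v).
Proof.
move=> da; have /@ex_derive ea := da.
have E : (fun h : R => h^-1 *: (a (h *: 1 + t) *: v - a t *: v)) =
    (fun h => (h^-1 *: (a (h *: 1 + t) - a t)) *: v).
  by apply/funext => h; rewrite -scalerBl scalerA.
have cv : (fun h : R => h^-1 *: (a (h *: 1 + t) *: v - a t *: v)) @ 0^' --> a' *: v.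
  rewrite E; apply: cvgZr_tmp.
  by rewrite -(@derive_val _ _ _ _ _ _ _ da); exact: ea.
apply: DeriveDef; first by apply/cvg_ex; exists (a' *: v).
exact: cvg_lim cv.
Qed.

End c1_functions.

Section real_derivatives.
Context (R : realType).
Implicit Types (f g : R -> R) (t : R).

Lemma derive_cstf (c : R) t : is_derive t 1 (fun=> c) (0 : R).
Proof. exact: is_derive_cst. Qed.

Lemma derive_addf f g df dg t : is_derive t 1 f df -> is_derive t 1 g dg ->
  is_derive t 1 (fun s => f s + g s) (df + dg).
Proof. by move=> ? ?; exact: is_deriveD. Qed.

Lemma derive_subf f g df dg t : is_derive t 1 f df -> is_derive t 1 g dg ->
  is_derive t 1 (fun s => f s - g s) (df - dg).
Proof. by move=> ? ?; exact: is_deriveB. Qed.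

Lemma derive_mulf f g df dg t : is_derive t 1 f df -> is_derive t 1 g dg ->
  is_derive t 1 (fun s => f s * g s) (f t * dg + g t * df).
Proof. by move=> ? ?; exact: is_deriveM. Qed.

Lemma derive_scalef c f df t : is_derive t 1 f df ->
  is_derive t 1 (fun s => c * f s) (c * df).
Proof. by move=> ?; exact: is_deriveZ. Qed.

Lemma derive_expf n f df t : is_derive t 1 f df ->
  is_derive t 1 (fun s => f s ^+ n) (n%:R * f t ^+ n.-1 * df).
Proof.
move=> d; rewrite (_ : (fun s => _) = f ^+ n); first exact: is_deriveX.
by apply/funext => s; elim: n => [|n IHn]; rewrite ?expr0// !exprS IHn.
Qed.

End real_derivatives.

(** * Differentiation along rotations *)

Section rotation_derivative.
Context (R : realType) (n : nat).
Local Notation V := 'rV[R]_n.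
Local Notation e_ := (fun j : 'I_n => delta_mx ord0 j : V).
Local Notation S := (@sphere R n).
Implicit Types (x y : V) (i j : 'I_n) (F : V -> R).

Definition rotJ i j (x : V) : V := x ord0 i *: e_ j - x ord0 j *: e_ i.

Lemma rotJ_l i j x : i != j -> rotJ i j x ord0 i = - x ord0 j.
Proof. by move=> ij; rewrite !mxE !eqxx/= (negbTE ij) mulr0 mulr1 sub0r. Qed.

Lemma rotJ_r i j x : i != j -> rotJ i j x ord0 j = x ord0 i.
Proof.
by move=> ij; rewrite !mxE !eqxx/= [j == i]eq_sym (negbTE ij) mulr0 mulr1 subr0.
Qed.

Lemma is_derive_rot_coor i j x (t : R) k : i != j ->
  is_derive t 1 (fun t => rot i j t x ord0 k) (rotJ i j (rot i j t x) ord0 k).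
Proof.
move=> ij.
rewrite (_ : (fun t => _) = (fun t => (x ord0 k - (k == i)%:R * x ord0 i - (k == j)%:R * x ord0 j) +
    ((k == i)%:R * x ord0 i + (k == j)%:R * x ord0 j) * cos t +
    ((k == j)%:R * x ord0 i - (k == i)%:R * x ord0 j) * sin t)); last first.
  by apply/funext => s; rewrite !mxE eqxx/=; ring.
apply: (is_derive_eq (derive_addf (derive_addf (derive_cstf _ t)
  (derive_scalef _ (is_derive_cos t))) (derive_scalef _ (is_derive_sin t)))).
rewrite !mxE !eqxx/= (negbTE ij) [j == i]eq_sym (negbTE ij)/=; ring.
Qed.

Lemma is_derive_rot i j x (t : R) : i != j ->
  is_derive t 1 (fun t => rot i j t x) (rotJ i j (rot i j t x)).
Proof.
move=> ij; apply: DeriveDef.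
  apply/derivable_mxP => a k; rewrite (ord1 a).
  by have /@ex_derive := is_derive_rot_coor x t k ij.
rewrite derive_mx; last first.
  apply/derivable_mxP => a k; rewrite (ord1 a).
  by have /@ex_derive := is_derive_rot_coor x t k ij.
apply/rowP => k; rewrite mxE.
by have /@derive_val := is_derive_rot_coor x t k ij.
Qed.

Lemma rot_neq0 i j (t : R) x : i != j -> x != 0 -> rot i j t x != 0.
Proof. by move=> ij; rewrite -!enorm_gt0 enorm_rot. Qed.

(** The angular momentum operator x_i d_j - x_j d_i, the derivative of F along the rotation of the
    (i, j)-plane. *)
Definition Lrot i j F x : R :=
  x ord0 i * 'D_(e_ j) F x - x ord0 j * 'D_(e_ i) F x.

Lemma sum_rotJ i j x (g : 'I_n -> R) : i != j ->
  \sum_(k < n) rotJ i j x ord0 k * g k = x ord0 i * g j - x ord0 j * g i.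
Proof.
move=> ij.
under eq_bigr do rewrite !mxE eqxx/= mulrBl.
rewrite sumrB (bigD1 j)//= big1 => [|k kj]; last by rewrite (negbTE kj) mulr0 mul0r.
rewrite eqxx mulr1 addr0; congr (_ - _).
rewrite (bigD1 i)//= big1 => [|k kj]; last by rewrite (negbTE kj) mulr0 mul0r.
by rewrite eqxx mulr1 addr0.
Qed.

Lemma is_derive_Lrot F i j x (t : R) : c1 F -> i != j -> x != 0 ->
  is_derive t 1 (fun t => F (rot i j t x)) (Lrot i j F (rot i j t x)).
Proof.
move=> cF ij x0.
have := @is_derive_curve R n F (fun t => rot i j t x) _ t
  (c1_differentiable cF (rot_neq0 t ij x0)) (is_derive_rot x t ij).
by rewrite sum_rotJ.
Qed.

(** [Lrot] applied twice, expanded by the product rule: along the rotation x_i has derivative -x_j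
    and x_j has derivative x_i. In this form its continuity and the Euler relations can be read
    off. *)
Definition Lrot2 i j F x : R :=
  x ord0 i * Lrot i j ('D_(e_ j) F) x - x ord0 j * 'D_(e_ j) F x
  - (x ord0 j * Lrot i j ('D_(e_ i) F) x + x ord0 i * 'D_(e_ i) F x).

Definition c2 F := c1 F /\ forall i, c1 ('D_(e_ i) F).

Lemma is_derive_Lrot2 F i j x (t : R) : c2 F -> i != j -> x != 0 ->
  is_derive t 1 (fun t => Lrot i j F (rot i j t x)) (Lrot2 i j F (rot i j t x)).
Proof.
move=> [cF cDF] ij x0.
have di := is_derive_rot_coor x t i ij.
have dj := is_derive_rot_coor x t j ij.
have dDi := is_derive_Lrot t (cDF i) ij x0.
have dDj := is_derive_Lrot t (cDF j) ij x0.
rewrite /Lrot.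
apply: (is_derive_eq (derive_subf (derive_mulf di dDj) (derive_mulf dj dDi))).
rewrite (rotJ_l _ ij) (rotJ_r _ ij) /Lrot2; move: (rot i j t x) => y.
move: (Lrot i j _ y) (Lrot i j _ y) ('D_(e_ i) F y) ('D_(e_ j) F y) => a b c e.
ring.
Qed.

Lemma c1_continuous F x : c1 F -> x != 0 -> {for x, continuous F}.
Proof. by move=> cF x0; apply: differentiable_continuous; exact: c1_differentiable. Qed.

Lemma continuous_Lrot i j F x : c1 F -> x != 0 -> {for x, continuous (Lrot i j F)}.
Proof.
move=> cF x0; apply: continuousB; apply: continuousM; try exact: coord_continuous.
  by have [] := cF x j x0.
by have [] := cF x i x0.
Qed.

Lemma continuous_Lrot2 i j F x : c2 F -> x != 0 -> {for x, continuous (Lrot2 i j F)}.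
Proof.
move=> [cF cDF] x0.
have Di k : {for x, continuous ('D_(e_ k) F)} by have [] := cF x k x0.
have Li k : {for x, continuous (Lrot i j ('D_(e_ k) F))} by exact: continuous_Lrot.
have ck k : {for x, continuous (fun y : V => y ord0 k)} by exact: coord_continuous.
by apply: continuousB; [apply: continuousB|apply: continuousD]; apply: continuousM.
Qed.

Lemma continuous_dot : continuous (fun x : V => dot x x).
Proof.
move=> x; apply: differentiable_continuous.
rewrite (_ : (fun _ => _) = \sum_(i < n) ((fun y : V => y ord0 i) * (fun y : V => y ord0 i))); last first.
  by apply/funext => y; rewrite fct_sumE.
by apply: differentiable_sum => i; apply: differentiableM; exact: differentiable_coord.
Qed.

Lemma continuous_enorm : continuous (@enorm R n).
Proof.
move=> x; apply: (@continuous_comp _ _ _ (fun x : V => dot x x) (@Num.sqrt R)).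
  exact: continuous_dot.
exact: sqrt_continuous.
Qed.

Lemma compact_sphere : compact S.
Proof.
apply: bounded_closed_compact.
  exists 1; split; first exact: num_real.
  move=> M M1 x Sx; apply/ltW; apply: mx_norm_lt => [|i]; first exact: lt_trans M1.
  by apply: le_lt_trans M1; rewrite (le_trans (coor_le_enorm _ _))// Sx.
rewrite (_ : S = @enorm R n @^-1` [set 1])//.
apply: (closed_comp (f := @enorm R n)); last first.
  exact/accessible_closed_set1/hausdorff_accessible/Rhausdorff.
by move=> x _; exact: continuous_enorm.
Qed.

Lemma continuous_bmf F : (forall x, x != 0 -> {for x, continuous F}) -> bmf S F.
Proof.
move=> cF; split.
  apply: (measurable_funS _ _ (open_continuous_measurable_rV (@open_neq0 R n) cF)).
    by apply: open_measurable_rV; exact: open_neq0.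
  by move=> x; exact: sphere_neq0.
have : compact (F @` S).
  apply: continuous_compact; last exact: compact_sphere.
  by apply: continuous_in_subspaceT => x /set_mem /sphere_neq0; exact: cF.
move=> /compact_bounded[M [_ MS]]; exists (M + 1) => x Sx.
by apply: MS; [rewrite ltrDl|exists x].
Qed.

End rotation_derivative.

(** * Homogeneous functions of degree 0 and the spherical Laplacian *)

Section homogeneous.
Context (R : realType) (n : nat).
Local Notation V := 'rV[R]_n.
Local Notation e_ := (fun j : 'I_n => delta_mx ord0 j : V).
Local Notation S := (@sphere R n).
Implicit Types (x y : V) (i j : 'I_n) (F : V -> R).

Definition hom_deg0 F := forall (c : R) x, 0 < c -> F (c *: x) = F x.

Lemma is_derive_dilation x (t : R) :
  is_derive t 1 (fun t => expR t *: x) (expR t *: x).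
Proof. by apply: is_derive_scalev; exact: is_derive_expR. Qed.

Lemma dilation_neq0 x (t : R) : x != 0 -> expR t *: x != 0.
Proof. by move=> x0; rewrite scaler_eq0 gt_eqF ?expR_gt0. Qed.

Lemma is_derive_dil F x : c1 F -> x != 0 ->
  is_derive (0 : R) 1 (fun t => F (expR t *: x)) (\sum_(i < n) x ord0 i * 'D_(e_ i) F x).
Proof.
move=> cF x0.
have := @is_derive_curve R n F (fun t => expR t *: x) _ 0
  (c1_differentiable cF (dilation_neq0 0 x0)) (is_derive_dilation x 0).
by rewrite expR0 scale1r.
Qed.

Lemma euler_deg0 F x : c1 F -> hom_deg0 F -> x != 0 ->
  \sum_(i < n) x ord0 i * 'D_(e_ i) F x = 0.
Proof.
move=> cF hF x0; have /@derive_val <- := is_derive_dil cF x0.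
rewrite (_ : (fun t => _) = cst (F x)) ?derive_cst//.
by apply/funext => t; rewrite hF// expR_gt0.
Qed.

(** Differentiate F (c x + t c e_j) = F (x + t e_j) at t = 0. *)
Lemma partial_homN1 F x (c : R) j : c1 F -> hom_deg0 F -> x != 0 -> 0 < c ->
  c * 'D_(e_ j) F (c *: x) = 'D_(e_ j) F x.
Proof.
move=> cF hF x0 c0.
have cx0 : c *: x != 0 by rewrite scaler_eq0 gt_eqF.
pose g (t : R) : V := c *: x + t *: (c *: e_ j).
have g0 : g 0 = c *: x by rewrite /g scale0r addr0.
have dg : is_derive (0 : R) 1 g (c *: e_ j).
  rewrite -[X in is_derive _ _ _ X]add0r -[X in _ + X]scale1r.
  apply: is_deriveD.
  exact: is_derive_scalev.
have dF : differentiable F (g 0) by rewrite g0; exact: c1_differentiable.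
have := is_derive_curve dF dg; rewrite g0.
rewrite (bigD1 j)//= big1 => [|k kj]; last by rewrite !mxE eqxx/= (negbTE kj) mulr0 mul0r.
rewrite !mxE !eqxx mulr1 addr0 => /@derive_val.
have xE : x = x + (0 : R) *: e_ j by rewrite scale0r addr0.
have dFl : derivable F (x + (0 : R) *: e_ j) (e_ j).
  by rewrite -xE; have [] := cF x j x0.
have -> : F \o g = (fun s => F (x + s *: e_ j)).
  by apply/funext => t /=; rewrite /g scalerA mulrC -scalerA -scalerDr hF.
by move=> <-; have := is_derive_line dFl; rewrite -xE => /@derive_val.
Qed.

(** By [partial_homN1] the function e^t d_j F (e^t x) is constant in t; its derivative at t = 0
    gives Euler's relation in degree -1. *)
Lemma euler_partial F x j : c2 F -> hom_deg0 F -> x != 0 ->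
  \sum_(i < n) x ord0 i * 'D_(e_ i) ('D_(e_ j) F) x = - 'D_(e_ j) F x.
Proof.
move=> [cF cDF] hF x0.
have := derive_mulf (is_derive_expR 0) (is_derive_dil (cDF j) x0).
rewrite (_ : (fun t => _) = cst ('D_(e_ j) F x)); last first.
  by apply/funext => t; rewrite partial_homN1// expR_gt0.
move=> /@derive_val; rewrite derive_cst expR0 mul1r scale1r mulr1 => /esym/eqP.
by rewrite addr_eq0 => /eqP.
Qed.

(** The algebra behind [sum_Lrot2], with H for the second and G for the first partial derivatives.
    [eH] contracts the first index of H, so the sum of x_j H i j over j is kept until the outer sum
    over i, where exchanging the sums makes it vanish. *)
Lemma sum_quadratic (x : V) (H : 'I_n -> 'I_n -> R) (G : 'I_n -> R) :
  dot x x = 1 -> (forall j, \sum_i x ord0 i * H i j = - G j) ->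
  \sum_i x ord0 i * G i = 0 ->
  \sum_i \sum_(j | i != j)
    (x ord0 i * (x ord0 i * H j j - x ord0 j * H i j) - x ord0 j * G j
     - (x ord0 j * (x ord0 i * H j i - x ord0 j * H i i) + x ord0 i * G i)) =
  2 * \sum_j H j j.
Proof.
move=> x1 eH eG.
pose f i j := x ord0 i * (x ord0 i * H j j - x ord0 j * H i j) - x ord0 j * G j
   - (x ord0 j * (x ord0 i * H j i - x ord0 j * H i i) + x ord0 i * G i).
(* The diagonal terms -2 x_i G_i cancel by Euler's relation, so the sum may run over all pairs. *)
have diag : \sum_i f i i = 0.
  rewrite (eq_bigr (fun i => - 2 * (x ord0 i * G i))); last by move=> i _; rewrite /f; ring.
  by rewrite -mulr_sumr eG mulr0.
transitivity (\sum_i \sum_j f i j).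
  transitivity (\sum_i f i i + \sum_i \sum_(j | i != j) f i j).
    by rewrite diag add0r.
  rewrite -big_split/=; apply: eq_bigr => i _.
  rewrite [RHS](bigD1 i)//=; congr (_ + _).
  by apply: eq_bigl => j; rewrite eq_sym.
pose D := \sum_j H j j.
have inner i : \sum_j f i j = x ord0 i ^+ 2 * D - x ord0 i * (\sum_j x ord0 j * H i j)
    + x ord0 i * G i + H i i - n%:R * (x ord0 i * G i).
  rewrite (eq_bigr (fun j => x ord0 i ^+ 2 * H j j - x ord0 i * (x ord0 j * H i j)
    - x ord0 j * G j - x ord0 i * (x ord0 j * H j i) + x ord0 j * x ord0 j * H i i
    - x ord0 i * G i)); last by move=> j _; rewrite /f; ring.
  rewrite !(big_split, sumrN) /= -!mulr_sumr -mulr_suml eH eG.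
  rewrite -[X in X * H i i]/(dot x x) x1 sumr_const card_ord -[_ *+ n]mulr_natl /D.
  by ring.
rewrite (eq_bigr _ (fun i _ => inner i)) !(big_split, sumrN) /= -!mulr_suml -!mulr_sumr eG.
have -> : \sum_i x ord0 i ^+ 2 = dot x x by apply: eq_bigr => i _; rewrite expr2.
have -> : \sum_i x ord0 i * (\sum_j x ord0 j * H i j) = 0.
  under eq_bigr do rewrite mulr_sumr.
  rewrite exchange_big/= (eq_bigr (fun j => - (x ord0 j * G j))); last first.
    move=> j _; rewrite -mulrN -eH mulr_sumr; apply: eq_bigr => i _; ring.
  by rewrite sumrN eG oppr0.
by rewrite x1 -/D; ring.
Qed.

Lemma sum_Lrot2 F x : c2 F -> hom_deg0 F -> S x ->
  \sum_i \sum_(j | i != j) Lrot2 i j F x =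
  2 * \sum_(j < n) 'D_(e_ j) ('D_(e_ j) F) x.
Proof.
move=> cF hF Sx; have x0 := sphere_neq0 Sx; have /sphere_dot x1 := Sx.
exact: (@sum_quadratic x (fun a b => 'D_(e_ a) ('D_(e_ b) F) x)
  (fun a => 'D_(e_ a) F x) x1 (fun j => euler_partial j cF hF x0)
  (euler_deg0 cF.1 hF x0)).
Qed.

End homogeneous.

Section laplace_beltrami.
Context (R : realType) (n : nat).
Local Notation V := 'rV[R]_n.
Local Notation e_ := (fun j : 'I_n => delta_mx ord0 j : V).
Local Notation S := (@sphere R n).
Implicit Types (x y : V) (i j : 'I_n) (f : V -> R).

Lemma hom0_deg0 f : hom_deg0 (hom0 f).
Proof. by move=> c x c0; rewrite /hom0/= dirZ. Qed.

Lemma sphere_C2_c2 f : sphere_C2 f -> c2 (hom0 f).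
Proof.
by move=> Cf; split => [x i|i x j] x0; [have [] := Cf i i x x0|have [] := Cf i j x x0].
Qed.

Lemma derive_enorm w j : S w -> is_derive (0 : R) 1 (fun s => enorm (w + s *: e_ j)) (w ord0 j).
Proof.
move=> /sphere_dot w1.
have E s : dot (w + s *: e_ j) (w + s *: e_ j) = 1 + (2 * w ord0 j) * s + s * s.
  rewrite !(dotDl, dotDr, dotZl, dotZr) ![dot (delta_mx _ _) _]dotC !dot_delta w1.
  by rewrite mxE !eqxx/=; ring.
have d : is_derive (0 : R) 1 (fun s : R => 1 + (2 * w ord0 j) * s + s * s) (2 * w ord0 j).
  apply: (is_derive_eq (derive_addf (derive_addf (derive_cstf 1 (0 : R))
    (derive_scalef (2 * w ord0 j) (is_derive_id (0 : R) 1)))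
    (derive_mulf (is_derive_id (0 : R) 1) (is_derive_id (0 : R) 1)))).
  by rewrite /=; ring.
rewrite (_ : (fun s => _) = Num.sqrt \o (fun s : R => 1 + (2 * w ord0 j) * s + s * s)); last first.
  by apply/funext => s; rewrite /enorm E.
have q0 : 1 + (2 * w ord0 j) * 0 + 0 * 0 = 1 :> R by rewrite !mulr0 !addr0.
have ds : is_derive (1 + (2 * w ord0 j) * 0 + 0 * 0 : R) 1 Num.sqrt (2 * Num.sqrt 1)^-1.
  by rewrite q0; exact: (is_derive1_sqrt (@ltr01 R)).
have dc := @is_derive1_comp R Num.sqrt (fun s : R => 1 + (2 * w ord0 j) * s + s * s) 0 _ _ ds d.
by apply: (is_derive_eq dc); rewrite sqrtr1 mulr1 mulKf.
Qed.

Lemma derive_lineE f w v : 'D_v f w = 'D_1 (fun s : R => f (w + s *: v)) 0.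
Proof.
rewrite /derive; congr (lim _); congr (_ @ 0^').
apply/funext => h /=; rewrite scale0r addr0 addr0 [h *: 1]mulr1.
by rewrite [h *: v + w]addrC.
Qed.

(** Extending the spherical gradient with degree 0 multiplies the Euclidean gradient, of degree -1,
    by |x|. Differentiating |x| adds w_j d_j F to the j-th term, and these additions sum to zero by
    Euler's relation. *)
Lemma laplace_beltramiE f w : sphere_C2 f -> S w ->
  laplace_beltrami f w = \sum_(j < n) 'D_(e_ j) ('D_(e_ j) (hom0 f)) w.
Proof.
move=> Cf Sw; have [cF cDF] := sphere_C2_c2 Cf; have w0 := sphere_neq0 Sw.
have hF := @hom0_deg0 f.
have step j : 'D_(e_ j) (fun x => hom0 (sphere_grad f) x ord0 j) w =
    'D_(e_ j) ('D_(e_ j) (hom0 f)) w + w ord0 j * 'D_(e_ j) (hom0 f) w.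
  have E : \forall x \near w, hom0 (sphere_grad f) x ord0 j =
      enorm x * 'D_(e_ j) (hom0 f) x.
    have nz : \forall x \near w, x != 0.
      by apply: open_nbhs_nbhs; split => //; exact: open_neq0.
    near=> x; have x0 : x != 0 by near: x.
    rewrite /hom0/= mxE -/(hom0 f).
    have ex : 0 < enorm x by rewrite enorm_gt0.
    by rewrite -(partial_homN1 j cF hF x0 (c := (enorm x)^-1)) ?invr_gt0// mulVKf// gt_eqF.
  rewrite (near_eq_derive _ E) derive_lineE.
  have dD : is_derive (0 : R) 1 (fun s => 'D_(e_ j) (hom0 f) (w + s *: e_ j))
      ('D_(e_ j) ('D_(e_ j) (hom0 f)) w).
    have wE : w = w + (0 : R) *: e_ j by rewrite scale0r addr0.
    have dl : derivable ('D_(e_ j) (hom0 f)) (w + (0 : R) *: e_ j) (e_ j).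
      by rewrite -wE; have [] := cDF j w j w0.
    by have := is_derive_line dl; rewrite -wE.
  have /@derive_val -> := derive_mulf (derive_enorm j Sw) dD.
  rewrite !scale0r !addr0 Sw mul1r; congr (_ + _); exact: mulrC.
rewrite /laplace_beltrami /sphere_div (eq_bigr _ (fun j _ => step j)) big_split/=.
by rewrite euler_deg0// addr0.
Unshelve. all: by end_near. Qed.

End laplace_beltrami.

(** * The recurrence for moments under a rotation-invariant measure *)

Section uniformly_bounded.
Context (R : realType) (T : Type) (D : set T).
Implicit Types f g : R -> T -> R.

(** The bound is uniform in the angle t: this is the domination required by
    [is_derive_Rintegral]. *)
Definition ubd f := exists M, forall t x, D x -> `|f t x| <= M.

Lemma ubd_add f g : ubd f -> ubd g -> ubd (fun t x => f t x + g t x).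
Proof.
move=> [M fM] [N gN]; exists (M + N) => t x Dx.
by rewrite (le_trans (ler_normD _ _))// lerD ?fM ?gN.
Qed.

Lemma ubd_mul f g : ubd f -> ubd g -> ubd (fun t x => f t x * g t x).
Proof.
move=> [M fM] [N gN]; exists (M * N) => t x Dx.
by rewrite normrM ler_pM ?fM ?gN.
Qed.

Lemma ubd_exp f k : ubd f -> ubd (fun t x => f t x ^+ k).
Proof.
move=> bf; elim: k => [|k IHk]; first by exists 1 => t x _; rewrite normr1.
have [M fM] := ubd_mul bf IHk; exists M => t x Dx.
by rewrite exprS fM.
Qed.

Lemma ubd_fun (g : T -> R) : (exists M, forall x, D x -> `|g x| <= M) -> ubd (fun=> g).
Proof. by move=> [M gM]; exists M => t; exact: gM. Qed.

Lemma ubd_real (g : R -> R) : (forall t, `|g t| <= 1) -> ubd (fun t _ => g t).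
Proof. by move=> g1; exists 1. Qed.

End uniformly_bounded.

Section ladder.
Context (R : realType) (n : nat).
Local Notation V := 'rV[R]_n.
Local Notation e_ := (fun j : 'I_n => delta_mx ord0 j : V).
Local Notation S := (@sphere R n).
Implicit Types (y z : V) (i j : 'I_n) (F : V -> R).

Lemma measurable_rot i j t : i != j -> measurable_fun setT (rot i j t : V -> V).
Proof. by move=> ij; have [] := surface_measure_rot (R := R) t ij. Qed.

Lemma bmf_rot i j t F : i != j -> bmf S F -> bmf S (fun x => F (rot i j t x)).
Proof.
move=> ij [mF [M FM]]; split; last by exists M => x Sx; apply: FM; exact/sphere_rot.
apply: (@measurable_comp _ _ _ _ _ _ S F S (rot i j t)) => //.
- exact: measurable_sphere.
- by move=> _ [x Sx <-]; exact/sphere_rot.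
- by apply: measurable_funTS; exact: measurable_rot.
Qed.

(** [plane_sym] and [plane_alt] are the coefficients of cos t and sin t in the inner product of y
    with z rotated in the (i, j)-plane. *)
Definition plane_sym i j z y := z ord0 i * y ord0 i + z ord0 j * y ord0 j.
Definition plane_alt i j z y := z ord0 i * y ord0 j - z ord0 j * y ord0 i.

Lemma dot_rotl i j (t : R) z y : dot (rot i j t z) y =
  (dot z y - plane_sym i j z y) + plane_sym i j z y * cos t + plane_alt i j z y * sin t.
Proof.
rewrite /rot /givens !(dotDl, dotZl) ![dot (delta_mx _ _) _]dotC !dot_delta.
by rewrite /plane_sym /plane_alt; ring.
Qed.

Lemma sum_plane_sym z y :
  \sum_i \sum_(j | i != j) plane_sym i j z y = 2 * (n%:R - 1) * dot z y.
Proof.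
have [n0|n0] := posnP n.
  rewrite big1 => [|i _]; last by have := ltn_ord i; rewrite [X in (_ < X)%N]n0.
  rewrite (_ : dot z y = 0) ?mulr0//.
  by rewrite /dot big1// => i _; have := ltn_ord i; rewrite [X in (_ < X)%N]n0.
have E : \sum_i \sum_j plane_sym i j z y = 2 * n%:R * dot z y.
  rewrite (eq_bigr (fun i => n%:R * (z ord0 i * y ord0 i) + dot z y)); last first.
    by move=> i _; rewrite big_split/= sumr_const card_ord mulr_natl.
  by rewrite big_split/= -mulr_sumr sumr_const card_ord -[_ *+ n]mulr_natl /dot; ring.
have E' : \sum_i \sum_j plane_sym i j z y = 2 * dot z y + \sum_i \sum_(j | i != j) plane_sym i j z y.
  rewrite /dot mulr_sumr -big_split/=; apply: eq_bigr => i _.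
  rewrite (bigD1 i)//=; congr (_ + _); first by rewrite /plane_sym; ring.
  by apply: eq_bigl => j; rewrite eq_sym.
have := E'; rewrite E => /eqP; rewrite addrC -subr_eq => /eqP <-; ring.
Qed.

(** Lagrange's identity; the factor 2 comes from summing over ordered pairs. *)
Lemma sum_plane_alt z y :
  \sum_i \sum_(j | i != j) plane_alt i j z y ^+ 2 = 2 * (dot z z * dot y y - dot z y ^+ 2).
Proof.
transitivity (\sum_i \sum_j plane_alt i j z y ^+ 2).
  apply: eq_bigr => i _; rewrite [RHS](bigD1 i)//= /plane_alt subrr expr0n add0r.
  by apply: eq_bigl => j; rewrite eq_sym.
rewrite (eq_bigr (fun i => z ord0 i ^+ 2 * dot y y - 2 * (z ord0 i * y ord0 i) * dot z y
   + y ord0 i ^+ 2 * dot z z)); last first.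
  move=> i _; rewrite /dot !mulr_sumr -sumrB -big_split/=.
  by apply: eq_bigr => j _; rewrite /plane_alt; ring.
rewrite big_split sumrB/= -!mulr_suml -mulr_sumr.
rewrite -/(dot z y).
have sq (w : V) : \sum_i w ord0 i ^+ 2 = dot w w by apply: eq_bigr => i _; rewrite expr2.
by rewrite !sq; ring.
Qed.

Context dT (T : measurableType dT) (nu : {measure set T -> \bar R}) (D : set T).
Hypotheses (mD : measurable D) (Doo : (nu D < +oo)%E).
Variables (xi q : T -> V) (tau : 'I_n -> 'I_n -> R -> T -> T).
Hypotheses (mxi : measurable_fun D xi) (Sxi : forall x : T, D x -> S (xi x)).
Hypothesis bq : forall k, bmf D (fun x => q x ord0 k).
Hypothesis tauP : forall i j t, i != j -> [/\ preserves nu (tau i j t),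
  forall x, D (tau i j t x) <-> D x,
  forall x, xi (tau i j t x) = rot i j t (xi x) &
  forall x, q (tau i j t x) = rot i j t (q x)].

Definition moment F (m p : nat) z : R :=
  \int[nu]_(x in D) (F (xi x) * dot z (q x) ^+ m * dot (q x) (q x) ^+ p).

Lemma bmf_xi F : bmf S F -> bmf D (fun x => F (xi x)).
Proof.
move=> [mF [M FM]]; split; last by exists M => x /Sxi/FM.
apply: (@measurable_comp _ _ _ _ _ _ S F D xi) => //.
- exact: measurable_sphere.
- by move=> _ [x /Sxi Sx <-].
Qed.

Lemma bmf_dotq z : bmf D (fun x => dot z (q x)).
Proof. by apply: bmf_sum => i _; exact: bmfZ. Qed.

Lemma bmf_q2 p : bmf D (fun x => dot (q x) (q x) ^+ p).
Proof. by apply: bmfX; apply: bmf_sum => i _; exact: bmfM. Qed.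

Lemma bmf_sym i j z : bmf D (fun x => plane_sym i j z (q x)).
Proof. by apply: bmfD; exact: bmfZ. Qed.

Lemma bmf_alt i j z : bmf D (fun x => plane_alt i j z (q x)).
Proof. by apply: bmfB; exact: bmfZ. Qed.

Lemma bmf_moment F m p z : bmf S F ->
  bmf D (fun x => F (xi x) * dot z (q x) ^+ m * dot (q x) (q x) ^+ p).
Proof.
move=> bF; apply: bmfM; last exact: bmf_q2.
by apply: bmfM; [exact: bmf_xi|apply: bmfX; exact: bmf_dotq].
Qed.

Lemma moment_rot F m p z i j t : i != j -> bmf S F ->
  moment (fun x => F (rot i j t x)) m p z = moment F m p (rot i j t z).
Proof.
move=> ij bF; have [ptau Dtau xitau qtau] := tauP t ij.
rewrite /moment -(Rintegral_preserves mD Doo ptau Dtau (bmf_moment m p (rot i j t z) bF)).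
by apply: eqD_Rintegral => x _; rewrite xitau qtau !dot_rot.
Qed.

Lemma derive_moment F F' i j m p z (t : R) : i != j -> bmf S F -> bmf S F' ->
  (forall y (t : R), y != 0 -> is_derive t 1 (fun t => F (rot i j t y)) (F' (rot i j t y))) ->
  is_derive t 1 (fun t => moment (fun x => F (rot i j t x)) m p z)
    (moment (fun x => F' (rot i j t x)) m p z).
Proof.
move=> ij bF bF' dF.
apply: (is_derive_Rintegral mD Doo
  (f := fun t x => F (rot i j t (xi x)) * dot z (q x) ^+ m * dot (q x) (q x) ^+ p)
  (f' := fun t x => F' (rot i j t (xi x)) * dot z (q x) ^+ m * dot (q x) (q x) ^+ p)).
- by move=> s; apply: (bmf_moment m p z (F := fun x => F (rot i j s x))); exact: bmf_rot.
- apply: ubd_mul; last by apply: ubd_fun; exact: (bmf_q2 p).2.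
  apply: ubd_mul; last by apply: ubd_exp; apply: ubd_fun; exact: (bmf_dotq z).2.
  have [_ [M F'M]] := bF'; exists M => s x Dx; apply: F'M; apply/sphere_rot => //.
  exact: Sxi.
- move=> s x Dx.
  have /(derive_scalef (dot z (q x) ^+ m * dot (q x) (q x) ^+ p)) :=
    dF _ s (sphere_neq0 (Sxi Dx)).
  by under eq_fun do rewrite mulrC mulrA; rewrite [X in is_derive _ _ _ X]mulrC mulrA.
Qed.

Section plane.
Variables (i j : 'I_n) (z : V).
Hypothesis ij : i != j.

Let c (t : R) x := dot (rot i j t z) (q x).
Let c' (t : R) x := plane_alt i j z (q x) * cos t - plane_sym i j z (q x) * sin t.
Let c'' (t : R) x := - (plane_sym i j z (q x) * cos t) - plane_alt i j z (q x) * sin t.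

Let derive_c (t : R) (x : T) : is_derive t 1 (c^~ x) (c' t x).
Proof.
rewrite /c; under eq_fun do rewrite dot_rotl.
apply: (is_derive_eq (derive_addf (derive_addf (derive_cstf _ t)
  (derive_scalef _ (is_derive_cos t))) (derive_scalef _ (is_derive_sin t)))).
by rewrite /c'; ring.
Qed.

Let derive_c' (t : R) (x : T) : is_derive t 1 (c'^~ x) (c'' t x).
Proof.
rewrite /c'.
apply: (is_derive_eq (derive_subf (derive_scalef _ (is_derive_cos t))
  (derive_scalef _ (is_derive_sin t)))).
by rewrite /c''; ring.
Qed.

Let cos_le1 (t : R) : `|cos t| <= 1.
Proof. by rewrite ler_norml cos_geN1 cos_le1. Qed.

Let sin_le1 (t : R) : `|sin t| <= 1.
Proof. by rewrite ler_norml sin_geN1 sin_le1. Qed.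

Let ubd_c : ubd D c.
Proof.
rewrite /c; under eq_fun do under eq_fun do rewrite dot_rotl.
have sb := (bmf_sym i j z).2; have ab := (bmf_alt i j z).2.
apply: ubd_add; last by apply: ubd_mul; [exact: ubd_fun|exact: ubd_real].
apply: ubd_add; last by apply: ubd_mul; [exact: ubd_fun|exact: ubd_real].
by apply: ubd_fun; exact: (bmfB (bmf_dotq z) (bmf_sym i j z)).2.
Qed.

Let bmf_c t : bmf D (c t). Proof. exact: bmf_dotq. Qed.

Let bmf_c' t : bmf D (c' t).
Proof.
apply: bmfB; apply: bmfM; try exact: bmf_cst; [exact: bmf_alt|exact: bmf_sym].
Qed.

Let ubd_opp f : ubd D f -> ubd D (fun (t : R) (x : T) => - f t x : R).
Proof. by move=> [M fM]; exists M => t x Dx; rewrite normrN fM. Qed.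

Let ubd_c' : ubd D c'.
Proof.
have sb := (bmf_sym i j z).2; have ab := (bmf_alt i j z).2.
apply: ubd_add; last apply: ubd_opp; by apply: ubd_mul; [exact: ubd_fun|exact: ubd_real].
Qed.

Let ubd_c'' : ubd D c''.
Proof.
have sb := (bmf_sym i j z).2; have ab := (bmf_alt i j z).2.
by apply: ubd_add; apply: ubd_opp; apply: ubd_mul; [exact: ubd_fun|exact: ubd_real|exact: ubd_fun|exact: ubd_real].
Qed.

(** By [moment_rot], rotating F by t is the same as rotating z by t. Differentiating both sides
    twice at t = 0 moves two derivatives from F to the kernel. *)
Lemma derive2_moment F m p : c2 F ->
  moment (Lrot2 i j F) m p z =
  \int[nu]_(x in D) (F (xi x) * (m%:R * (m.-1%:R * dot z (q x) ^+ m.-2 * plane_alt i j z (q x) ^+ 2 -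
     dot z (q x) ^+ m.-1 * plane_sym i j z (q x))) * dot (q x) (q x) ^+ p).
Proof.
move=> c2F; have [cF cDF] := c2F.
have bF : bmf S F by apply: continuous_bmf => y; exact: c1_continuous.
have bL : bmf S (Lrot i j F) by apply: continuous_bmf => y; exact: continuous_Lrot.
have bL2 : bmf S (Lrot2 i j F) by apply: continuous_bmf => y; exact: continuous_Lrot2.
pose k t x := F (xi x) * c t x ^+ m * dot (q x) (q x) ^+ p.
pose k' t x := F (xi x) * (m%:R * (c t x ^+ m.-1 * c' t x)) * dot (q x) (q x) ^+ p.
pose k'' t x := F (xi x) * (m%:R * (m.-1%:R * c t x ^+ m.-2 * c' t x ^+ 2 +
   c t x ^+ m.-1 * c'' t x)) * dot (q x) (q x) ^+ p.
have dk (t : R) x : D x -> is_derive t 1 (k^~ x) (k' t x).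
  move=> _; have := derive_scalef (F (xi x) * dot (q x) (q x) ^+ p) (derive_expf m (derive_c t x)).
  rewrite (_ : (fun s => _ * _) = k^~ x); last by apply/funext => s; rewrite /k; ring.
  by move=> dh; apply: (is_derive_eq dh); rewrite /k'; ring.
have dk' (t : R) x : D x -> is_derive t 1 (k'^~ x) (k'' t x).
  move=> _; have := derive_scalef (F (xi x) * dot (q x) (q x) ^+ p * m%:R)
    (derive_mulf (derive_expf m.-1 (derive_c t x)) (derive_c' t x)).
  rewrite (_ : (fun s => _ * _) = k'^~ x); last by apply/funext => s; rewrite /k'; ring.
  by move=> dh; apply: (is_derive_eq dh); rewrite /k''; ring.
have bk t : bmf D (k t) by apply: bmf_moment.
have bk' t : bmf D (k' t).
  apply: bmfM; last exact: bmf_q2.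
  apply: bmfM; first exact: bmf_xi.
  by apply: bmfZ; apply: bmfM => //; exact: bmfX.
have uF : ubd D (fun (_ : R) x => F (xi x)) by apply: ubd_fun; exact: (bmf_xi bF).2.
have uq : ubd D (fun (_ : R) x => dot (q x) (q x) ^+ p) by apply: ubd_fun; exact: (bmf_q2 p).2.
have uc a : ubd D (fun (_ : R) (_ : T) => a : R) by exists `|a|.
have uk' : ubd D k'.
  apply: ubd_mul => //; apply: ubd_mul => //; apply: ubd_mul => //.
  by apply: ubd_mul => //; exact: ubd_exp.
have uk'' : ubd D k''.
  apply: ubd_mul => //; apply: ubd_mul => //; apply: ubd_mul => //.
  apply: ubd_add; last by apply: ubd_mul => //; exact: ubd_exp.
  by apply: ubd_mul; [apply: ubd_mul => //|]; exact: ubd_exp.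
(* The first derivatives are compared at every t, so that the identity can be differentiated once
   more. *)
have E1 (t : R) : moment (fun x => Lrot i j F (rot i j t x)) m p z = \int[nu]_(x in D) k' t x.
  have /@derive_val <- := derive_moment m p z t ij bF bL
     (fun y t nz => is_derive_Lrot t cF ij nz).
  have /@derive_val <- := is_derive_Rintegral mD Doo bk uk' dk t.
  by congr ('D_1 _ t); apply/funext => s; exact: moment_rot.
have := derive_moment m p z 0 ij bL bL2 (fun y t nz => is_derive_Lrot2 t c2F ij nz).
rewrite (funext E1) => /@derive_val.
have /@derive_val -> := is_derive_Rintegral mD Doo bk' uk'' dk' 0.
rewrite [X in _ = X -> _](_ : _ = moment (Lrot2 i j F) m p z); last first.
  by apply: eqD_Rintegral => x _; rewrite rot0.
move=> <-; apply: eqD_Rintegral => x _.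
by rewrite /k'' /c /c' /c'' rot0 cos0 sin0; congr (_ * _); ring.
Qed.

End plane.

Lemma moment_recurrence F lam m p z : c2 F ->
  (forall y, S y -> \sum_i \sum_(j | i != j) Lrot2 i j F y = - (2 * lam * F y)) ->
  (m%:R * (m%:R + n%:R - 2) - lam) * moment F m p z =
  m%:R * (m%:R - 1) * dot z z * moment F m.-2 p.+1 z.
Proof.
move=> c2F eF; have [cF cDF] := c2F.
have bF : bmf S F by apply: continuous_bmf => y; exact: c1_continuous.
have bL2 i j : bmf S (Lrot2 i j F) by apply: continuous_bmf => y; exact: continuous_Lrot2.
have E1 : \sum_i \sum_(j | i != j) moment (Lrot2 i j F) m p z = - (2 * lam * moment F m p z).
  rewrite -mulNr -bmf_RintegralZ//; last exact: bmf_moment.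
  rewrite (eq_bigr (fun i => \int[nu]_(x in D) (\sum_(j | i != j)
    (Lrot2 i j F (xi x) * dot z (q x) ^+ m * dot (q x) (q x) ^+ p)))); last first.
    by move=> i _; rewrite bmf_Rintegral_sum// => j _; exact: bmf_moment.
  rewrite -bmf_Rintegral_sum//; last by move=> i _; apply: bmf_sum => j _; exact: bmf_moment.
  apply: eqD_Rintegral => x /Sxi Sx.
  under eq_bigr do rewrite -!mulr_suml.
  by rewrite -!mulr_suml eF//; ring.
have E2 : \sum_i \sum_(j | i != j) moment (Lrot2 i j F) m p z =
    2 * (m%:R * (m%:R - 1) * dot z z * moment F m.-2 p.+1 z
     - m%:R * (m%:R + n%:R - 2) * moment F m p z).
  rewrite -!bmf_RintegralZ//; try exact: bmf_moment.
  rewrite -bmf_RintegralB//; try by apply: bmfZ; exact: bmf_moment.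
  rewrite -bmf_RintegralZ//; last by apply: bmfB; apply: bmfZ; exact: bmf_moment.
  pose g i j x := F (xi x) * (m%:R * (m.-1%:R * dot z (q x) ^+ m.-2 * plane_alt i j z (q x) ^+ 2 -
     dot z (q x) ^+ m.-1 * plane_sym i j z (q x))) * dot (q x) (q x) ^+ p.
  have bg i j : bmf D (g i j).
    apply: bmfM; last exact: bmf_q2.
    apply: bmfM; first exact: bmf_xi.
    apply: bmfZ; apply: bmfB; apply: bmfM.
    - by apply: bmfZ; apply: bmfX; exact: bmf_dotq.
    - by apply: bmfX; exact: bmf_alt.
    - by apply: bmfX; exact: bmf_dotq.
    - exact: bmf_sym.
  rewrite (eq_bigr (fun i => \int[nu]_(x in D) (\sum_(j | i != j) g i j x))); last first.
    move=> i _; rewrite bmf_Rintegral_sum//; apply: eq_bigr => j ij.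
    exact: derive2_moment.
  rewrite -bmf_Rintegral_sum//; last by move=> i _; exact: bmf_sum.
  apply: eqD_Rintegral => x _.
  have -> : \sum_i \sum_(j | i != j) g i j x =
      F (xi x) * dot (q x) (q x) ^+ p * m%:R * (m.-1%:R * dot z (q x) ^+ m.-2 *
        (\sum_i \sum_(j | i != j) plane_alt i j z (q x) ^+ 2) -
      dot z (q x) ^+ m.-1 * \sum_i \sum_(j | i != j) plane_sym i j z (q x)).
    rewrite mulrBr !mulrA !mulr_sumr -sumrB; apply: eq_bigr => i _.
    rewrite !mulr_sumr -sumrB; apply: eq_bigr => j _.
    by rewrite /g; ring.
  rewrite sum_plane_alt sum_plane_sym.
  (* For m = 0, 1 the truncated exponents [m.-1] and [m.-2] are not the true ones, but the
     coefficients in front of the affected terms vanish. *)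
  case: m {E1 bg g} => [|[|m]] /=; first by ring.
    by rewrite !expr1 !expr0; ring.
  by rewrite !exprS -[in m.+2%:R]addn2 -[in m.+1%:R]addn1 !natrD; ring.
by move: E2; rewrite E1 => E; lra.
Qed.

End ladder.

(** * Moments on the sphere and on pairs of points of the sphere *)

Section surface_measure_finite.
Context (R : realType) (n : nat).

Let surface_fin_num : fin_num_fun (@surface_measure R n).
Proof. by move=> A mA; rewrite ge0_fin_numE ?measure_ge0// surface_measure_lty. Qed.

HB.instance Definition _ := Measure_isFinite.Build _ _ _ (@surface_measure R n) surface_fin_num.

End surface_measure_finite.

Section sphere_moments.
Context (R : realType) (n : nat).
Local Notation V := 'rV[R]_n.
Local Notation S := (@sphere R n).
Local Notation sigma := (@surface_measure R n).
Local Notation sigma2 := (sigma \x sigma)%E.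
Implicit Types (y z : V) (i j : 'I_n) (F : V -> R).

(* The squared generators of the rotations, summed over ordered pairs i != j,
   give twice the spherical Laplacian. *)
Definition eigen lam F := c2 F /\
  forall y, S y -> \sum_i \sum_(j | i != j) Lrot2 i j F y = - (2 * lam * F y).

Lemma eigen_bmf lam F : eigen lam F -> bmf S F.
Proof. by move=> [[cF _] _]; apply: continuous_bmf => y; exact: c1_continuous. Qed.

(** With F constant the recurrence computes the plain means of (z . x)^m, which control the
    concentrating kernels and the rotation invariance below. *)
Lemma eigen_cst (c : R) : eigen 0 (fun _ : V => c).
Proof.
have D0 j : 'D_(delta_mx ord0 j) (fun _ : V => c) = (fun=> 0).
  by apply/funext => y; exact: derive_cst.
have D00 j : 'D_(delta_mx ord0 j) (fun _ : V => 0 : R) = (fun=> 0).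
  by apply/funext => y; exact: derive_cst.
split.
  by split => [y i _|i y j _]; rewrite ?D0 ?D00; split; try exact: derivable_cst; exact: cst_continuous.
move=> y _; rewrite big1 => [|i _]; first by rewrite mulr0 mul0r oppr0.
rewrite big1// => j _; rewrite /Lrot2 /Lrot !D0 !derive_cst; ring.
Qed.

Lemma eigen_hom0 (f : V -> R) lam : sphere_C2 f ->
  (forall w, S w -> - laplace_beltrami f w = lam * f w) -> eigen lam (hom0 f).
Proof.
move=> Cf ef; split; first exact: sphere_C2_c2.
move=> y Sy; rewrite sum_Lrot2//; [|exact: sphere_C2_c2|exact: hom0_deg0].
rewrite -laplace_beltramiE// /hom0/= dir_id//.
by rewrite -[laplace_beltrami f y]opprK ef//; ring.
Qed.

Definition sphere_moment F m z : R := \int[sigma]_(x in S) (F x * dot z x ^+ m).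

Definition proj (v x : V) : V := x - dot x v *: v.

Definition proj_moment F m p z : R :=
  \int[sigma2]_(x in S `*` S) (F x.1 * dot z (proj x.2 x.1) ^+ m *
     dot (proj x.2 x.1) (proj x.2 x.1) ^+ p).

Lemma sphere_fin : (sigma S < +oo)%E.
Proof. by apply: surface_measure_lty; exact: measurable_sphere. Qed.

Lemma measurable_sphere2 : measurable (S `*` S).
Proof. by apply: measurableX; exact: measurable_sphere. Qed.

Lemma sphere2_fin : (sigma2 (S `*` S) < +oo)%E.
Proof.
rewrite product_measure1E; try exact: measurable_sphere.
by apply: lte_mul_pinfty => //; rewrite ?ge0_fin_numE ?measure_ge0// sphere_fin.
Qed.

Lemma bmf_coor i : bmf S (fun x => x ord0 i).
Proof.
split; first by apply: measurable_funTS; exact: measurable_coor.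
by exists 1 => x Sx; rewrite (le_trans (coor_le_enorm _ _))// Sx.
Qed.

Lemma bmf_dot z : bmf S (fun x => dot z x).
Proof. by apply: bmf_sum => i _; apply: bmfZ; exact: bmf_coor. Qed.

Lemma bmf_sphere_moment F m z : bmf S F -> bmf S (fun x => F x * dot z x ^+ m).
Proof. by move=> bF; apply: bmfM => //; apply: bmfX; exact: bmf_dot. Qed.

Lemma bmf_fst (F : V -> R) : bmf S F -> bmf (S `*` S) (fun x : V * V => F x.1).
Proof.
move=> [mF [M FM]]; split; last by exists M => x [Sx _]; exact: FM.
apply: (@measurable_comp _ _ _ _ _ _ S F (S `*` S) fst) => //.
- exact: measurable_sphere.
- by move=> _ [x [Sx _] <-].
- by apply: measurable_funTS; exact: measurable_fst.
Qed.

Lemma bmf_snd (F : V -> R) : bmf S F -> bmf (S `*` S) (fun x : V * V => F x.2).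
Proof.
move=> [mF [M FM]]; split; last by exists M => x [_ Sx]; exact: FM.
apply: (@measurable_comp _ _ _ _ _ _ S F (S `*` S) snd) => //.
- exact: measurable_sphere.
- by move=> _ [x [_ Sx] <-].
- by apply: measurable_funTS; exact: measurable_snd.
Qed.

Lemma bmf_dot12 : bmf (S `*` S) (fun x : V * V => dot x.1 x.2).
Proof.
apply: bmf_sum => i _; apply: bmfM.
- exact: (bmf_fst (bmf_coor i)).
- exact: (bmf_snd (bmf_coor i)).
Qed.

Lemma bmf_proj k : bmf (S `*` S) (fun x : V * V => proj x.2 x.1 ord0 k).
Proof.
apply: (@eq_bmf _ _ _ _ (fun x : V * V => x.1 ord0 k - dot x.1 x.2 * x.2 ord0 k)).
  by move=> x _; rewrite !mxE.
apply: bmfB; first exact: (bmf_fst (bmf_coor k)).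
by apply: bmfM; [exact: bmf_dot12|exact: (bmf_snd (bmf_coor k))].
Qed.

Lemma bmf_proj_moment (F : V -> R) m p z : bmf S F ->
  bmf (S `*` S) (fun x : V * V => F x.1 * dot z (proj x.2 x.1) ^+ m *
     dot (proj x.2 x.1) (proj x.2 x.1) ^+ p).
Proof.
move=> bF; apply: bmfM; first apply: bmfM.
- exact: bmf_fst.
- by apply: bmfX; apply: bmf_sum => i _; apply: bmfZ; exact: bmf_proj.
- by apply: bmfX; apply: bmf_sum => i _; apply: bmfM; exact: bmf_proj.
Qed.

Definition rot2 i j (t : R) (x : V * V) : V * V := (rot i j t x.1, rot i j t x.2).

Lemma preserves_rot2 i j t : i != j -> preserves sigma2 (rot2 i j t).
Proof.
move=> ij.
have pr := surface_measure_rot (R := R) t ij.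
rewrite (_ : rot2 i j t = (fun p => (p.1, rot i j t p.2)) \o (fun p => (rot i j t p.1, p.2)))//.
apply: preserves_comp.
  apply: (@preserves_skewr _ _ _ _ R sigma sigma (fun=> rot i j t)) => //.
  by apply: (measurableT_comp pr.1); exact: measurable_snd.
apply: (@preserves_skewl _ _ _ _ R sigma sigma (fun=> rot i j t)) => //.
by apply: (measurableT_comp pr.1); exact: measurable_fst.
Qed.

Lemma sphere_moment_recurrence F lam m z : eigen lam F ->
  (m%:R * (m%:R + n%:R - 2) - lam) * sphere_moment F m z =
  m%:R * (m%:R - 1) * dot z z * sphere_moment F m.-2 z.
Proof.
move=> [c2F eF].
(* On the sphere q = x has norm 1, so the exponent p has no effect. *)
have E a p : moment sigma S id id F a p z = sphere_moment F a z.
  apply: eqD_Rintegral => x /sphere_dot x1.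
  by rewrite x1 expr1n mulr1.
rewrite -(E m 0%N) -(E _ 1%N).
have mid : measurable_fun S (id : V -> V) by apply: measurable_funTS.
apply: (@moment_recurrence R n _ _ sigma S (@measurable_sphere R n) sphere_fin
  id id (fun i j t => rot i j t) mid (fun _ => id) bmf_coor _ F lam m 0%N z c2F eF).
by move=> i j t ij; split => //; [exact: surface_measure_rot|move=> x; exact: sphere_rot].
Qed.

Lemma proj_moment_recurrence F lam m p z : eigen lam F ->
  (m%:R * (m%:R + n%:R - 2) - lam) * proj_moment F m p z =
  m%:R * (m%:R - 1) * dot z z * proj_moment F m.-2 p.+1 z.
Proof.
move=> [c2F eF].
have mfst : measurable_fun (S `*` S) (fst : V * V -> V).
  by apply: measurable_funTS; exact: measurable_fst.
apply: (@moment_recurrence R n _ _ sigma2 (S `*` S) measurable_sphere2 sphere2_fin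
  fst (fun x => proj x.2 x.1) rot2 mfst _ bmf_proj _ F lam m p z c2F eF).
  by move=> x [].
move=> i j t ij; split => //.
- exact: preserves_rot2.
- by move=> x; split => -[/(sphere_rot t _ ij) a /(sphere_rot t _ ij) b].
- by move=> x; rewrite /proj/= rotB rotZ dot_rot.
Qed.

End sphere_moments.

(** * Vanishing, proportionality and Gram invariance of moments *)

Section moments.
Context (R : realType) (n : nat).
Hypothesis n3 : (3 <= n)%N.
Local Notation V := 'rV[R]_n.
Local Notation S := (@sphere R n).
Local Notation sigma := (@surface_measure R n).
Implicit Types (y z : V) (i j : 'I_n) (F : V -> R).

Definition lam (l : nat) : R := l%:R * (l%:R + n%:R - 2).

(** The difference of the eigenvalues is (l - m)(l + m + n - 2), and n >= 3 makes the second factor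
    positive. *)
Lemma lam_inj l m : lam l = lam m -> l = m.
Proof.
have n3' : 3 <= n%:R :> R by rewrite (ler_nat _ 3).
move=> e; apply/eqP; rewrite -(eqr_nat R) -subr_eq0.
have /eqP : (l%:R - m%:R) * (l%:R + m%:R + n%:R - 2) = 0 :> R.
  by move: e; rewrite /lam => e; lra.
rewrite mulf_eq0 => /orP[//|]; have l0 : 0 <= l%:R :> R := ler0n _ _.
have m0 : 0 <= m%:R :> R := ler0n _ _.
by rewrite gt_eqF//; lra.
Qed.

Lemma nat_ind2 (P : nat -> Prop) : P 0%N -> P 1%N -> (forall m, P m -> P m.+2) ->
  forall m, P m.
Proof.
move=> P0 P1 PS m; suff : P m /\ P m.+1 by case.
by elim: m => // m [Pm Pm1]; split => //; exact: PS.
Qed.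

Lemma lam_neq l m : (m < l)%N || (odd m != odd l) -> lam m - lam l != 0.
Proof.
move=> c; rewrite subr_eq0; apply/negP => /eqP/lam_inj l0.
by move: c; rewrite l0 ltnn eqxx.
Qed.

(** In this range [lam m - lam l] is invertible and the range is closed under lowering m by 2, so
    the recurrence descends until m (m - 1) = 0 stops it at m = 0 or 1. *)
Lemma vanish_step (A : nat -> nat -> R) (c : R) l :
  (forall m p, (lam m - lam l) * A m p = m%:R * (m%:R - 1) * c * A m.-2 p.+1) ->
  forall m p, (m < l)%N || (odd m != odd l) -> A m p = 0.
Proof.
move=> rec; elim/nat_ind2 => [||m IH] p ml; apply: (mulfI (lam_neq ml)); rewrite rec mulr0 /=.
- by rewrite !mul0r.
- by rewrite subrr mulr0 !mul0r.
- rewrite IH ?mulr0//; case/orP: ml => [h|]; first by rewrite (ltnW (ltnW h)).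
  by rewrite /= negbK => ->; rewrite orbT.
Qed.

Lemma sphere_moment_vanish F l m z : eigen (lam l) F ->
  (m < l)%N || (odd m != odd l) -> sphere_moment F m z = 0.
Proof.
move=> eF; apply: (vanish_step (A := fun m _ => sphere_moment F m z) (c := dot z z)) 0%N.
by move=> k _; exact: sphere_moment_recurrence.
Qed.

Lemma proj_moment_vanish F l m p z : eigen (lam l) F -> (m < l)%N || (odd m != odd l) ->
  proj_moment F m p z = 0.
Proof.
move=> eF; apply: (vanish_step (A := fun m p => proj_moment F m p z) (c := dot z z)).
by move=> k p'; exact: proj_moment_recurrence.
Qed.

(* Both families of moments obey the same recurrence, so proportionality
   propagates from m = l to all m of the same parity. *)
Lemma proj_moment_ratio F l k (r : R) z : eigen (lam l) F ->
  proj_moment F l k z = r * sphere_moment F l z ->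
  forall m p, (m + p.*2 = l + k.*2)%N ->
  proj_moment F m p z = r * sphere_moment F m z.
Proof.
move=> eF rl; elim/ltn_ind => m IH p mp.
have par : odd m = odd l.
  by have := congr1 odd mp; rewrite !oddD !odd_double !addbF.
have [ml|lm|ml] := ltngtP m l.
- by rewrite (proj_moment_vanish _ _ eF) ?(sphere_moment_vanish _ eF) ?ml// mulr0.
(* Above l the value m = 1 would force l = 0, against parity, so m has the form m' + 2. *)
- case: m IH mp par lm => [//|[|m]] IH mp par lm.
    by move: lm par; case: l {eF rl IH mp} => // -[].
  have c0 : m.+2%:R * (m.+2%:R + n%:R - 2) - lam l != 0.
    rewrite -[m.+2%:R * _]/(lam m.+2) subr_eq0; apply/negP => /eqP/lam_inj e.
    by rewrite e ltnn in lm.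
  apply: (mulfI c0); rewrite (proj_moment_recurrence _ _ _ eF)/= mulrCA (sphere_moment_recurrence _ _ eF)/=.
  have e : (m + p.+1.*2 = l + k.*2)%N by rewrite -mp doubleS !addnS !addSn.
  by rewrite (IH m (ltnW (ltnSn m.+1)) p.+1 e); exact: mulrCA.
- have -> : p = k by apply: double_inj; apply/eqP; rewrite -(eqn_add2l m) mp ml.
  by rewrite ml.
Qed.

Definition sphere_mean (m : nat) : V -> R := sphere_moment (fun=> 1) m.

Lemma sphere_meanE m z : sphere_mean m z = \int[sigma]_(x in S) dot z x ^+ m.
Proof. by apply: eqD_Rintegral => x _; rewrite mul1r. Qed.

Lemma eigen_lam0 (c : R) : eigen (lam 0) (fun _ : V => c).
Proof. by rewrite /lam mul0r; exact: eigen_cst. Qed.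

Lemma sphere_mean_recurrence m z :
  (m.+2%:R + n%:R - 2) * sphere_mean m.+2 z = (m%:R + 1) * dot z z * sphere_mean m z.
Proof.
have := sphere_moment_recurrence m.+2 z (eigen_cst n 1).
rewrite subr0 -[sphere_moment _ _ _]/(sphere_mean m.+2 z) /=.
rewrite -[sphere_moment _ _ _]/(sphere_mean m z) -!mulrA => /(mulfI _) ->; first by rewrite -natr1 addrK natr1 -natr1.
by rewrite pnatr_eq0.
Qed.

(** The recurrence for F = 1 sees z only through [dot z z]; it ends at the area of the sphere for
    even m, and odd means vanish. *)
Lemma sphere_mean_norm m z z' : dot z z = dot z' z' -> sphere_mean m z = sphere_mean m z'.
Proof.
move=> e; have n3' : 3 <= n%:R :> R by rewrite (ler_nat _ 3).
elim/nat_ind2: m => [||m IH].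
- by rewrite !sphere_meanE; apply: eqD_Rintegral => x _; rewrite !expr0.
- by rewrite /sphere_mean !(sphere_moment_vanish _ (eigen_lam0 _)).
- have c0 : m.+2%:R + n%:R - 2 != 0 :> R.
    by rewrite gt_eqF//; have : 0 <= m.+2%:R :> R := ler0n _ _; lra.
  by apply: (mulfI c0); rewrite !sphere_mean_recurrence e IH.
Qed.

Lemma poly_eq0 (p : {poly R}) : (forall s, p.[s] = 0) -> p = 0.
Proof.
move=> p0; apply/eqP/negPn/negP => nz.
have := @max_poly_roots _ p [seq k%:R | k <- iota 0 (size p)] nz.
rewrite size_map size_iota ltnn => H; apply: notF; apply: H.
  by apply/allP => _ /mapP[k _ ->]; apply/rootP.
by rewrite map_inj_uniq ?iota_uniq// => a b /eqP; rewrite eqr_nat => /eqP.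
Qed.

Definition mixed_moment (a b : nat) z y : R :=
  \int[sigma]_(v in S) (dot z v ^+ a * dot y v ^+ b).

Lemma bmf_mixed a b z y : bmf S (fun v => dot z v ^+ a * dot y v ^+ b).
Proof. by apply: bmfM; apply: bmfX; exact: bmf_dot. Qed.

(* The moments of z + s y depend only on its norm; compare coefficients of s. *)
Lemma mixed_moment_gram a b z y z' y' :
  dot z z = dot z' z' -> dot z y = dot z' y' -> dot y y = dot y' y' ->
  mixed_moment a b z y = mixed_moment a b z' y'.
Proof.
move=> ezz ezy eyy; pose N := (a + b)%N.
pose P z y := \poly_(k < N.+1) ('C(N, k)%:R * mixed_moment (N - k) k z y).
have PE u w s : (P u w).[s] = sphere_mean N (u + s *: w).
  rewrite sphere_meanE horner_poly.
  transitivity (\int[sigma]_(v in S) (\sum_(k < N.+1)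
      ('C(N, k)%:R * s ^+ k) * (dot u v ^+ (N - k) * dot w v ^+ k))); last first.
    apply: eqD_Rintegral => v _; rewrite dotDl dotZl exprDn; apply: eq_bigr => k _.
    by rewrite exprMn -mulr_natl; ring.
  rewrite bmf_Rintegral_sum; [|exact: measurable_sphere|exact: sphere_fin|]; last first.
    by move=> k _; apply: bmfZ; exact: bmf_mixed.
  apply: eq_bigr => k _; rewrite bmf_RintegralZ; [|exact: measurable_sphere|exact: sphere_fin|exact: bmf_mixed].
  by rewrite -/(mixed_moment _ _ _ _) mulrAC.
have /eqP : P z y - P z' y' = 0.
  apply: poly_eq0 => s; rewrite hornerD hornerN !PE; apply/eqP; rewrite subr_eq0; apply/eqP.
  apply: sphere_mean_norm; rewrite !(dotDl, dotDr, dotZl, dotZr).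
  by rewrite (dotC y z) (dotC y' z') ezz eyy ezy.
rewrite subr_eq0 => /eqP/(congr1 (fun p : {poly R} => p`_b)).
rewrite /P !coef_poly ltnS leq_addl addnK; apply: mulfI.
by rewrite pnatr_eq0 -lt0n bin_gt0 leq_addl.
Qed.

End moments.

(** * An eigenfunction is a multiple of its l-th moment *)

Section representation.
Context (R : realType) (n : nat).
Hypothesis n3 : (3 <= n)%N.
Local Notation V := 'rV[R]_n.
Local Notation S := (@sphere R n).
Local Notation sigma := (@surface_measure R n).
Local Notation lam := (@lam R n).
Implicit Types (y z w : V) (F : V -> R).
Local Notation mS := (@measurable_sphere R n).
Local Notation fS := (@sphere_fin R n).

Let n3R : 3 <= n%:R :> R. Proof. by rewrite (ler_nat _ 3). Qed.

Lemma sphere_mean0_gt0 z : 0 < sphere_mean 0 z.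
Proof.
rewrite sphere_meanE; under eq_Rintegral do rewrite expr0.
rewrite Rintegral_cst; last exact: mS.
rewrite mul1r fine_gt0// surface_sphere_gt0 ?fS//.
exact: leq_trans n3.
Qed.

Lemma sphere_mean_gt0 j w : S w -> 0 < sphere_mean j.*2 w.
Proof.
have n3' := n3R; move=> /sphere_dot w1; elim: j => [|j IHj]; first exact: sphere_mean0_gt0.
have := sphere_mean_recurrence j.*2 w.
rewrite -doubleS w1 mulr1 => E.
have c0 : 0 < j.+1.*2%:R + n%:R - 2 :> R by have : 0 <= j.+1.*2%:R :> R := ler0n _ _; lra.
by rewrite -(pmulr_rgt0 _ c0) E mulr_gt0// ltr_wpDl.
Qed.

Lemma sphere_mean_odd m z : odd m -> sphere_mean m z = 0.
Proof. by move=> om; apply: (sphere_moment_vanish n3 _ (eigen_lam0 n 1)); rewrite om orbT. Qed.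

(** For |w| = 1 the coefficients of the recurrence are numbers, so the ratio c is the same for all
    w. *)
Lemma moment_ratio F l : eigen (lam l) F ->
  forall m, exists c, forall w, S w -> sphere_moment F m w = c * sphere_moment F l w.
Proof.
move=> eF; elim/ltn_ind => m IH.
have [mo|/eqP mo] := boolP (odd m != odd l).
  by exists 0 => w Sw; rewrite (sphere_moment_vanish n3 _ eF) ?mo ?orbT// mul0r.
have [ml|lm|ml] := ltngtP m l.
- by exists 0 => w Sw; rewrite (sphere_moment_vanish n3 _ eF) ?ml// mul0r.
- case: m IH mo lm => [//|[|m]] IH mo lm.
    by move: lm mo; case: l {eF IH} => // -[].
  have [c cE] := IH m (leqnSn _).
  exists (m.+2%:R * (m.+2%:R - 1) * c / (lam m.+2 - lam l)) => w Sw.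
  have c0 : lam m.+2 - lam l != 0.
    by rewrite subr_eq0; apply/negP => /eqP/(lam_inj n3) e; rewrite e ltnn in lm.
  apply: (mulfI c0); rewrite (sphere_moment_recurrence _ _ eF)/= cE//.
  move/sphere_dot: Sw => ->; move: (lam m.+2 - lam l) c0 => L c0.
  by field.
- by exists 1 => w _; rewrite ml mul1r.
Qed.

(** With u = w . x, adding the moments 2j and 2j + 1 gives the nonnegative kernel (1 + u) u^(2j). It
    vanishes at the antipode of w, where u^(2j) alone would also concentrate. The error splits into
    a part near w, small by continuity, and a part bounded by the mean of (1 - u^2) u^(2j). *)
Lemma approx_bound F w (e : R) : bmf S F -> S w -> {for w, continuous F} -> 0 < e ->
  exists2 C, 0 <= C & forall j,
  `|sphere_moment F j.*2 w + sphere_moment F j.*2.+1 w - F w * sphere_mean j.*2 w| <=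
  (e + C / (j.*2%:R + n%:R)) * sphere_mean j.*2 w.
Proof.
have n3' := n3R; move=> bF Sw /cvgrPdist_lt cF e0; have /nbhs_ballP[r /= r0 rF] := cF _ e0.
have [_ [M FM]] := bF; have /sphere_dot w1 := Sw.
have M0 : 0 <= M by rewrite (le_trans _ (FM w Sw)).
(* As |x - w|^2 = 2 (1 - u), the condition 1 - u < b keeps x within r of w. Otherwise (1 - u)/b >=
   1, and 2 M, which bounds |F x - F w|, is at most C (1 - u). *)
pose b := r ^+ 2 / 4; have b0 : 0 < b by rewrite divr_gt0// exprn_gt0.
pose C := 2 * M / b; have C0 : 0 <= C by rewrite divr_ge0 ?mulr_ge0// ltW.
have pw x : S x -> `|F x - F w| * (1 + dot w x) <= e * (1 + dot w x) + C * (1 - dot w x ^+ 2).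
  move=> Sx; have := dot_sphere_le1 Sw Sx; rewrite ler_norml => /andP[u1 u2].
  have [ub|bu] := ltP (1 - dot w x) b.
    apply: (@le_trans _ _ (e * (1 + dot w x))); last first.
      by rewrite lerDl mulr_ge0//; nra.
    apply: ler_wpM2r; first by lra.
    rewrite distrC ltW//; apply: rF; rewrite -ball_normE/=.
    apply: mx_norm_lt => // i; apply: (le_lt_trans (coor_le_enorm _ _)).
    rewrite -(@ltr_pXn2r _ 2) ?nnegrE ?enorm_ge0 ?(ltW r0)// sqr_enorm.
    rewrite !(dotBl, dotBr) (dotC x w) w1 (sphere_dot x).1//.
    have r2 : 0 < r ^+ 2 by rewrite exprn_gt0.
    by move: ub; rewrite /b; lra.
  apply: (@le_trans _ _ (C * (1 - dot w x ^+ 2))); last first.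
    by rewrite lerDr mulr_ge0//; [exact: ltW|lra].
  have -> : C * (1 - dot w x ^+ 2) = (2 * M * ((1 - dot w x) / b)) * (1 + dot w x).
    by rewrite /C; field; rewrite gt_eqF.
  apply: ler_wpM2r; first by lra.
  apply: (@le_trans _ _ (2 * M)).
    by rewrite (le_trans (ler_normB _ _))// mulr2n mulrDl mul1r lerD ?FM.
  by rewrite ler_peMr ?mulr_ge0// ler_pdivlMr// mul1r.
(* The means of u^(2j+2) and u^(2j) have ratio (2j + 1)/(2j + n), so (1 - u^2) u^(2j) contributes
   the fraction (n - 1)/(2j + n). *)
exists (C * (n%:R - 1)); first by rewrite mulr_ge0//; lra.
move=> j.
have bu k : bmf S (fun x => dot w x ^+ k) by apply: bmfX; exact: bmf_dot.
have E1 : sphere_moment F j.*2 w + sphere_moment F j.*2.+1 w - F w * sphere_mean j.*2 w =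
    \int[sigma]_(x in S) ((F x - F w) * (1 + dot w x) * dot w x ^+ j.*2).
  have -> : F w * sphere_mean j.*2 w = F w * (sphere_mean j.*2 w + sphere_mean j.*2.+1 w).
    by rewrite (@sphere_mean_odd j.*2.+1) ?addr0//= odd_double.
  rewrite !sphere_meanE -(bmf_RintegralD mS fS (bu _) (bu _)).
  rewrite -(bmf_RintegralZ mS fS _ (bmfD (bu _) (bu _))).
  rewrite -(bmf_RintegralD mS fS (bmf_sphere_moment _ _ bF) (bmf_sphere_moment _ _ bF)).
  rewrite -(bmf_RintegralB mS fS (bmfD (bmf_sphere_moment _ _ bF) (bmf_sphere_moment _ _ bF))
    (bmfZ _ (bmfD (bu _) (bu _)))).
  by apply: eqD_Rintegral => x _; rewrite exprS; ring.
have bB : bmf S (fun x => (F x - F w) * (1 + dot w x) * dot w x ^+ j.*2).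
  apply: bmfM => //; apply: bmfM; first by apply: bmfB => //; exact: bmf_cst.
  by apply: bmfD; [exact: bmf_cst|exact: bmf_dot].
have bN : bmf S (fun x => `|(F x - F w) * (1 + dot w x) * dot w x ^+ j.*2|).
  have [mB [N BN]] := bB; split; first exact: measurableT_comp.
  by exists N => x Sx; rewrite normr_id BN.
rewrite E1 (le_trans (bmf_le_norm_Rintegral mS fS bB))//.
have E2 : (e + C * (n%:R - 1) / (j.*2%:R + n%:R)) * sphere_mean j.*2 w =
    \int[sigma]_(x in S) (e * (dot w x ^+ j.*2 + dot w x ^+ j.*2.+1) + C * (dot w x ^+ j.*2 - dot w x ^+ j.*2.+2)).
  rewrite (bmf_RintegralD mS fS (bmfZ _ (bmfD (bu _) (bu _))) (bmfZ _ (bmfB (bu _) (bu _)))).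
  rewrite (bmf_RintegralZ mS fS _ (bmfD (bu _) (bu _))) (bmf_RintegralZ mS fS _ (bmfB (bu _) (bu _))).
  rewrite (bmf_RintegralD mS fS (bu _) (bu _)) (bmf_RintegralB mS fS (bu _) (bu _)).
  rewrite -!sphere_meanE (@sphere_mean_odd j.*2.+1) ?addr0/= ?odd_double//.
  have c0 : j.*2%:R + n%:R != 0 :> R.
    by rewrite gt_eqF//; have : 0 <= j.*2%:R :> R := ler0n _ _; lra.
  have -> : sphere_mean j.*2.+2 w = (j.*2%:R + 1) / (j.*2%:R + n%:R) * sphere_mean j.*2 w.
    apply: (mulfI c0); have := sphere_mean_recurrence j.*2 w.
    rewrite w1 mulr1 -addn2 natrD (_ : j.*2%:R + 2 + n%:R - 2 = j.*2%:R + n%:R); last by ring.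
    by move=> ->; field.
  by field.
rewrite E2; apply: (bmf_le_Rintegral mS fS) => //.
  by apply: bmfD; apply: bmfZ; [exact: bmfD|exact: bmfB].
move=> x Sx; have := pw x Sx; have := dot_sphere_le1 Sw Sx; rewrite ler_norml => /andP[u1 u2] h.
rewrite !normrM [`|1 + _|]ger0_norm; last by lra.
have p0 : 0 <= dot w x ^+ j.*2 by rewrite -muln2 mulnC exprM exprn_ge0// sqr_ge0.
rewrite [`|_ ^+ j.*2|]ger0_norm//.
have -> : e * (dot w x ^+ j.*2 + dot w x ^+ j.*2.+1) + C * (dot w x ^+ j.*2 - dot w x ^+ j.*2.+2) =
  (e * (1 + dot w x) + C * (1 - dot w x ^+ 2)) * dot w x ^+ j.*2 by rewrite !exprS; ring.
exact: ler_wpM2r.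
Qed.

(** The normalized kernels give numbers a_j, independent of w, with a_j T_l(w) tending to F w for
    every w. *)
Lemma eigen_repr F l : eigen (lam l) F ->
  exists kappa, forall w, S w -> F w = kappa * sphere_moment F l w.
Proof.
have n3' := n3R; move=> eF; have bF := eigen_bmf eF.
have [c cE] := choice (moment_ratio eF).
pose e0 : V := delta_mx ord0 (Ordinal n3).
have Se0 : S e0 by apply/sphere_dot; rewrite dot_delta mxE !eqxx.
pose m (j : nat) := sphere_mean j.*2 e0.
have m0 j : 0 < m j by exact: sphere_mean_gt0.
have mE j w : S w -> sphere_mean j.*2 w = m j.
  by move=> /sphere_dot w1; apply: sphere_mean_norm => //; rewrite w1 (sphere_dot e0).1.
pose a j := (c j.*2 + c j.*2.+1) / m j.
have lim_a w : S w -> a j * sphere_moment F l w @[j --> \oo] --> F w.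
  move=> Sw; apply/cvgrPdist_le => e e1.
  have cF : {for w, continuous F}.
    by apply: c1_continuous; [exact: eF.1.1|exact: sphere_neq0].
  have [C C0 CE] := approx_bound bF Sw cF (divr_gt0 e1 (ltr0Sn R 1)).
  near=> j.
  have dj : 0 < j.*2%:R + n%:R :> R.
    by have : 0 <= j.*2%:R :> R := ler0n _ _; lra.
  have Cj : C / (j.*2%:R + n%:R) <= e / 2.
    rewrite ler_pdivrMr// mulrC -ler_pdivrMr ?divr_gt0//.
    apply: (@le_trans _ _ j%:R); first by near: j; exact: nbhs_infty_ger.
    by rewrite -addnn natrD; have : 0 <= j%:R :> R := ler0n _ _; lra.
  have := CE j; rewrite mE// (cE j.*2 w Sw) (cE j.*2.+1 w Sw).
  rewrite (_ : _ - _ = - ((F w - a j * sphere_moment F l w) * m j)); last first.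
    rewrite /a; move: (m0 j); move: (m j) (sphere_moment F l w) (F w) => mj T Fw mj0.
    by field; rewrite gt_eqF.
  rewrite normrN normrM (gtr0_norm (m0 j)) ler_pM2r// => h.
  by apply: (le_trans h); lra.
(* If T_l vanishes on the sphere, so does F. Otherwise one point where T_l is nonzero shows that a_j
   itself converges. *)
have [Tz|] := pselect (forall w, S w -> sphere_moment F l w = 0).
  exists 0 => w Sw; rewrite mul0r; apply: (cvg_unique _ (lim_a w Sw)).
    exact: Rhausdorff.
  rewrite (_ : (fun j => _) = (fun=> 0)); first exact: cvg_cst.
  by apply/funext => j; rewrite Tz// mulr0.
move=> /existsNP[w0 /not_implyP[Sw0 /eqP Tw0]].
exists (F w0 / sphere_moment F l w0) => w Sw.
apply: (cvg_unique _ (lim_a w Sw)); first exact: Rhausdorff.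
apply: cvgMl.
have -> : a = fun j => a j * sphere_moment F l w0 / sphere_moment F l w0.
  by apply/funext => j; rewrite mulfK.
by apply: cvgMl; exact: lim_a.
Unshelve. all: by end_near. Qed.

End representation.

(** * Fubini for bounded functions on products of finite measures *)

Section bounded_fubini.
Context (R : realType) d1 d2 (T1 : measurableType d1) (T2 : measurableType d2)
  (m1 : {finite_measure set T1 -> \bar R}) (m2 : {finite_measure set T2 -> \bar R})
  (D1 : set T1) (D2 : set T2).
Hypotheses (mD1 : measurable D1) (mD2 : measurable D2).

Let fin1 : (m1 D1 < +oo)%E.
Proof. by rewrite ltey_eq fin_num_measure. Qed.
Let fin2 : (m2 D2 < +oo)%E.
Proof. by rewrite ltey_eq fin_num_measure. Qed.

Let fin12 : ((m1 \x m2)%E (D1 `*` D2) < +oo)%E.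
Proof.
rewrite product_measure1E//.
by apply: lte_mul_pinfty => //; rewrite ?ge0_fin_numE ?measure_ge0.
Qed.

Lemma bmf_xsection (f : T1 * T2 -> R) x : D1 x -> bmf (D1 `*` D2) f -> bmf D2 (fun y => f (x, y)).
Proof.
move=> Dx [mf [M fM]]; split; last by exists M => y Dy; exact: fM.
apply: (@measurable_comp _ _ _ _ _ _ (D1 `*` D2) f D2 (pair x)) => //.
- exact: measurableX.
- by move=> _ [y Dy <-].
- by apply: measurable_funTS; exact: pair1_measurable.
Qed.

Lemma bmf_ysection (f : T1 * T2 -> R) y : D2 y -> bmf (D1 `*` D2) f -> bmf D1 (fun x => f (x, y)).
Proof.
move=> Dy [mf [M fM]]; split; last by exists M => x Dx; exact: fM.
apply: (@measurable_comp _ _ _ _ _ _ (D1 `*` D2) f D1 (pair^~ y)) => //.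
- exact: measurableX.
- by move=> _ [x Dx <-].
- by apply: measurable_funTS; exact: pair2_measurable.
Qed.

Variable f : T1 * T2 -> R.
Hypothesis bf : bmf (D1 `*` D2) f.

Let mD12 : measurable (D1 `*` D2). Proof. exact: measurableX. Qed.

Let g := f \_ (D1 `*` D2).

Let ig : (m1 \x m2)%E.-integrable setT (EFin \o g).
Proof.
rewrite /g -restrict_EFin.
by apply/integrable_restrict => //; rewrite setTI; exact: bmf_integrable.
Qed.

Let inner1 x : (\int[m2]_y (EFin \o g) (x, y))%E =
  ((fun x => (\int[m2]_(y in D2) f (x, y))) \_ D1 x)%:E.
Proof.
rewrite patchE; case: ifPn => [/set_mem Dx|nDx].
  rewrite fineK; last first.
    apply: integrable_fin_num => //.
    by apply: bmf_integrable => //; exact: bmf_xsection.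
  rewrite [RHS]integral_mkcond; apply: eq_integral => y _.
  rewrite /g /= !patchE; case: ifPn => [/set_mem[_ Dy]|nD]; first by rewrite mem_set.
  by rewrite memNset// => Dy; move/negP: nD; apply; rewrite inE; split.
rewrite (eq_integral (fun=> 0%E)) ?integral0// => y _.
rewrite /g /= patchE memNset// => -[Dx _].
by move/negP: nDx; apply; rewrite inE.
Qed.

Let inner2 y : (\int[m1]_x (EFin \o g) (x, y))%E =
  ((fun y => (\int[m1]_(x in D1) f (x, y))) \_ D2 y)%:E.
Proof.
rewrite patchE; case: ifPn => [/set_mem Dy|nDy].
  rewrite fineK; last first.
    apply: integrable_fin_num => //.
    by apply: bmf_integrable => //; exact: bmf_ysection.
  rewrite [RHS]integral_mkcond; apply: eq_integral => x _.
  rewrite /g /= !patchE; case: ifPn => [/set_mem[Dx _]|nD]; first by rewrite mem_set.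
  by rewrite memNset// => Dx; move/negP: nD; apply; rewrite inE; split.
rewrite (eq_integral (fun=> 0%E)) ?integral0// => x _.
rewrite /g /= patchE memNset// => -[_ Dy].
by move/negP: nDy; apply; rewrite inE.
Qed.

Lemma Rintegral_prod12 : \int[(m1 \x m2)%E]_(p in D1 `*` D2) f p =
  \int[m1]_(x in D1) \int[m2]_(y in D2) f (x, y).
Proof.
rewrite Rintegral_mkcond [RHS]Rintegral_mkcond /Rintegral.
rewrite -[X in fine X = _](integral12_prod_meas1 ig); congr fine.
by apply: eq_integral => x _; exact: inner1.
Qed.

Lemma Rintegral_prod21 : \int[(m1 \x m2)%E]_(p in D1 `*` D2) f p =
  \int[m2]_(y in D2) \int[m1]_(x in D1) f (x, y).
Proof.
rewrite Rintegral_mkcond [RHS]Rintegral_mkcond /Rintegral.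
rewrite -[X in fine X = _](integral21_prod_meas1 ig); congr fine.
by apply: eq_integral => y _; exact: inner2.
Qed.

End bounded_fubini.

(** * Computation of the ratio r from G_(l,k) *)

Section diagonal.
Context (R : realType) (n : nat).
Hypothesis n3 : (3 <= n)%N.
Local Notation V := 'rV[R]_n.
Local Notation S := (@sphere R n).
Local Notation sigma := (@surface_measure R n).
Local Notation lam := (@lam R n).
Implicit Types (x y z v w : V) (F : V -> R).
Local Notation mS := (@measurable_sphere R n).
Local Notation fS := (@sphere_fin R n).
Let i1 : 'I_n := Ordinal (ltnW (ltnW n3)).
Let i2 : 'I_n := Ordinal (ltnW n3).
Local Notation e_ := (fun j : 'I_n => delta_mx ord0 j : V).

Definition kap (N r : nat) : R :=
  \int[sigma]_(v in S) ((1 - v ord0 i1 ^+ 2) ^+ N * (v ord0 i1 * v ord0 i2) ^+ r).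

(** The ratio r, that is lambda / sqrt pi: the real part of (a + i b)^l with a = 1 - v_1^2 and b =
    v_1 v_2 is expanded, and i^r supplies the sign for even r. *)
Definition lamR (k l : nat) : R :=
  \sum_(r < l.+1) (if odd r then 0 else (-1) ^+ r./2) * 'C(l, r)%:R * kap (k + (l - r)) r.

(** For unit y and u = z . y this is the integral over v inside G_(l,k): with q the component of y
    orthogonal to v, z . q = u - (y . v)(z . v) and |q|^2 = 1 - (y . v)^2. *)
Let K (u : R) l k y z : R :=
  \int[sigma]_(v in S) ((u - dot y v * dot z v) ^+ l * (1 - dot y v ^+ 2) ^+ k).

Lemma K_mixed u l k y z : K u l k y z = \sum_(a < l.+1) \sum_(b < k.+1)
  ('C(l, a)%:R * u ^+ (l - a) * (-1) ^+ a * ('C(k, b)%:R * (-1) ^+ b)) * mixed_moment a (a + b.*2) z y.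
Proof.
pose c a b := 'C(l, a)%:R * u ^+ (l - a) * (-1) ^+ a * ('C(k, b)%:R * (-1) ^+ b) : R.
pose g a b v := dot z v ^+ a * dot y v ^+ (a + b.*2).
have bg a b : bmf S (fun v => c a b * g a b v) by apply: bmfZ; exact: bmf_mixed.
transitivity (\int[sigma]_(v in S) \sum_(a < l.+1) \sum_(b < k.+1) c a b * g a b v).
  apply: eqD_Rintegral => v _.
  rewrite exprBn [X in _ * X]exprBn mulr_suml; apply: eq_bigr => a _.
  rewrite mulr_sumr; apply: eq_bigr => b _.
  rewrite /c /g expr1n exprMn -exprM exprD -mul2n -[_ *+ 'C(l, a)]mulr_natl -[_ *+ 'C(k, b)]mulr_natl.
  by ring.
rewrite (bmf_Rintegral_sum mS fS); last by move=> a _; exact: bmf_sum.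
apply: eq_bigr => a _; rewrite (bmf_Rintegral_sum mS fS)//.
by apply: eq_bigr => b _; rewrite (bmf_RintegralZ mS fS)//; exact: bmf_mixed.
Qed.

Lemma K_gram u l k y z y' z' :
  dot z z = dot z' z' -> dot z y = dot z' y' -> dot y y = dot y' y' ->
  K u l k y z = K u l k y' z'.
Proof.
move=> zz zy yy; rewrite !K_mixed; apply: eq_bigr => a _; apply: eq_bigr => b _.
by rewrite (mixed_moment_gram n3 _ _ zz zy yy).
Qed.

Lemma bmf_kap N r : bmf S (fun v => (1 - v ord0 i1 ^+ 2) ^+ N * (v ord0 i1 * v ord0 i2) ^+ r).
Proof.
have b1 := @bmf_coor R n i1; have b2 := @bmf_coor R n i2.
apply: bmfM; apply: bmfX; last exact: bmfM.
by apply: bmfB; [exact: bmf_cst|exact: bmfX].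
Qed.

Let i12 : i1 != i2. Proof. by rewrite eqE. Qed.

Lemma dot_e i : dot (e_ i) (e_ i) = 1 :> R.
Proof. by rewrite dot_delta mxE !eqxx. Qed.

Lemma dot_e12 : dot (e_ i1) (e_ i2) = 0 :> R.
Proof. by rewrite dot_delta mxE eqxx/=. Qed.

(* Reflecting e_2 does not change the Gram matrix of (e_1, e_2). *)
Lemma kap_odd N r : odd r -> kap N r = 0.
Proof.
move=> ro.
pose k (s : R) := \int[sigma]_(v in S) ((1 - dot (e_ i1) v ^+ 2) ^+ N * (dot (e_ i1) v * dot (s *: e_ i2) v) ^+ r).
have kE s : k s = \sum_(b < N.+1) ('C(N, b)%:R * (-1) ^+ b) * mixed_moment (r + b.*2) r (e_ i1) (s *: e_ i2).
  pose g b v := dot (e_ i1) v ^+ (r + b.*2) * dot (s *: e_ i2) v ^+ r.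
  transitivity (\int[sigma]_(v in S) \sum_(b < N.+1) ('C(N, b)%:R * (-1) ^+ b) * g b v).
    apply: eqD_Rintegral => v _; rewrite exprBn mulr_suml; apply: eq_bigr => b _.
    rewrite /g expr1n -exprM exprMn exprD -mul2n -[_ *+ 'C(N, b)]mulr_natl; ring.
  rewrite (bmf_Rintegral_sum mS fS) => [|b _]; last by apply: bmfZ; exact: bmf_mixed.
  by apply: eq_bigr => b _; rewrite (bmf_RintegralZ mS fS)//; exact: bmf_mixed.
have k1 : k 1 = k (-1).
  rewrite !kE; apply: eq_bigr => b _; congr (_ * _); apply: mixed_moment_gram => //.
    by rewrite !dotZr dot_e12 !mulr0.
  by rewrite !(dotZl, dotZr); ring.
have kap1 : kap N r = k 1.
  by apply: eqD_Rintegral => v _; rewrite scale1r ![dot (delta_mx _ _) _]dotC !dot_delta.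
have kapN : - kap N r = k (-1).
  transitivity (\int[sigma]_(v in S)
      (-1 * ((1 - v ord0 i1 ^+ 2) ^+ N * (v ord0 i1 * v ord0 i2) ^+ r))).
    by rewrite (bmf_RintegralZ mS fS) ?mulN1r//; exact: bmf_kap.
  apply: eqD_Rintegral => v _; rewrite dotZl ![dot (delta_mx _ _) _]dotC !dot_delta.
  rewrite (_ : v ord0 i1 * (-1 * v ord0 i2) = -1 * (v ord0 i1 * v ord0 i2)); last by ring.
  by rewrite [(-1 * _) ^+ r]exprMn -[(-1) ^+ r]signr_odd ro expr1; ring.
by move: kapN; rewrite -k1 -kap1; lra.
Qed.

(** K depends only on the Gram matrix of (y, z), so (y, z) may be replaced by (e_1, u e_1 + b e_2)
    with b^2 = |z|^2 - u^2, which is nonnegative by Cauchy-Schwarz. Only even powers of b survive,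
    so the result is polynomial in u. *)
Lemma K_kap u l k y z : S y -> u = dot z y ->
  K u l k y z = \sum_(r < l.+1) ('C(l, r)%:R * kap (k + (l - r)) r) *
    (u ^+ (l - r) * (if odd r then 0 else (dot z z - u ^+ 2) ^+ r./2)).
Proof.
move=> /sphere_dot y1 uE; pose b := Num.sqrt (dot z z - u ^+ 2).
have b2 : b ^+ 2 = dot z z - u ^+ 2.
  by rewrite sqr_sqrtr// subr_ge0 uE; have := cauchy_schwarz z y; rewrite y1 mulr1.
rewrite (@K_gram u l k y z (e_ i1) (u *: e_ i1 + b *: e_ i2)); first last.
- by rewrite dot_e.
- by rewrite dotDl !dotZl dot_e [dot (e_ i2) _]dotC dot_e12 uE; ring.
- rewrite !(dotDl, dotDr, dotZl, dotZr) !dot_e [dot (e_ i2) (e_ i1)]dotC dot_e12.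
  by transitivity (u ^+ 2 + b ^+ 2); [rewrite b2; ring|ring].
pose g r v : R := (1 - v ord0 i1 ^+ 2) ^+ (k + (l - r)) * (v ord0 i1 * v ord0 i2) ^+ r.
transitivity (\int[sigma]_(v in S) \sum_(r < l.+1) ('C(l, r)%:R * (u ^+ (l - r) * (- b) ^+ r)) * g r v).
  apply: eqD_Rintegral => v _.
  rewrite dotDl !dotZl ![dot (delta_mx _ _) _]dotC !dot_delta.
  rewrite (_ : u - v ord0 i1 * (u * v ord0 i1 + b * v ord0 i2) =
     u * (1 - v ord0 i1 ^+ 2) + (- b) * (v ord0 i1 * v ord0 i2)); last by ring.
  rewrite exprDn mulr_suml; apply: eq_bigr => r _.
  rewrite /g !exprMn exprD -[_ *+ 'C(l, r)]mulr_natl; ring.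
rewrite (bmf_Rintegral_sum mS fS) => [|r _]; last by apply: bmfZ; exact: bmf_kap.
apply: eq_bigr => r _; rewrite (bmf_RintegralZ mS fS)//; last exact: bmf_kap.
rewrite -/(kap _ _); have [ro|re] := boolP (odd r).
  by rewrite kap_odd// !(mulr0, mul0r).
rewrite -b2 -exprM mul2n even_halfK// exprNn -[(-1) ^+ r]signr_odd (negbTE re) expr0 mul1r.
by rewrite mulrAC.
Qed.

(** Among the powers of z . y in the expansion only the top one can reach degree l, and moments of
    lower degree vanish. *)
Lemma moment_even_factor F l z i a : eigen (lam l) F -> (a + i.*2 <= l)%N ->
  \int[sigma]_(y in S) (F y * (dot z y ^+ a * (dot z z - dot z y ^+ 2) ^+ i)) =
  (if (a + i.*2 == l)%N then (-1) ^+ i * sphere_moment F l z else 0).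
Proof.
move=> eF; have bF := eigen_bmf eF.
have bA i' a' : bmf S (fun y => F y * (dot z y ^+ a' * (dot z z - dot z y ^+ 2) ^+ i')).
  apply: bmfM => //; apply: bmfM; apply: bmfX; first exact: bmf_dot.
  by apply: bmfB; [exact: bmf_cst|apply: bmfX; exact: bmf_dot].
elim: i a => [|i IH] a al.
  under eq_Rintegral do rewrite expr0 mulr1.
  rewrite expr0 mul1r; move: al; rewrite addn0 leq_eqVlt; case: eqP => [->//|_ /= al].
  by apply: (sphere_moment_vanish n3 _ eF); rewrite al.
transitivity (dot z z * (\int[sigma]_(y in S) (F y * (dot z y ^+ a * (dot z z - dot z y ^+ 2) ^+ i)))
   - \int[sigma]_(y in S) (F y * (dot z y ^+ a.+2 * (dot z z - dot z y ^+ 2) ^+ i))).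
  rewrite -(bmf_RintegralZ mS fS _ (bA _ _)) -(bmf_RintegralB mS fS (bmfZ _ (bA _ _)) (bA _ _)).
  by apply: eqD_Rintegral => y _; rewrite !exprS; ring.
move: al; rewrite doubleS !addnS => al.
rewrite (IH a (ltnW (ltnW al))) (IH a.+2) ?addSn//.
by rewrite [(_ + _ == l)%N]ltn_eqF ?(ltnW al)// mulr0 sub0r; case: eqP => _; rewrite ?oppr0// exprS mulN1r mulNr.
Qed.

(** Integrate over v first by [K_kap]. Every term then has degree l in z . y, and the sign
    (-1)^(r/2) of its leading coefficient is the i^r in the integrand of lambda. *)
Lemma proj_moment_diag F l k z : eigen (lam l) F ->
  proj_moment F l k z = lamR k l * sphere_moment F l z.
Proof.
move=> eF; have bF := eigen_bmf eF.
rewrite /proj_moment (Rintegral_prod12 sigma sigma mS mS (bmf_proj_moment l k z bF))/=.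
have bk r : bmf S (fun y => F y * (dot z y ^+ (l - r) * (dot z z - dot z y ^+ 2) ^+ r./2)).
  apply: bmfM => //; apply: bmfM; apply: bmfX; first exact: bmf_dot.
  by apply: bmfB; [exact: bmf_cst|apply: bmfX; exact: bmf_dot].
transitivity (\int[sigma]_(y in S) (\sum_(r < l.+1)
    ((if odd r then 0 else 1) * 'C(l, r)%:R * kap (k + (l - r)) r) * (F y * (dot z y ^+ (l - r) * (dot z z - dot z y ^+ 2) ^+ r./2)))).
  apply: eqD_Rintegral => y Sy; have y1 := (sphere_dot y).1 Sy.
  transitivity (F y * K (dot z y) l k y z).
    rewrite /K -(bmf_RintegralZ mS fS); last first.
      apply: bmfM; apply: bmfX; apply: bmfB; try exact: bmf_cst.
        by apply: bmfM; exact: bmf_dot.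
      by apply: bmfX; exact: bmf_dot.
    apply: eqD_Rintegral => v Sv; have v1 := (sphere_dot v).1 Sv.
    rewrite /proj !(dotBl, dotBr, dotZl, dotZr) y1 v1 (dotC v y) mulrA.
    by congr (_ * _ * _ ^+ k); ring.
  rewrite K_kap// mulr_sumr; apply: eq_bigr => r _.
  by case: ifP => _; ring.
rewrite (bmf_Rintegral_sum mS fS) => [|r _]; last exact: bmfZ.
rewrite mulr_suml; apply: eq_bigr => r _.
rewrite (bmf_RintegralZ mS fS)//.
have rl : (r <= l)%N by rewrite -ltnS.
case: ifPn => [_|re]; first by rewrite !mul0r.
have lr : (l - r + r./2.*2 = l)%N by rewrite even_halfK// subnK.
by rewrite (moment_even_factor _ eF) lr// eqxx; ring.
Qed.

End diagonal.

(** * Real and imaginary parts *)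

Section complex_real.
Local Open Scope complex_scope.
Context (R : realType).
Local Notation Re := (@complex.Re R).
Local Notation Im := (@complex.Im R).
Implicit Types (a b : R) (z w : R[i]).

Lemma Re_add z w : Re (z + w) = Re z + Re w. Proof. by case: z w => [? ?] [? ?]. Qed.
Lemma Im_add z w : Im (z + w) = Im z + Im w. Proof. by case: z w => [? ?] [? ?]. Qed.
Lemma Re_scale a z : Re (a%:C * z) = a * Re z.
Proof. by case: z => [x y] /=; rewrite mul0r subr0. Qed.
Lemma Im_scale a z : Im (a%:C * z) = a * Im z.
Proof. by case: z => [x y] /=; rewrite mul0r addr0. Qed.

Lemma Re_sum I (s : seq I) (P : pred I) (f : I -> R[i]) :
  Re (\sum_(i <- s | P i) f i) = \sum_(i <- s | P i) Re (f i).
Proof. by elim/big_rec2: _ => // i x y _ <-; rewrite Re_add. Qed.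

Lemma Im_sum I (s : seq I) (P : pred I) (f : I -> R[i]) :
  Im (\sum_(i <- s | P i) f i) = \sum_(i <- s | P i) Im (f i).
Proof. by elim/big_rec2: _ => // i x y _ <-; rewrite Im_add. Qed.

Lemma realcM a b : (a * b)%:C = a%:C * b%:C.
Proof. by rewrite /real_complex_def/=; apply/eqP; rewrite eq_complex/= !mul0r !mulr0 subr0 addr0 !eqxx. Qed.

Lemma realcX a m : (a ^+ m)%:C = a%:C ^+ m.
Proof. by elim: m => [|m IH]; rewrite ?expr0// !exprS realcM IH. Qed.

Let I : R[i] := 0 +i* 1.

Lemma powi r : I ^+ r = if odd r then 0 +i* (-1) ^+ r./2 else ((-1) ^+ r./2)%:C.
Proof.
elim: r => [|r IH]; first by rewrite expr0.
rewrite exprSr IH /= uphalf_half; case: (odd r); rewrite /= ?add0n ?add1n ?exprS;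
  move: ((-1) ^+ r./2) => s; apply/eqP; rewrite eq_complex/=;
  by apply/andP; split; apply/eqP; ring.
Qed.

Lemma complex_pow a b l : (a +i* b) ^+ l =
  \sum_(r < l.+1) ('C(l, r)%:R * (a ^+ (l - r) * b ^+ r))%:C * I ^+ r.
Proof.
have -> : a +i* b = a%:C + b%:C * I.
  by apply/eqP; rewrite eq_complex/= !(mul0r, mulr0, mulr1, subr0, add0r, addr0) !eqxx.
rewrite exprDn; apply: eq_bigr => r _.
rewrite exprMn !realcM !realcX mulrA -mulr_natl mulrA; congr (_ * _ * _).
by rewrite [in RHS]/real_complex_def; rewrite -(rmorph_nat (real_complex R)).
Qed.

(** Used for positivity with z and y conjugate to each other, u = -1/4 and w = -1/2. *)
Lemma trinomial_expand (K : comNzRingType) (A u w z y : K) k l :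
  (A + u * (z + y)) ^+ k * (A + w * y) ^+ l =
  \sum_(r < k.+1) \sum_(p < r.+1) \sum_(q < l.+1)
    ('C(k, r)%:R * 'C(r, p)%:R * 'C(l, q)%:R * u ^+ r * w ^+ q * A ^+ ((k - r) + (l - q))) *
    (z ^+ (r - p) * y ^+ (p + q)).
Proof.
rewrite [X in X * _]exprDn mulr_suml; apply: eq_bigr => r _.
rewrite exprMn [(z + y) ^+ r]exprDn -[_ *+ 'C(k, r)]mulr_natl !mulr_sumr mulr_suml.
apply: eq_bigr => p _; rewrite [(A + w * y) ^+ l]exprDn mulr_sumr.
apply: eq_bigr => q _.
rewrite [(w * y) ^+ q]exprMn -[_ *+ 'C(r, p)]mulr_natl -[_ *+ 'C(l, q)]mulr_natl !exprD.
by ring.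
Qed.

End complex_real.

(** * Positivity of lambda *)

Section lambda_positive.
Local Open Scope complex_scope.
Context (R : realType) (n : nat).
Hypothesis n3 : (3 <= n)%N.
Local Notation V := 'rV[R]_n.
Local Notation S := (@sphere R n).
Local Notation sigma := (@surface_measure R n).
Local Notation Re := (@complex.Re R).
Local Notation Im := (@complex.Im R).
Implicit Types (v : V).
Local Notation mS := (@measurable_sphere R n).
Local Notation fS := (@sphere_fin R n).
Let i1 : 'I_n := Ordinal (ltnW (ltnW n3)).
Let i2 : 'I_n := Ordinal (ltnW n3).
Local Notation lamR := (@lamR R n n3).
Local Notation kap := (@kap R n n3).
Let i12 : i1 != i2. Proof. by rewrite eqE. Qed.
Let a v : R := 1 - v ord0 i1 ^+ 2.
Let b v : R := v ord0 i1 * v ord0 i2.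

Let bmf_kap' k l r : bmf S (fun v => a v ^+ (k + (l - r)) * b v ^+ r).
Proof. exact: bmf_kap. Qed.

Lemma integral_Re_lambda k l :
  \int[sigma]_(v in S) Re ((a v ^+ k)%:C * (a v +i* b v) ^+ l) = lamR k l.
Proof.
transitivity (\int[sigma]_(v in S) \sum_(r < l.+1)
    ((if odd r then 0 else (-1) ^+ r./2) * 'C(l, r)%:R) * (a v ^+ (k + (l - r)) * b v ^+ r)).
  apply: eqD_Rintegral => v _; rewrite Re_scale complex_pow Re_sum mulr_sumr.
  apply: eq_bigr => r _; rewrite Re_scale powi exprD.
  by case: (odd r) => /=; ring.
rewrite (bmf_Rintegral_sum mS fS) => [|r _]; last exact: bmfZ.
by apply: eq_bigr => r _; rewrite (bmf_RintegralZ mS fS).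
Qed.

Lemma integral_Im_lambda k l :
  \int[sigma]_(v in S) Im ((a v ^+ k)%:C * (a v +i* b v) ^+ l) = 0.
Proof.
transitivity (\int[sigma]_(v in S) \sum_(r < l.+1)
    ((if odd r then (-1) ^+ r./2 else 0) * 'C(l, r)%:R) * (a v ^+ (k + (l - r)) * b v ^+ r)).
  apply: eqD_Rintegral => v _; rewrite Im_scale complex_pow Im_sum mulr_sumr.
  apply: eq_bigr => r _; rewrite Im_scale powi exprD.
  by case: (odd r) => /=; ring.
rewrite (bmf_Rintegral_sum mS fS) => [|r _]; last exact: bmfZ.
rewrite big1// => r _; rewrite (bmf_RintegralZ mS fS)//.
case: ifPn => ro; last by rewrite !mul0r.
by rewrite -/(kap _ _) kap_odd// mulr0.
Qed.

Lemma lambdaE k l : lambda R n3 k l = (Num.sqrt pi * lamR k l)%:C.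
Proof.
rewrite /lambda /Cintegral realcM; congr (_ * _).
rewrite -integral_Re_lambda; apply/eqP; rewrite eq_complex/= eqxx/=.
by apply/eqP; exact: integral_Im_lambda.
Qed.

Let w v : R[i] := v ord0 i1 +i* v ord0 i2.
Let zeta v := w v ^+ 2.
Let A v : R := 1 - (v ord0 i1 ^+ 2 + v ord0 i2 ^+ 2) / 2.

Let J x p q := \int[sigma]_(v in S) (A v ^+ x * Re (zeta v ^+ p * (conjc (zeta v)) ^+ q)).

Definition bmfC (f : V -> R[i]) := bmf S (fun v => Re (f v)) /\ bmf S (fun v => Im (f v)).

Lemma bmfC_mul f g : bmfC f -> bmfC g -> bmfC (fun v => f v * g v).
Proof.
move=> [rf jf] [rg jg]; split.
  apply: (@eq_bmf _ _ _ _ (fun v => Re (f v) * Re (g v) - Im (f v) * Im (g v))).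
    by move=> v _; case: (f v) (g v) => [? ?] [? ?].
  by apply: bmfB; exact: bmfM.
apply: (@eq_bmf _ _ _ _ (fun v => Re (f v) * Im (g v) + Im (f v) * Re (g v))).
  by move=> v _; case: (f v) (g v) => [? ?] [? ?].
by apply: bmfD; exact: bmfM.
Qed.

Lemma bmfC_exp f m : bmfC f -> bmfC (fun v => f v ^+ m).
Proof.
move=> bf; elim: m => [|m IH]; first by split; exact: bmf_cst.
by under eq_fun do rewrite exprS; exact: bmfC_mul.
Qed.

Lemma bmfC_conj f : bmfC f -> bmfC (fun v => conjc (f v)).
Proof.
move=> [rf jf]; split.
  by apply: (@eq_bmf _ _ _ _ (fun v => Re (f v))) => // v _; case: (f v).
by apply: (@eq_bmf _ _ _ _ (fun v => - Im (f v))) => [v _|]; [case: (f v)|exact: bmfN].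
Qed.

Let bw : bmfC w. Proof. by split; exact: bmf_coor. Qed.

Let bA x : bmf S (fun v => A v ^+ x).
Proof.
apply: bmfX; apply: bmfB; first exact: bmf_cst.
by apply: bmfM; [apply: bmfD; apply: bmfX; exact: bmf_coor|exact: bmf_cst].
Qed.

Let bJ x p q : bmf S (fun v => A v ^+ x * Re (zeta v ^+ p * (conjc (zeta v)) ^+ q)).
Proof.
apply: bmfM => //; have bz : bmfC zeta by exact: bmfC_exp.
by apply: (bmfC_mul (bmfC_exp _ bz) (bmfC_exp _ (bmfC_conj bz))).1.
Qed.

Lemma conjcM (z z' : R[i]) : conjc (z * z') = conjc z * conjc z'.
Proof. by case: z z' => [? ?] [? ?]; apply/eqP; rewrite eq_complex/=; apply/andP; split; apply/eqP; ring. Qed.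

Lemma conjcX' (z : R[i]) m : conjc z ^+ m = conjc (z ^+ m).
Proof. by rewrite rmorphXn. Qed.

Let J_sym x p q : J x p q = J x q p.
Proof.
apply: eqD_Rintegral => v _; congr (_ * _).
rewrite !conjcX' mulrC; case: (zeta v ^+ p) (zeta v ^+ q) => [? ?] [? ?] /=; ring.
Qed.

Let E (t : R) : R[i] := cos t +i* sin t.

Let E_exp t m : E t ^+ m = E (m%:R * t).
Proof.
elim: m => [|m IH]; first by rewrite expr0 mul0r /E cos0 sin0.
rewrite exprS IH /E -natr1 mulrDl mul1r addrC cosD sinD.
by apply/eqP; rewrite eq_complex/=; apply/andP; split; apply/eqP; ring.
Qed.

Let w_rot t v : w (rot i1 i2 t v) = E t * w v.
Proof.
rewrite /w /E /rot /givens !mxE !eqxx/= ?[i2 == i1]eq_sym ?(negbTE i12)/=.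
by apply/eqP; rewrite eq_complex/=; apply/andP; split; apply/eqP; ring.
Qed.

Let A_rot t v : A (rot i1 i2 t v) = A v.
Proof.
rewrite /A; congr (1 - _ / 2).
have sq (y : V) : y ord0 i1 ^+ 2 + y ord0 i2 ^+ 2 = Re (w y * conjc (w y)) by rewrite /=; ring.
rewrite !sq w_rot conjcM mulrACA.
rewrite (_ : E t * conjc (E t) = 1) ?mul1r//.
apply/eqP; rewrite eq_complex/=; apply/andP; split; apply/eqP; last by ring.
by rewrite mulrN opprK -!expr2 cos2Dsin2.
Qed.

(** Rotating the (v_1, v_2)-plane by t multiplies zeta^p times conj(zeta)^q by e^(2i(p-q)t) and
    fixes A. *)
Let J_neq x p q : p != q -> J x p q = 0.
Proof.
have main p' q' : (q' < p')%N -> J x p' q' = 0.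
  move=> qp; pose m := (p' - q')%N.
  have m0 : (m.*2)%:R != 0 :> R by rewrite pnatr_eq0 double_eq0 subn_eq0 -ltnNge.
  (* Chosen so that the factor is e^(i pi) = -1, whence J = - J. *)
  pose t : R := pi / (m.*2)%:R.
  have Em : E t ^+ m.*2 = -1.
    rewrite E_exp /t mulrC divfK// /E cospi sinpi.
    by apply/eqP; rewrite eq_complex/= oppr0 !eqxx.
  have EE : E t * conjc (E t) = 1.
    apply/eqP; rewrite eq_complex/=; apply/andP; split; apply/eqP; last by ring.
    by rewrite mulrN opprK -!expr2 cos2Dsin2.
  have zr v : zeta (rot i1 i2 t v) ^+ p' * conjc (zeta (rot i1 i2 t v)) ^+ q' =
      - (zeta v ^+ p' * conjc (zeta v) ^+ q').
    have -> : zeta (rot i1 i2 t v) = E t ^+ 2 * zeta v by rewrite /zeta w_rot exprMn.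
    move: (zeta v) => z; rewrite conjcM [(E t ^+ 2 * z) ^+ p']exprMn.
    rewrite [(conjc (E t ^+ 2) * _) ^+ q']exprMn mulrACA.
    rewrite (_ : (E t ^+ 2) ^+ p' * conjc (E t ^+ 2) ^+ q' = -1) ?mulN1r//.
    rewrite -conjcX' -!exprM !mul2n -(subnK (ltnW qp)) -/m doubleD exprD -mulrA -exprMn EE.
    by rewrite expr1n mulr1.
  have JN : J x p' q' = - J x p' q'.
    rewrite {1}/J -(Rintegral_preserves mS fS (surface_measure_rot (R := R) t i12) (fun v => sphere_rot t v i12) (bJ x p' q')).
    rewrite -mulN1r -(bmf_RintegralZ mS fS _ (bJ x p' q')).
    apply: eqD_Rintegral => v _; rewrite A_rot zr.
    by case: (zeta v ^+ p' * _) => [? ?] /=; ring.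
  by lra.
by rewrite neq_ltn => /orP[?|?]; [rewrite J_sym|]; exact: main.
Qed.

Let A_ge v : S v -> 1 / 2 <= A v.
Proof.
move=> /sphere_dot v1; rewrite /A.
have : v ord0 i1 ^+ 2 + v ord0 i2 ^+ 2 <= 1.
  rewrite -v1 /dot (bigD1 i1)//= (bigD1 i2)//=.
  rewrite -!expr2 addrA lerDl; apply: sumr_ge0 => i _; exact: sqr_ge0.
by lra.
Qed.

Let J_ge0 x p : 0 <= J x p p.
Proof.
apply: Rintegral_ge0 => v Sv; apply: mulr_ge0.
  by apply: exprn_ge0; apply: le_trans (A_ge Sv); lra.
rewrite -exprMn; case: (zeta v) => [c d] /=.
rewrite (_ : (c +i* d) * (c -i* d) = (c ^+ 2 + d ^+ 2)%:C); last first.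
  by apply/eqP; rewrite eq_complex/=; apply/andP; split; apply/eqP; ring.
by rewrite -realcX /= exprn_ge0// addr_ge0// sqr_ge0.
Qed.

Let J_gt0 x : 0 < J x 0 0.
Proof.
apply: (@lt_le_trans _ _ (\int[sigma]_(v in S) ((1 / 2) ^+ x))).
  rewrite Rintegral_cst; last exact: mS.
  rewrite mulr_gt0 ?exprn_gt0 ?divr_gt0// fine_gt0// surface_sphere_gt0 ?fS//.
  exact: leq_trans n3.
apply: (bmf_le_Rintegral mS fS); [exact: bmf_cst|exact: bJ|move=> v Sv].
rewrite !expr0 mulr1 /= mulr1; apply: lerXn2r; rewrite ?nnegrE; [lra| |exact: A_ge].
by apply: le_trans (A_ge Sv); lra.
Qed.

(* In terms of z = (v_1 + i v_2)^2 the integrand is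
   (A - (z + z^* )/4)^k (A - z^* /2)^l, and only the monomials with as many z
   as z^* survive a rotation of the (v_1, v_2)-plane. *)
Lemma lamR_gt0 k l : 0 < lamR k l.
Proof.
pose c r p q : R := 'C(k, r)%:R * 'C(r, p)%:R * 'C(l, q)%:R * (-1) ^+ (r + q) * (1 / 4) ^+ r * (1 / 2) ^+ q.
pose x r q := ((k - r) + (l - q))%N.
pose term r p q := c r p q * J (x r q) (r - p) (p + q).
have E1 : lamR k l = \sum_(r < k.+1) \sum_(p < r.+1) \sum_(q < l.+1) term r p q.
  rewrite -integral_Re_lambda.
  pose g r p q v := A v ^+ (x r q) * Re (zeta v ^+ (r - p) * conjc (zeta v) ^+ (p + q)).
  have bg r p q : bmf S (fun v => c r p q * g r p q v) by apply: bmfZ; exact: bJ.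
  transitivity (\int[sigma]_(v in S) \sum_(r < k.+1) \sum_(p < r.+1) \sum_(q < l.+1) c r p q * g r p q v).
    apply: eqD_Rintegral => v _; rewrite realcX.
    have -> : (a v)%:C = (A v)%:C + (- (1 / 4))%:C * (zeta v + conjc (zeta v)).
      by apply/eqP; rewrite eq_complex/= /a /A; apply/andP; split; apply/eqP; field.
    have -> : a v +i* b v = (A v)%:C + (- (1 / 2))%:C * conjc (zeta v).
      by apply/eqP; rewrite eq_complex/= /a /b /A; apply/andP; split; apply/eqP; field.
    rewrite trinomial_expand Re_sum; apply: eq_bigr => r _.
    rewrite Re_sum; apply: eq_bigr => p _; rewrite Re_sum; apply: eq_bigr => q _.
    rewrite -!(rmorph_nat (real_complex R)) -!realcX -!realcM Re_scale /g [RHS]mulrA; congr (_ * _).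
    rewrite /c /x [(- (1 / 4)) ^+ r]exprNn [(- (1 / 2)) ^+ q]exprNn [(-1) ^+ (r + q)]exprD.
    move: ((-1) ^+ r) ((-1) ^+ q) ((1 / 4) ^+ r) ((1 / 2) ^+ q) => s1 s2 s3 s4; ring.
  rewrite (bmf_Rintegral_sum mS fS) => [|r _]; last by apply: bmf_sum => p _; exact: bmf_sum.
  apply: eq_bigr => r _; rewrite (bmf_Rintegral_sum mS fS) => [|p _]; last exact: bmf_sum.
  apply: eq_bigr => p _; rewrite (bmf_Rintegral_sum mS fS)//.
  by apply: eq_bigr => q _; rewrite (bmf_RintegralZ mS fS)//; exact: bJ.
(* A surviving term has r - p = p + q, so r + q = 2 (p + q) is even and the sign (-1)^(r + q) is
   positive. *)
have term_ge0 (r : 'I_k.+1) (p : 'I_r.+1) (q : 'I_l.+1) : 0 <= term r p q.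
  rewrite /term; have [rp|rp] := eqVneq (r - p)%N (p + q)%N; last by rewrite J_neq// mulr0.
  have rq : (r + q = (p + q).*2)%N.
    by have := leq_ord p; move: rp; rewrite -addnn; lia.
  rewrite rp mulr_ge0// /c rq -mul2n exprM sqrrN expr1n expr1n mulr1.
  by rewrite !mulr_ge0 ?ler0n ?exprn_ge0.
(* This term is the integral of A^(k + l), and A >= 1/2 on the sphere. *)
have term0_gt0 : 0 < term 0%N 0%N 0%N.
  by rewrite /term /c /x !bin0 !expr0 !mulr1 mul1r.
rewrite E1 (bigD1 ord0)//= ltr_pwDl//; last first.
  by apply: sumr_ge0 => r _; apply: sumr_ge0 => p _; apply: sumr_ge0 => q _; exact: term_ge0.
rewrite big_ord1 (bigD1 ord0)//= ltr_pwDl//.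
by apply: sumr_ge0 => q _; exact: (term_ge0 ord0 ord0 q).
Qed.

End lambda_positive.

(** * Gaussian moments on the line *)

Section integral_of_derivative.
Context (R : realType).
Local Notation mu := (@lebesgue_measure R).
Variables (G g : R -> R) (C : R).
Hypothesis dG : forall t : R, is_derive t 1 G (g t).
Hypothesis cg : continuous g.
Hypothesis ig : mu.-integrable setT (EFin \o g).
Hypothesis GC : forall t, `|t * G t| <= C.

Let I n : set R := `[- n.+1%:R, n.+1%:R].

Let integral_trunc n :
  (\int[mu]_(t in I n) (g t)%:E = (G n.+1%:R - G (- n.+1%:R))%:E)%E.
Proof.
have cG : continuous G.
  by move=> t; apply: differentiable_continuous; apply/derivable1_diffP; case: (dG t).
rewrite EFinB; apply: continuous_FTC2.
- by apply: (@lt_trans _ _ 0); rewrite ?oppr_lt0 ltr0n.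
- exact: continuous_subspaceT.
- split; first by move=> x _; case: (dG x).
    by apply: cvg_at_right_filter; exact: cG.
  by apply: cvg_at_left_filter; exact: cG.
- by move=> x _; rewrite derive1E; case: (dG x).
Qed.

Let cvg_trunc : (fun n => \int[mu]_(t in I n) (g t)%:E)%E @ \oo --> (\int[mu]_t (g t)%:E)%E.
Proof.
have mg : measurable_fun setT g by exact: continuous_measurable_fun.
pose f_ n t : \bar R := (((g \_ (I n)) t)%:E).
have := @dominated_convergence _ _ _ mu setT measurableT f_ (EFin \o g) (fun t => `|g t|%:E).
case.
- move=> n; apply/measurable_EFinP; apply/measurable_restrict => //.
  exact: measurable_itv. exact: measurable_funTS.
- exact/measurable_EFinP.
- apply: aeW => t _; apply: cvg_near_cst; near=> n.
  rewrite /f_ patchE mem_set// /I /= in_itv/= -ler_norml.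
  near: n; exists (Num.truncn `|t|) => // n /= tn.
  by apply: (le_trans (ltW (truncnS_gt _))); rewrite ler_nat.
- exact: integrable_norm.
- apply: aeW => t n _; rewrite /f_ patchE lee_fin; case: ifP => // _.
  by rewrite normr0.
move=> _ _; rewrite (_ : [sequence _]_n = (fun n => \int[mu]_(t in I n) (g t)%:E)%E)//.
by apply/funext => n /=; rewrite [RHS]integral_mkcond restrict_EFin.
Unshelve. all: by end_near. Qed.

(** Over [-n-1, n+1] the integral is a difference of values of G, which are O(1/n) by [GC];
    dominated convergence passes to the whole line. *)
Lemma integral_derivative_eq0 : \int[mu]_t g t = 0.
Proof.
have cvg0 : (fun n => (G n.+1%:R - G (- n.+1%:R))) @ \oo --> 0.
  have h : (fun n : nat => (2 * C) * (n.+1%:R)^-1) @ \oo --> 0.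
    by rewrite -[X in _ --> X](mulr0 (2 * C)); apply: cvgMr; exact: cvg_harmonic.
  apply: norm_cvg0; apply: (squeeze_cvgr _ (cvg_cst 0) h); apply: nearW => n.
  rewrite normr_ge0/= ler_pdivlMr ?ltr0n// -[X in _ * X]ger0_norm// -normrM mulrBl [_ * n.+1%:R]mulrC [G (- _) * _]mulrC.
  apply: (le_trans (ler_normB _ _)).
  have := GC (- n.+1%:R); rewrite mulNr normrN => GN.
  by apply: (le_trans (lerD (GC _) GN)); rewrite mulr_natl mulr2n.
rewrite /Rintegral (_ : (\int[mu]_t (g t)%:E)%E = 0%E)//.
have h : (fun n => \int[mu]_(t in I n) (g t)%:E)%E @ \oo --> 0%:E.
  by under eq_fun do rewrite integral_trunc; apply: cvg_EFin; [exact: nearW|exact: cvg0].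
exact: (cvg_unique _ cvg_trunc h).
Qed.

End integral_of_derivative.

Section gaussian_moments.
Context (R : realType).
Local Notation mu := (@lebesgue_measure R).

Lemma norm_exp_gauss_le j : exists C : R, forall t, `|t ^+ j * expR (- t ^+ 2)| <= C * expR (- t ^+ 2 / 2).
Proof.
(* Half of the exponent absorbs the power: |t|^j <= 1 + t^(2j), and with s = t^2/2, t^(2j) = 2^j s^j
   <= 2^j j! e^s. *)
exists (1 + 2 ^+ j * j`!%:R) => t.
have s0 : 0 <= t ^+ 2 / 2 by rewrite divr_ge0// sqr_ge0.
rewrite normrM [`|expR _|]ger0_norm ?expR_ge0//.
rewrite [in leLHS](_ : - t ^+ 2 = - (t ^+ 2 / 2) + - (t ^+ 2 / 2)); last by lra.
rewrite expRD mulrA mulNr; apply: ler_wpM2r; first exact: expR_ge0.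
rewrite expRN ler_pdivrMr ?expR_gt0// normrX.
have e1 : 1 <= expR (t ^+ 2 / 2) by rewrite -[leLHS]expR0 ler_expR.
have h1 : `|t| ^+ j <= 1 + (`|t| ^+ 2) ^+ j.
  rewrite -exprM mulnC exprM; set u := `|t| ^+ j.
  by have := sqr_ge0 (u - 1 / 2); lra.
have h2 : (`|t| ^+ 2) ^+ j <= 2 ^+ j * j`!%:R * expR (t ^+ 2 / 2).
  rewrite real_normK ?num_real// -[t ^+ 2](@divfK _ 2)// mulrC exprMn -mulrA.
  apply: ler_wpM2l; first exact: exprn_ge0.
  rewrite mulrC divfK//.
  case: j {h1} => [|j]; first by rewrite expr0 fact0 mul1r.
  rewrite [leRHS]mulrC -ler_pdivrMr ?ltr0n ?fact_gt0//.
  by apply: le_trans (expR_ge1Dxn j s0); rewrite lerDr.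
by apply: (le_trans h1); rewrite mulrDl lerD// mul1r.
Qed.

Let integrable_gauss2 : mu.-integrable setT (EFin \o (fun t : R => expR (- t ^+ 2 / 2))).
Proof.
have := integrable_normal_pdf 0 (1 : R).
move=> /(integrableZl measurableT (normal_peak 1)^-1); apply: eq_integrable => // t _ /=.
rewrite -EFinM normal_pdfE ?oner_eq0// mulrA mulVf ?mul1r ?gt_eqF ?normal_peak_gt0 ?oner_eq0//.
by rewrite /normal_fun subr0 expr1n.
Qed.

Definition gmom j : R := \int[mu]_t (t ^+ j * expR (- t ^+ 2)).

Lemma continuous_gmom j : continuous (fun t : R => t ^+ j * expR (- t ^+ 2)).
Proof. by move=> t; apply: cvgM; [exact: exprn_continuous|exact: continuous_gauss_fun]. Qed.

Lemma integrable_gmom j : mu.-integrable setT (EFin \o (fun t : R => t ^+ j * expR (- t ^+ 2))).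
Proof.
have [C Ct] := norm_exp_gauss_le j.
apply: (le_integrable _ _ _ (integrableZl measurableT C integrable_gauss2)) => //.
  by apply/measurable_EFinP; apply: continuous_measurable_fun; exact: continuous_gmom.
move=> t _ /=; rewrite lee_fin; apply: (le_trans (Ct t)); exact: ler_norm.
Qed.

Lemma gmom0 : gmom 0 = Num.sqrt pi.
Proof.
rewrite /gmom /Rintegral; under eq_integral do rewrite expr0 mul1r.
by rewrite integralT_gauss.
Qed.

Lemma gmom_by_parts j : 2 * gmom j.+1 = j%:R * gmom j.-1.
Proof.
pose g (t : R) := j%:R * (t ^+ j.-1 * expR (- t ^+ 2)) - 2 * (t ^+ j.+1 * expR (- t ^+ 2)).
have ih c i : mu.-integrable setT (EFin \o (fun t : R => c * (t ^+ i * expR (- t ^+ 2)))).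
  by apply: (eq_integrable measurableT _ _ _ (integrableZl measurableT c (integrable_gmom i))) => // t _ /=.
have ig : mu.-integrable setT (EFin \o g).
  by apply: (eq_integrable measurableT _ _ _ (integrableB measurableT (ih j%:R j.-1) (ih 2 j.+1))) => // t _ /=.
have dG (t : R) : is_derive t 1 (fun t : R => t ^+ j * expR (- t ^+ 2)) (g t).
  have d1 : is_derive t 1 (fun s : R => - s ^+ 2) (- (2 * t)).
    by apply: (is_derive_eq (@is_deriveN _ _ _ _ _ _ _ (derive_expf 2 (is_derive_id t 1)))); rewrite expr1 mulr1.
  have d2 : is_derive t 1 (fun s : R => expR (- s ^+ 2)) (- (2 * t) * expR (- t ^+ 2)).
    exact: (is_derive_eq (@is_derive1_comp _ expR (fun s : R => - s ^+ 2) t _ _ (is_derive_expR _) d1) (mulrC _ _)).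
  apply: (is_derive_eq (derive_mulf (derive_expf j (is_derive_id t 1)) d2)).
  by rewrite /g /id [t ^+ j.+1]exprS; ring.
have cg : continuous g.
  by move=> t; apply: cvgB; (apply: cvgMr; exact: continuous_gmom).
have [C GC] : exists C : R, forall t, `|t * (t ^+ j * expR (- t ^+ 2))| <= C.
  have [C GC] := norm_exp_gauss_le j.+1; exists C => t; rewrite mulrA -exprS.
  apply: (le_trans (GC t)); rewrite -[leRHS]mulr1; apply: ler_wpM2l.
    have := GC 0; rewrite expr2 mul0r oppr0 mul0r expR0 !mulr1.
    by apply: le_trans.
  by rewrite -[leRHS]expR0 ler_expR mulNr oppr_le0 divr_ge0 ?sqr_ge0.
have := integral_derivative_eq0 dG cg ig GC.
rewrite /g RintegralB; [|exact: measurableT|exact: ih|exact: ih].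
rewrite !RintegralZl; try exact: integrable_gmom; try exact: measurableT.
by move/eqP; rewrite subr_eq0 => /eqP <-.
Qed.

Lemma gmom_odd j : odd j -> gmom j = 0.
Proof.
elim/ltn_ind: j => -[|[|j]] IH // jo; apply: (@mulfI _ 2) => //.
  by rewrite gmom_by_parts mul0r mulr0.
by rewrite gmom_by_parts IH ?mulr0//= ; move: jo => /=; rewrite negbK.
Qed.

Lemma gmom_even b : gmom b.*2 = Num.sqrt pi * ((b.*2)`!%:R / (4 ^+ b * b`!%:R)).
Proof.
have f0 m : m`!%:R != 0 :> R by rewrite pnatr_eq0 -lt0n fact_gt0.
elim: b => [|b IH]; first by rewrite gmom0 fact0 expr0 !mulr1 divr1 mulr1.
apply: (@mulfI _ 2) => //; rewrite doubleS gmom_by_parts /= IH !factS !natrM exprS.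
rewrite -[b.*2.+2%:R]natr1 -[b.*2.+1%:R]natr1 -[b.+1%:R]natr1 -mul2n natrM.
by field; rewrite f0 natr1 pnatr_eq0 expf_neq0.
Qed.

End gaussian_moments.

(** * Hermite polynomials under Gaussian averages *)

Section sum_reindexing.
Context (A : nmodType).

Lemma sum_triangle m (f : nat -> nat -> A) :
  \sum_(i < m) \sum_(j < m - i) f i j = \sum_(s < m) \sum_(j < s.+1) f (s - j)%N j.
Proof.
elim: m => [|m IH]; first by rewrite !big_ord0.
rewrite [RHS]big_ord_recr /= -IH big_ord_recr /= subSnn big_ord1.
under eq_bigr => i _ do rewrite (subSn (ltnW (ltn_ord i))) big_ord_recr /=.
rewrite big_split /= -addrA; congr (_ + _).
rewrite (reindex_inj rev_ord_inj) /= [RHS]big_ord_recl /= subn0 addrC; congr (_ + _).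
by apply: eq_bigr => i _; rewrite /bump leq0n add1n subKn.
Qed.

Lemma sum_even m (g : nat -> A) : (forall j, odd j -> g j = 0) ->
  \sum_(j < m.+1) g j = \sum_(i < m./2.+1) g i.*2.
Proof.
move=> go; elim: m => [|m IH]; first by rewrite !big_ord1.
rewrite big_ord_recr /= IH uphalf_half; case: (boolP (odd m)) => mo /=.
  rewrite add1n [RHS]big_ord_recr /=; congr (_ + g _).
  by rewrite doubleS -[in LHS](odd_double_half m) mo.
by rewrite add0n go ?addr0.
Qed.

End sum_reindexing.

Section hermite.
Context (R : realType).

(* t |-> \sum_N hermite_coef m N t^(m - 2N) is the Hermite polynomial of degree
   m divided by 2^m. *)
Definition hermite_coef m N : R := (- 4^-1) ^+ N * (m`!%:R / (N`!%:R * (m - N.*2)`!%:R)).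

Definition hermite m (a s : R) : R :=
  \sum_(N < m./2.+1) hermite_coef m N * (a ^+ (m - N.*2) * s ^+ N).

Lemma natr_fact_neq0 m : m`!%:R != 0 :> R.
Proof. by rewrite pnatr_eq0 -lt0n fact_gt0. Qed.

(** Compares coefficients of a^(m - 2M) b^(2j) in [hermite_gauss]: the Hermite coefficient of index
    M - j times the Gaussian moment of order 2j yields the j-th term of (1 - b^2)^M. *)
Let coef_split m M j : (j <= M)%N -> (M.*2 <= m)%N ->
  hermite_coef m (M - j) * ('C(m - (M - j).*2, j.*2)%:R * ((j.*2)`!%:R / (4 ^+ j * j`!%:R))) =
  hermite_coef m M * ((-1) ^+ j * 'C(M, j)%:R).
Proof.
move=> jM Mm; have f0 := natr_fact_neq0.
have b1 : 'C(m - (M - j).*2, j.*2)%:R = (m - (M - j).*2)`!%:R / ((j.*2)`!%:R * (m - M.*2)`!%:R) :> R.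
  apply: (canRL (mulfK _)); first by rewrite mulf_neq0.
  have e : (m - M.*2 = (m - (M - j).*2) - j.*2)%N by rewrite doubleB; have := jM; rewrite -leq_double; lia.
  rewrite e -!natrM bin_fact//; have := jM; rewrite -leq_double doubleB; lia.
have b2 : 'C(M, j)%:R = M`!%:R / (j`!%:R * (M - j)`!%:R) :> R.
  by apply: (canRL (mulfK _)); rewrite ?mulf_neq0// -!natrM bin_fact.
have s : (- 4^-1) ^+ M = (- 4^-1) ^+ (M - j) * ((-1) ^+ j / 4 ^+ j) :> R.
  by rewrite -{1}(subnK jM) exprD [X in _ * X]exprNn exprVn.
rewrite /hermite_coef b1 b2 s.
have e2 : (-1) ^+ j * (-1) ^+ j = 1 :> R by rewrite -expr2 sqrr_sign.
move: ((-1) ^+ j) e2 ((- 4^-1) ^+ (M - j)) => e e2 q.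
have h4 : 4 ^+ j != 0 :> R by rewrite expf_neq0.
have [f1 f2 f3] := And3 (f0 (M - j)%N) (f0 j) (f0 (m - (M - j).*2)%N).
have [f4 f5 f6] := And3 (f0 (j.*2)%N) (f0 M) (f0 (m - M.*2)%N).
transitivity (q * (e * e) * (m`!%:R / ((M - j)`!%:R * (m - M.*2)`!%:R) / (4 ^+ j * j`!%:R))).
  by rewrite e2; field; rewrite f1 f2 f3 f4 f6 h4.
by field; rewrite f1 f2 f5 f6 h4.
Qed.

(* E f(a + b t) for the Gaussian density e^(-t^2) acts on Hermite polynomials by
   shrinking the variance 1 to 1 - b^2. *)
Lemma hermite_gauss m (a b : R) :
  \sum_(N < m./2.+1) hermite_coef m N *
     \sum_(j < (m - N.*2).+1) 'C(m - N.*2, j)%:R * (a ^+ (m - N.*2 - j) * b ^+ j) * gmom R j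
  = Num.sqrt pi * hermite m a (1 - b ^+ 2).
Proof.
pose f N j : R := hermite_coef m N * ('C(m - N.*2, j.*2)%:R * (a ^+ (m - N.*2 - j.*2) * b ^+ j.*2) * gmom R j.*2).
(* Odd Gaussian moments vanish, so the inner index is replaced by its double. *)
transitivity (\sum_(N < m./2.+1) \sum_(j < m./2.+1 - N) f N j).
  apply: eq_bigr => N _; rewrite mulr_sumr.
  have NM : (N <= m./2)%N by rewrite -ltnS.
  have -> : (m./2.+1 - N = (m - N.*2)./2.+1)%N.
    by lia.
  pose g j : R := hermite_coef m N * ('C(m - N.*2, j)%:R * (a ^+ (m - N.*2 - j) * b ^+ j) * gmom R j).
  by apply: (@sum_even _ (m - N.*2) g) => j jo; rewrite /g gmom_odd// !mulr0.
(* Regroups by M = N + j, the exponent of 1 - b^2. *)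
rewrite sum_triangle /hermite mulr_sumr; apply: eq_bigr => -[M /= MK] _.
have Mm : (M.*2 <= m)%N by rewrite -[m]odd_double_half; have := MK; rewrite ltnS -leq_double; lia.
rewrite exprBn !mulr_sumr; apply: eq_bigr => -[j /= jM] _.
rewrite /f gmom_even expr1n.
have -> : (m - (M - j).*2 - j.*2 = m - M.*2)%N by rewrite doubleB; have := jM; rewrite ltnS -leq_double; lia.
transitivity (Num.sqrt pi * (hermite_coef m (M - j) * ('C(m - (M - j).*2, j.*2)%:R * ((j.*2)`!%:R / (4 ^+ j * j`!%:R)))) * (a ^+ (m - M.*2) * b ^+ j.*2)).
  by ring.
rewrite coef_split// -(mul2n j) exprM -[_ *+ 'C(M, j)]mulr_natl; ring.
Qed.

End hermite.

Section Rintegral_sum.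
Context d (T : measurableType d) (R : realType) (mu : {measure set T -> \bar R}).
Context (I : Type) (s : seq I) (f : I -> T -> R).
Hypothesis fi : forall i, mu.-integrable setT (EFin \o f i).

Lemma integrable_sum_EFin : mu.-integrable setT (EFin \o (fun t => \sum_(i <- s) f i t)).
Proof.
rewrite (_ : EFin \o _ = (fun t => (\sum_(i <- s) (EFin \o f i) t)%E)).
  exact: integrable_sum.
by apply/funext => t /=; rewrite sumEFin.
Qed.

Lemma Rintegral_sum : \int[mu]_t (\sum_(i <- s) f i t) = \sum_(i <- s) \int[mu]_t f i t.
Proof.
rewrite /Rintegral; under eq_integral do rewrite -sumEFin.
rewrite (@integral_sum _ _ _ mu setT measurableT _ (fun i t => (f i t)%:E))// sum_fine// => i _.
exact: (integrable_fin_num measurableT (fi i)).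
Qed.

End Rintegral_sum.

(** * The Hermite combination of moments, its Laguerre form and the action of N *)

Section hermite_field.
Context (R : realType) (n : nat).
Hypothesis n3 : (3 <= n)%N.
Local Notation V := 'rV[R]_n.
Local Notation S := (@sphere R n).
Local Notation sigma := (@surface_measure R n).
Local Notation lam := (@lam R n).
Local Notation mu := (@lebesgue_measure R).
Implicit Types (x z v : V).
Local Notation mS := (@measurable_sphere R n).
Local Notation fS := (@sphere_fin R n).
Variables (F : V -> R) (k l : nat).
Hypothesis eF : eigen (lam l) F.
Let alpha : R := l%:R + n%:R / 2 - 1.
Let N0 := (l + k.*2)%N.

Lemma sphere_momentZ m (c : R) z : sphere_moment F m (c *: z) = c ^+ m * sphere_moment F m z.
Proof.
rewrite /sphere_moment -(bmf_RintegralZ mS fS); last first.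
  by apply: bmfM; [exact: eigen_bmf eF|apply: bmfX; exact: bmf_dot].
by apply: eqD_Rintegral => x _; rewrite dotZl exprMn; ring.
Qed.

(** The rising factorial (alpha + 1)_i. *)
Let P i : R := \prod_(j < i) (alpha + j.+1%:R).

Let alpha_gt0 : 0 < alpha.
Proof.
have : 3 <= n%:R :> R by rewrite (ler_nat R 3).
have : 0 <= l%:R :> R by exact: ler0n.
by rewrite /alpha; lra.
Qed.

Let P_neq0 i : P i != 0.
Proof. by apply/prodf_neq0 => j _; rewrite gt_eqF// addr_gt0// ltr0n. Qed.

(** Iterates the recurrence upwards from m = l, using lam (l + 2i + 2) - lam l = 4 (i + 1)(alpha + i
    + 1). *)
Lemma sphere_moment_even z i : sphere_moment F (l + i.*2) z =
  (l + i.*2)`!%:R / (l`!%:R * 4 ^+ i * i`!%:R * P i) * dot z z ^+ i * sphere_moment F l z.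
Proof.
have f0 := @natr_fact_neq0 R.
elim: i => [|i IH].
  by rewrite addn0 fact0 /P big_ord0 !expr0 !mulr1 divff// mul1r.
have a0 : alpha + i.+1%:R != 0 by rewrite gt_eqF// addr_gt0// ltr0n.
have := @sphere_moment_recurrence _ _ _ _ (l + i.+1.*2)%N z eF.
have PS : P i.+1 = P i * (alpha + i.+1%:R) by rewrite /P big_ord_recr.
rewrite doubleS !addnS /= IH PS.
rewrite (_ : _ - _ = 4 * i.+1%:R * (alpha + i.+1%:R)); last first.
  by  rewrite /lam /alpha -!natr1 natrD -mul2n natrM; field.
have h4 : 4 ^+ i != 0 :> R by rewrite expf_neq0.
have i1 : i.+1%:R != 0 :> R by rewrite pnatr_eq0.
move=> E; apply: (@mulfI _ (4 * i.+1%:R * (alpha + i.+1%:R))); first by do 2?apply: mulf_neq0 => //; rewrite pnatr_eq0.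
rewrite E [(l + i.*2).+2`!]factS [(l + i.*2).+1`!]factS [i.+1`!]factS !natrM !exprS.
rewrite -[(l + i.*2).+2%:R]natr1 addrK.
by field; rewrite nat1r a0 P_neq0 !f0 i1 h4.
Qed.

Definition hermite_field x : R :=
  \sum_(N < N0./2.+1) hermite_coef R N0 N * sphere_moment F (N0 - N.*2) x.

Let P_split i : (i <= k)%N -> \prod_(j < k - i) (k%:R + alpha - j%:R) * P i = P k.
Proof.
move=> ik; rewrite -(subnKC ik) /P addKn.
elim: (k - i)%N => [|m IH]; first by rewrite addn0 big_ord0 mul1r.
rewrite addnS [RHS]big_ord_recr /= -IH big_ord_recl /= subr0 -mulrA mulrC; congr (_ * _ * _).
  by apply: eq_bigr => j _; rewrite /bump leq0n add1n -!natr1; ring.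
exact: addrC.
Qed.

Lemma laguerre_hermite : exists2 c : R, c != 0 &
  forall x, hermite_field x = c * (laguerre k alpha).[dot x x] * sphere_moment F l x.
Proof.
have f0 := @natr_fact_neq0 R.
(* Fixed by the constant term i = 0, where binom(k + alpha, k) = P k / k!. *)
exists ((- 4^-1) ^+ k * N0`!%:R / (l`!%:R * P k)) => [|x].
  by rewrite mulf_neq0 ?invr_neq0 ?mulf_neq0 ?expf_neq0 ?oppr_eq0 ?invr_eq0.
have kN : (k <= N0./2)%N by rewrite /N0; lia.
(* For N > k the degree N0 - 2N is below l and the moment vanishes; the other terms are indexed by i
   = k - N, with degree l + 2i. *)
rewrite /hermite_field (bigID (fun N : 'I__ => (N <= k)%N)) /= addrC big1 ?add0r; last first.
  move=> N; rewrite -ltnNge => kN'; rewrite (sphere_moment_vanish n3 _ eF) ?mulr0//.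
  by apply/orP; left; have := ltn_ord N; move: kN'; rewrite /N0; move: (nat_of_ord N) => m; lia.
rewrite (big_ord_narrow_leq kN) /laguerre horner_poly mulr_sumr mulr_suml.
rewrite (reindex_inj rev_ord_inj) /=; apply: eq_bigr => -[i /= ik] _.
have -> : (k.+1 - i.+1 = k - i)%N by [].
rewrite (_ : N0 - _ = l + i.*2)%N; last by rewrite /N0 doubleB; lia.
rewrite sphere_moment_even /hermite_coef (_ : N0 - _ = l + i.*2)%N; last by rewrite /N0 doubleB; lia.
have ik' : (i <= k)%N by [].
have -> : (- 4^-1) ^+ k = (- 4^-1) ^+ (k - i) * ((-1) ^+ i / 4 ^+ i) :> R.
  by rewrite -{1}(subnK ik') exprD [X in _ * X]exprNn exprVn.
rewrite /gbinomial -(P_split ik').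
have Q0 : \prod_(j < k - i) (k%:R + alpha - j%:R) != 0.
  by have := P_neq0 k; rewrite -(P_split ik') mulf_eq0 negb_or => /andP[].
have e2 : (-1) ^+ i * (-1) ^+ i = 1 :> R by rewrite -expr2 sqrr_sign.
have h4 : 4 ^+ i != 0 :> R by rewrite expf_neq0.
move: (\prod_(j < k - i) _) Q0 ((-1) ^+ i) e2 => Q Q0 e e2.
have [f1 f2 f3] := And3 (f0 (k - i)%N) (f0 i) (f0 l).
have [f4 f5 f6] := And3 (f0 (l + i.*2)%N) (P_neq0 i) h4.
set c := (- 4^-1) ^+ (k - i).
transitivity (c * (e * e) / 4 ^+ i * N0`!%:R / (l`!%:R * i`!%:R * (k - i)`!%:R * P i) * dot x x ^+ i * sphere_moment F l x).
  by rewrite e2; field; rewrite f1 f2 f3 f4 f5 f6.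
by field; rewrite f1 f2 f3 f5 f6 Q0.
Qed.

Let bF : bmf S F. Proof. exact: eigen_bmf eF. Qed.

Let b p v N j w := F w * (dot p w ^+ (N0 - N.*2 - j) * dot v w ^+ j).

Let bmf_b p v N j : bmf S (b p v N j).
Proof. by apply: bmfM => //; apply: bmfM; apply: bmfX; exact: bmf_dot. Qed.

Let c N j : R := hermite_coef R N0 N * 'C(N0 - N.*2, j)%:R.

Let hermite_line p v t : expR (- t ^+ 2) * hermite_field (p + t *: v) =
  \sum_(N < N0./2.+1) \sum_(j < (N0 - N.*2).+1)
    c N j * (\int[sigma]_(w in S) b p v N j w) * (t ^+ j * expR (- t ^+ 2)).
Proof.
rewrite mulr_sumr; apply: eq_bigr => N _.
transitivity (expR (- t ^+ 2) * (hermite_coef R N0 N * \int[sigma]_(w in S)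
    \sum_(j < (N0 - N.*2).+1) ('C(N0 - N.*2, j)%:R * t ^+ j) * b p v N j w)).
  congr (_ * (_ * _)); apply: eqD_Rintegral => w _.
  rewrite dotDl dotZl exprDn mulr_sumr; apply: eq_bigr => j _.
  rewrite /b exprMn -[_ *+ 'C(_, _)]mulr_natl; ring.
rewrite (bmf_Rintegral_sum mS fS) => [|j _]; last exact: bmfZ.
by rewrite !mulr_sumr; apply: eq_bigr => j _; rewrite (bmf_RintegralZ mS fS)// /c; ring.
Qed.

Let integrable_term (a : R) j : mu.-integrable setT (EFin \o (fun t : R => a * (t ^+ j * expR (- t ^+ 2)))).
Proof.
by apply: (eq_integrable measurableT _ _ _ (integrableZl measurableT a (integrable_gmom R j))) => // t _ /=.
Qed.

Lemma integrable_gauss_hermite p v :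
  mu.-integrable setT (EFin \o (fun t => expR (- t ^+ 2) * hermite_field (p + t *: v))).
Proof.
under [X in EFin \o X]eq_fun do rewrite hermite_line.
by apply: integrable_sum_EFin => N; exact: integrable_sum_EFin.
Qed.

(** For each w the integrand is a Hermite polynomial in p . w + t (v . w). Averaging over t leaves
    variance 1 - (v . w)^2, the squared norm of the projection of w, and p . w equals z .
    [proj v w]. *)
Let gaussian_line v z : S v ->
  \int[mu]_t (expR (- t ^+ 2) * hermite_field (z - dot z v *: v + t *: v)) =
  \int[sigma]_(w in S) (Num.sqrt pi * (F w * hermite N0 (dot z (proj v w)) (dot (proj v w) (proj v w)))).
Proof.
move=> Sv; set p := z - _; under eq_Rintegral do rewrite hermite_line.
rewrite Rintegral_sum => [|N]; last exact: integrable_sum_EFin.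
transitivity (\sum_(N < N0./2.+1) \sum_(j < (N0 - N.*2).+1)
    c N j * (\int[sigma]_(w in S) b p v N j w) * gmom R j).
  apply: eq_bigr => N _; rewrite Rintegral_sum//.
  by apply: eq_bigr => j _; rewrite RintegralZl//; exact: integrable_gmom.
transitivity (\int[sigma]_(w in S) \sum_(N < N0./2.+1) \sum_(j < (N0 - N.*2).+1)
    (c N j * gmom R j) * b p v N j w).
  rewrite (bmf_Rintegral_sum mS fS) => [|N _]; last by apply: bmf_sum => j _; exact: bmfZ.
  apply: eq_bigr => N _; rewrite (bmf_Rintegral_sum mS fS) => [|j _]; last exact: bmfZ.
  by apply: eq_bigr => j _; rewrite (bmf_RintegralZ mS fS)// mulrAC.
apply: eqD_Rintegral => w Sw.
have -> : dot (proj v w) (proj v w) = 1 - dot v w ^+ 2.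
  rewrite /proj !(dotBl, dotBr, dotZl, dotZr) ((sphere_dot v).1 Sv) ((sphere_dot w).1 Sw) (dotC w v); ring.
have -> : dot z (proj v w) = dot p w.
  by rewrite /proj /p !(dotBl, dotBr, dotZl, dotZr) (dotC v w); ring.
rewrite mulrCA -hermite_gauss mulr_sumr; apply: eq_bigr => N _.
rewrite !mulr_sumr; apply: eq_bigr => j _; rewrite /c /b; ring.
Qed.

Lemma hermite_eigen (a : R) z :
  \int[sigma]_(v in S) (a * \int[mu]_t (expR (- t ^+ 2) * hermite_field (z - dot z v *: v + t *: v))) =
  Num.sqrt pi * lamR R n3 k l * (a * hermite_field z).
Proof.
rewrite (eqD_Rintegral _ (fun v Sv => congr1 (fun u => a * u) (gaussian_line z Sv))).
pose f N (x : V * V) := F x.1 * dot z (proj x.2 x.1) ^+ (N0 - N.*2) * dot (proj x.2 x.1) (proj x.2 x.1) ^+ N.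
have bf N : bmf (S `*` S) (f N) by exact: bmf_proj_moment.
pose h (x : V * V) := \sum_(N < N0./2.+1) (Num.sqrt pi * hermite_coef R N0 N) * f N x.
have bh : bmf (S `*` S) h by apply: bmf_sum => N _; exact: bmfZ.
transitivity (\int[sigma]_(v in S) \int[sigma]_(w in S) (a * h (w, v))).
  apply: eqD_Rintegral => v Sv; rewrite [RHS](bmf_RintegralZ mS fS); last exact: (bmf_ysection mS mS Sv bh).
  congr (_ * _); apply: eqD_Rintegral => w _.
  rewrite /hermite !mulr_sumr; apply: eq_bigr => N _; rewrite /f /=; ring.
rewrite -(Rintegral_prod21 sigma sigma mS mS (bmfZ a bh)).
rewrite (bmf_RintegralZ (@measurable_sphere2 R n) (@sphere2_fin R n))// mulrCA; congr (_ * _).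
rewrite (bmf_Rintegral_sum (@measurable_sphere2 R n) (@sphere2_fin R n)) => [|N _]; last exact: bmfZ.
rewrite /hermite_field mulr_sumr; apply: eq_bigr => N _.
rewrite (bmf_RintegralZ (@measurable_sphere2 R n) (@sphere2_fin R n))//.
(* The exponents satisfy (N0 - 2N) + 2N = l + 2k, so every N contributes the same ratio. *)
rewrite -/(proj_moment F (N0 - N.*2) N z) (proj_moment_ratio n3 eF (proj_moment_diag n3 k z eF)); first by ring.
by have := ltn_ord N; rewrite /N0; move: (nat_of_ord N) => m; lia.
Qed.

End hermite_field.

(** * The operator N on real components, and the conclusion *)

Section real_operator.
Local Open Scope complex_scope.
Context (R : realType) (n : nat).
Hypothesis n3 : (3 <= n)%N.
Local Notation V := 'rV[R]_n.
Local Notation S := (@sphere R n).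
Local Notation sigma := (@surface_measure R n).
Local Notation lam := (@lam R n).
Local Notation mu := (@lebesgue_measure R).
Local Notation Re := (@complex.Re R).
Local Notation Im := (@complex.Im R).
Implicit Types (x z v : V) (f : V -> R) (phi : V -> R[i]).
Local Notation mS := (@measurable_sphere R n).
Local Notation fS := (@sphere_fin R n).

(** All weights in N are real, so N acts in this way on the real and on the imaginary part
    separately. *)
Definition realN f z : R := expR (- (enorm z ^+ 2 / 2)) *
  \int[sigma]_(v in S) (expR (enorm (z - dot z v *: v) ^+ 2) *
    \int[mu]_t (expR (- (enorm (z - dot z v *: v + t *: v) ^+ 2 / 2)) *
      f (z - dot z v *: v + t *: v))).

Lemma Re_Nop phi z : Re (Nop phi z) = realN (fun x => Re (phi x)) z.
Proof.
rewrite /Nop {1}/gauss Re_scale; congr (_ * _); apply: eqD_Rintegral => v _.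
rewrite /exp_sqr_mul Re_scale; congr (_ * _).
by apply: eq_Rintegral => t _; rewrite /gauss Re_scale.
Qed.

Lemma Im_Nop phi z : Im (Nop phi z) = realN (fun x => Im (phi x)) z.
Proof.
rewrite /Nop {1}/gauss Im_scale; congr (_ * _); apply: eqD_Rintegral => v _.
rewrite /exp_sqr_mul Im_scale; congr (_ * _).
by apply: eq_Rintegral => t _; rewrite /gauss Im_scale.
Qed.

Let dot_proj_line z v t : S v ->
  enorm (z - dot z v *: v + t *: v) ^+ 2 = enorm (z - dot z v *: v) ^+ 2 + t ^+ 2.
Proof.
move=> /sphere_dot v1.
have : dot (z - dot z v *: v) v = 0 by rewrite dotBl dotZl v1; ring.
move: (z - _) => a av; rewrite !sqr_enorm !(dotDl, dotDr, dotZl, dotZr) v1 (dotC v a) av; ring.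
Qed.

Lemma realN_eigen k l f Y : sphere_C2 Y ->
  (forall w, S w -> - laplace_beltrami Y w = lam l * Y w) ->
  (forall rho w, 0 <= rho -> S w -> f (rho *: w) =
     expR (- (rho ^+ 2 / 2)) * (laguerre k (l%:R + n%:R / 2 - 1)).[rho ^+ 2] * rho ^+ l * Y w) ->
  forall z, realN f z = Num.sqrt pi * lamR R n3 k l * f z.
Proof.
move=> Y2 LY fY z; have eF := eigen_hom0 Y2 LY.
set F := hom0 Y in eF.
have [kappa FT] := eigen_repr n3 eF.
have [c c0 cE] := laguerre_hermite n3 k eF.
have fE x : f x = expR (- (enorm x ^+ 2 / 2)) * (kappa / c * hermite_field F k l x).
  have polar rho w : 0 <= rho -> S w -> f (rho *: w) =
      expR (- (enorm (rho *: w) ^+ 2 / 2)) * (kappa / c * hermite_field F k l (rho *: w)).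
    move=> r0 Sw; have w1 := (sphere_dot w).1 Sw.
    have rw : dot (rho *: w) (rho *: w) = rho ^+ 2 by rewrite dotZl dotZr w1; ring.
    rewrite fY// cE sqr_enorm rw (sphere_momentZ eF) mulrA.
    have -> : Y w = kappa * sphere_moment F l w by rewrite -FT// /F /hom0/= dir_id.
    by field.
  have [->|x0] := eqVneq x 0.
    (* The origin has no direction of its own; it is rho = 0 with an arbitrary unit vector. *)
    pose e : V := delta_mx ord0 (Ordinal (ltnW (ltnW n3))).
    by rewrite -(scale0r e); apply: polar => //; apply/sphere_dot; rewrite dot_delta mxE !eqxx.
  rewrite (_ : x = enorm x *: dir x); first by apply: polar; [exact: enorm_ge0|exact: dir_sphere].
  by rewrite /dir scalerA divff ?scale1r// enorm_eq0.
rewrite /realN; transitivity (expR (- (enorm z ^+ 2 / 2)) * \int[sigma]_(v in S) (kappa / c *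
    \int[mu]_t (expR (- t ^+ 2) * hermite_field F k l (z - dot z v *: v + t *: v)))).
  congr (_ * _); apply: eqD_Rintegral => v Sv; set p := z - _.
  have -> : \int[mu]_t (expR (- (enorm (p + t *: v) ^+ 2 / 2)) * f (p + t *: v)) =
      \int[mu]_t (expR (- enorm p ^+ 2) * (kappa / c) * (expR (- t ^+ 2) * hermite_field F k l (p + t *: v))).
    (* The Gaussian weight of N and that of f combine, as p is orthogonal to v, to e^(-|p|^2)
       e^(-t^2); the first factor then cancels e^(|p|^2). *)
    apply: eq_Rintegral => t _; rewrite fE mulrA -expRD dot_proj_line// -/p.
    rewrite (_ : - _ + - _ = - enorm p ^+ 2 + - t ^+ 2); last by lra.
    by rewrite expRD; ring.
  rewrite RintegralZl//; last exact: integrable_gauss_hermite.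
  by rewrite !mulrA -expRD subrr expR0 mul1r.
rewrite (hermite_eigen n3 k eF) fE; ring.
Qed.

End real_operator.

Theorem theorem1p2 (R : realType) (d : nat) (hd : (3 <= d)%N) (k l : nat) :
  (0 < lambda R hd k l)%R /\
  forall phi : 'rV[R]_d -> R[i]%C, Vkl k l phi ->
  forall z : 'rV[R]_d, Nop phi z = lambda R hd k l * phi z.
Proof.
have c_gt0 : 0 < Num.sqrt pi * lamR R hd k l.
  by rewrite mulr_gt0 ?lamR_gt0// sqrtr_gt0 pi_gt0.
(* In the order of [R[i]], being positive means having zero imaginary part and positive real
   part. *)
rewrite lambdaE; split; first by rewrite ltcE /= eqxx.
move=> phi [Y [Y2r Y2i LY] phiY] z.
have LYC w : sphere w -> - laplace_beltramiC Y w = (lam R d l)%:C%C * Y w.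
  move=> Sw; rewrite LY//; congr (_ * _).
  by rewrite /lam -!(rmorph_nat (real_complex R)) -rmorphD -rmorphB -rmorphM.
apply/eqP; rewrite eq_complex Re_Nop Im_Nop Re_scale Im_scale; apply/andP; split; apply/eqP.
  apply: (realN_eigen hd Y2r) => [w Sw|rho w r0 Sw].
    by rewrite -Re_scale -LYC.
  by rewrite phiY// Re_scale.
apply: (realN_eigen hd Y2i) => [w Sw|rho w r0 Sw].
  by rewrite -Im_scale -LYC.
by rewrite phiY// Im_scale.
Qed.
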